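(* Let $\mathcal{K}_o$ be the space of origin-symmetric convex disks in $\mathbb{R}^2$ with the topology induced by Hausdorff distance. A typical element $C$ of $\mathcal{K}_o$ (i.e. every element $C$ of some residual subset of $\mathcal{K}_o$) satisfies the property that for every integer $n \geq 4$ there is a $C$-convex disk $K$ with \[ \hat{a}_{n-1}^C(K) + \hat{a}_{n+1}^C(K) > 2 \hat{a}_n^C(K). \]
   Context: A convex disk is a compact, convex set in $\mathbb{R}^2$ with nonempty interior. In a topological space $\mathcal{F}$, a subset is called residual if it is a countable intersection of sets each of which has dense interior in $\mathcal{F}$; the elements of a residual subset are called typical. For an origin-symmetric convex disk $C$ and $p,q\in\mathbb{R}^2$ (not necessarily distinct), the $C$-spindle $[p,q]_C$ is the intersection of all translates of $C$ that contain $p$ and $q$ if such a translate exists, and $[p,q]_C=\mathbb{R}^2$ otherwise. A set $K\subset\mathbb{R}^2$ is $C$-convex if $[p,q]_C \subseteq K$ for all $p,q\in K$. A $C$-convex disk is a convex disk that is $C$-convex. For $n \ge 3$, a $C$-$n$-gon is an intersection of $n$ translates of $C$ (the translates need not be distinct). A $C$-$n$-gon $Q$ is inscribed in $K$ if $Q\subseteq K$. For $n\ge 3$ and a $C$-convex disk $K$, $\hat{a}_n^C(K) = \sup \{ \mathrm{area}(Q) : Q \text{ is a } C\text{-}n\text{-gon inscribed in } K \}$, where $\mathrm{area}(\cdot)$ is 2-dimensional Lebesgue measure. *)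

(* Defs.v *)
From HB Require Import structures.
From mathcomp Require Import all_boot all_order all_algebra.
From mathcomp Require Import all_classical all_reals all_analysis.
From mathcomp Require Import ring lra.

Set Implicit Arguments.
Unset Strict Implicit.
Unset Printing Implicit Defensive.

Import Order.TTheory GRing.Theory Num.Theory.
Import numFieldNormedType.Exports.

Local Open Scope classical_set_scope.
Local Open Scope ring_scope.

(* The library norm on a product is the maximum norm; it induces the usual
   topology of the plane, but distances below are Euclidean. *)
Definition plane (R : realType) : normedModType R := (R^o * R^o)%type.

Section Hausdorff.
Context {R : realType}.
Implicit Types (x y z : plane R) (A B C : set (plane R)).

Definition eucl_dist x y : R :=
  Num.sqrt ((x.1 - y.1) ^+ 2 + (x.2 - y.2) ^+ 2).

Definition inf_dist x A : R := inf [set eucl_dist x a | a in A].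

(* Meaningful for nonempty bounded sets only, where all the suprema and infima
   are those of nonempty bounded sets of reals. *)
Definition hausdorff_dist A B : R :=
  Num.max (sup [set inf_dist a B | a in A]) (sup [set inf_dist b A | b in B]).

Definition convex_disk A :=
  [/\ compact A, @convex_set R (plane R) A & A° !=set0].

Definition origin_symmetric A := [set - x | x in A] = A.

End Hausdorff.

Record osym_disk (R : realType) := OsymDisk {
  osym_disk_set :> set (plane R);
  osym_disk_convex : convex_disk osym_disk_set;
  osym_disk_sym : origin_symmetric osym_disk_set }.

HB.instance Definition _ (R : realType) := gen_eqMixin (osym_disk R).
HB.instance Definition _ (R : realType) := gen_choiceMixin (osym_disk R).

Section HausdorffMetric.
Context {R : realType}.
Implicit Types (x y z : plane R) (A B C : set (plane R)).

Lemma eucl_dist_ge0 x y : 0 <= eucl_dist x y.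
Proof. exact: sqrtr_ge0. Qed.

Lemma eucl_distxx x : eucl_dist x x = 0.
Proof. by rewrite /eucl_dist !subrr expr0n addr0 sqrtr0. Qed.

Lemma eucl_dist_sym x y : eucl_dist x y = eucl_dist y x.
Proof. by congr Num.sqrt; ring. Qed.

Lemma eucl_dist_triangle y x z :
  eucl_dist x z <= eucl_dist x y + eucl_dist y z.
Proof.
have sq u v : eucl_dist u v ^+ 2 = (u.1 - v.1) ^+ 2 + (u.2 - v.2) ^+ 2.
  by rewrite sqr_sqrtr// addr_ge0// sqr_ge0.
rewrite -(@ler_pXn2r _ 2) ?nnegrE ?addr_ge0 ?eucl_dist_ge0// sqrrD !sq.
set a := x.1 - y.1; set b := x.2 - y.2; set c := y.1 - z.1; set d := y.2 - z.2.
have -> : x.1 - z.1 = a + c by rewrite /a /c; ring.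
have -> : x.2 - z.2 = b + d by rewrite /b /d; ring.
have : a * c + b * d <= eucl_dist x y * eucl_dist y z.
  rewrite (le_trans (ler_norm _))// -(@ler_pXn2r _ 2) ?nnegrE//; last first.
    by rewrite mulr_ge0// eucl_dist_ge0.
  rewrite real_normK ?num_real// exprMn !sq -/a -/b -/c -/d.
  have := sqr_ge0 (a * d - b * c); nra.
rewrite mulr2n; nra.
Qed.

Lemma norm_le_eucl_dist x y : `|x - y| <= eucl_dist x y.
Proof.
rewrite prod_normE/= ge_max /eucl_dist -!sqrtr_sqr !ler_wsqrtr//.
  by rewrite lerDr sqr_ge0.
by rewrite lerDl sqr_ge0.
Qed.

Lemma eucl_dist_le_norm x y : eucl_dist x y <= 2 * `|x - y|.
Proof.
have h1 : `|x.1 - y.1| <= `|x - y| by rewrite [leRHS]prod_normE le_max lexx.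
have h2 : `|x.2 - y.2| <= `|x - y| by rewrite [leRHS]prod_normE le_max lexx orbT.
rewrite -(@ler_pXn2r _ 2) ?nnegrE ?mulr_ge0 ?eucl_dist_ge0//.
rewrite sqr_sqrtr ?addr_ge0 ?sqr_ge0//.
rewrite -[X in X + _]real_normK ?num_real// -[X in _ + X]real_normK ?num_real//.
have := normr_ge0 (x.1 - y.1); have := normr_ge0 (x.2 - y.2); nra.
Qed.

Lemma inf_dist_has_lbound x A : has_lbound [set eucl_dist x a | a in A].
Proof. by exists 0 => _ [a _ <-]; exact: eucl_dist_ge0. Qed.

Lemma inf_dist_le x A a : A a -> inf_dist x A <= eucl_dist x a.
Proof.
by move=> Aa; apply: ge_inf; [exact: inf_dist_has_lbound | exists a].
Qed.

Lemma inf_dist_ge x A r : A !=set0 ->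
  (forall a, A a -> r <= eucl_dist x a) -> r <= inf_dist x A.
Proof.
move=> [a0 Aa0] h; apply: lb_le_inf; first by exists (eucl_dist x a0), a0.
by move=> _ [a Aa <-]; exact: h.
Qed.

Lemma hausdorff_dist_sym A B : hausdorff_dist A B = hausdorff_dist B A.
Proof. exact: maxC. Qed.

Lemma hausdorff_dist_le A B r : A !=set0 -> B !=set0 ->
  (forall a, A a -> inf_dist a B <= r) ->
  (forall b, B b -> inf_dist b A <= r) -> hausdorff_dist A B <= r.
Proof.
move=> [a Aa] [b Bb] hA hB; rewrite /hausdorff_dist ge_max; apply/andP; split.
  by apply: ge_sup => [|_ [x /hA ? <-]//]; exists (inf_dist a B), a.
by apply: ge_sup => [|_ [x /hB ? <-]//]; exists (inf_dist b A), b.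
Qed.

Lemma inf_dist_le_hausdorff A B a : compact A -> B !=set0 -> A a ->
  inf_dist a B <= hausdorff_dist A B.
Proof.
move=> cA [b Bb] Aa; rewrite /hausdorff_dist le_max; apply/orP; left.
apply: ub_le_sup; last by exists a.
have [M [_ hM]] := compact_bounded cA.
exists (2 * ((M + 1) + `|b|)) => _ [x Ax <-].
rewrite (le_trans (inf_dist_le _ Bb))// (le_trans (eucl_dist_le_norm _ _))//.
rewrite ler_pM2l// (le_trans (ler_normB _ _))// lerD2r.
by apply: hM Ax; rewrite ltrDl.
Qed.

Lemma inf_dist_eq0 A x : closed A -> A !=set0 -> inf_dist x A <= 0 -> A x.
Proof.
move=> clA A0 h; apply: clA => U /nbhs_ballP[e /= e0 eU].
have [[a Aa xa]|nex] := pselect (exists2 a, A a & eucl_dist x a < e).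
  exists a; split=> //; apply: eU; rewrite -ball_normE/=.
  exact: le_lt_trans (norm_le_eucl_dist _ _) xa.
suff : e <= 0 by rewrite leNgt e0.
apply: le_trans h; apply: inf_dist_ge => // a Aa.
by rewrite leNgt; apply/negP => xa; apply: nex; exists a.
Qed.

Lemma osym_disk_compact (C : osym_disk R) : compact C.
Proof. by have [] := osym_disk_convex C. Qed.

Lemma osym_disk_nonempty (C : osym_disk R) : C !=set0.
Proof.
by have [_ _ [x /interior_subset Cx]] := osym_disk_convex C; exists x.
Qed.

Lemma osym_disk_closed (C : osym_disk R) : closed C.
Proof. by apply: compact_closed; [exact: norm_hausdorff | exact: osym_disk_compact]. Qed.

Lemma osym_disk_inj (C D : osym_disk R) : C = D :> set (plane R) -> C = D.
Proof.
case: C => C c1 c2; case: D => D d1 d2 /= CD; subst D.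
by congr OsymDisk; exact: Prop_irrelevance.
Qed.

End HausdorffMetric.

Section OsymDiskMetric.
Context {R : realType}.
Implicit Types (x : plane R) (C D E : osym_disk R).

Let hd C D : R := hausdorff_dist C D.

Let hd_ge0 C D : 0 <= hd C D.
Proof.
have [x Cx] := osym_disk_nonempty C.
apply: (@le_trans _ _ (inf_dist x D)).
  apply: inf_dist_ge => [|*]; [exact: osym_disk_nonempty|].
  exact: eucl_dist_ge0.
apply: inf_dist_le_hausdorff => //;
  [exact: osym_disk_compact | exact: osym_disk_nonempty].
Qed.

Let hdxx C : hd C C = 0.
Proof.
apply/eqP; rewrite eq_le hd_ge0 andbT.
have h x : (C : set _) x -> inf_dist x C <= 0.
  by move=> Cx; rewrite -(eucl_distxx x); exact: inf_dist_le.
by apply: hausdorff_dist_le => //; exact: osym_disk_nonempty.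
Qed.

Let hd_sub C D : hd C D = 0 -> C `<=` D.
Proof.
move=> CD x Cx; apply: inf_dist_eq0;
  [exact: osym_disk_closed | exact: osym_disk_nonempty |].
rewrite -CD; apply: inf_dist_le_hausdorff => //;
  [exact: osym_disk_compact | exact: osym_disk_nonempty].
Qed.

Let hd_sym C D : hd C D = hd D C.
Proof. exact: hausdorff_dist_sym. Qed.

Let hd_positivity C D : hd C D = 0 -> C = D.
Proof.
move=> CD; apply/osym_disk_inj/seteqP.
by split; apply: hd_sub; rewrite // hd_sym.
Qed.

Let hd_triangle D C E : hd C E <= hd C D + hd D E.
Proof.
have h C' D' E' x : (C' : set _) x ->
    inf_dist x E' <= hd C' D' + hd D' E'.
  move=> Cx.
  have : inf_dist x D' <= hd C' D'.
    apply: inf_dist_le_hausdorff => //;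
      [exact: osym_disk_compact | exact: osym_disk_nonempty].
  rewrite -(lerD2r (hd D' E')); apply: le_trans.
  rewrite -lerBlDr; apply: inf_dist_ge => [|d Dd].
    exact: osym_disk_nonempty.
  have : inf_dist d E' <= hd D' E'.
    apply: inf_dist_le_hausdorff => //;
      [exact: osym_disk_compact | exact: osym_disk_nonempty].
  suff : inf_dist x E' <= eucl_dist x d + inf_dist d E' by lra.
  rewrite -lerBlDl; apply: inf_dist_ge => [|e Ee].
    exact: osym_disk_nonempty.
  by rewrite lerBlDl (le_trans (inf_dist_le _ Ee))// eucl_dist_triangle.
apply: hausdorff_dist_le; [exact: osym_disk_nonempty..| |] => x.
  exact: h.
by move=> Ex; rewrite (hd_sym C D) (hd_sym D E) addrC; exact: h.
Qed.

HB.instance Definition _ := @isMetric.Build R (osym_disk R)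
  hd hdxx hd_positivity hd_sym hd_triangle.

Lemma osym_disk_mdistE C D :
  @mdist R (osym_disk R) C D = hausdorff_dist C D.
Proof. by []. Qed.

End OsymDiskMetric.

Definition residual (T : topologicalType) (S : set T) :=
  exists2 F : nat -> set T, (forall i, dense (F i)°) & S = \bigcap_i F i.

Section Spindle.
Context {R : realType} (C : osym_disk R).
Implicit Types (p q v : plane R) (K Q : set (plane R)).

Definition translate v : set (plane R) := [set v + x | x in C].

(* An intersection over an empty index set is setT, so this is the whole plane
   when no translate contains both points. *)
Definition spindle p q : set (plane R) :=
  \bigcap_(v in [set v | translate v p /\ translate v q]) translate v.

Definition spindle_convex K := forall p q, K p -> K q -> spindle p q `<=` K.

Definition spindle_convex_disk K := convex_disk K /\ spindle_convex K.

(* Used for 3 <= n only. *)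
Definition ngon n Q :=
  exists v : 'I_n -> plane R, Q = \bigcap_i translate (v i).

Definition area Q : \bar R := (@lebesgue_measure R \x @lebesgue_measure R)%E Q.

Definition max_inscribed_area n K : \bar R :=
  ereal_sup [set area Q | Q in [set Q | ngon n Q /\ Q `<=` K]].

End Spindle.

(* Main.v *)
(* At scales much smaller than d, the boundary of the sum of a disk and a disc of
   radius d is almost straight.  Cut off a tiny cap at the top (and symmetrically
   at the bottom) of such a sum, replacing it by three segments of slopes
   B, 0, -B.  Translates of the resulting disk C can then play the role of almost
   arbitrary half-planes, or of the region below a three-segment roof.

   Let N = n - 2, and let K be the intersection of n + 1 translates: N of them cut
   out a deep convex chain of lower edges, two cut out steep sides, and one cuts
   out the roof.  Lowering the roof until it ends at the ends of the chain makes
   the two sides redundant, so K contains an (n - 1)-gon L, and the area of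
   K \ L is at most 2 + B / 4.  An n-gon Q inside K must do more than half of that
   damage.  Indeed, Q avoids a point just below the middle of each lower edge, and
   all points just above the roof.  Unless Q loses a large region anyway, each
   translate that excludes one of the former points excludes none of the others
   (two excluded points far apart, on a segment crossing the body transversally,
   contradict that it contains a large disc through each of its points), so that
   only two translates are left to exclude all points above the roof.  One of them
   excludes the left end, the other one the right end, and they change roles at
   some point X; hence Q lies essentially below the path joining both ends to X,
   and loses an area of at least 1 + B / 8 + B / 64.

   All the inequalities are strict and survive a small perturbation of C, whence an
   open dense set of disks for each n. *)
Require Import Defs.
From mathcomp Require Import all_boot all_order all_algebra.
From mathcomp Require Import boolp.
From mathcomp Require Import ring lra zify.
Set Implicit Arguments.
Unset Strict Implicit.
Unset Printing Implicit Defensive.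
Import Order.TTheory GRing.Theory Num.Theory.
Local Open Scope ring_scope.

(** * Discs and crossing segments *)

(** At leading order the factor one half is a tie: under a flat roof of width 2 and height 1,
    lowering the roof costs the whole rectangle, of area 2, while keeping only a triangle over the
    same base costs half of it. The slopes [B] break the tie. Lowering is a translation, so the
    bevelled part of the roof is not lost, and to first order the cost is [2 + ee], where [ee] is
    the width of a steep side. The region under the roof has area [2 + 3 * B / 4 + ee] and a
    triangle in it at most about [1 + B / 2 + ee], so an inscribed polygon loses about [1 + B / 4]
    whatever [ee] is. Thus [ee < B / 2] is what is needed, and [ee = B / 4] leaves room for the
    errors. The errors must be small compared with [B], which in turn depends on the disk to be
    approximated; hence [B] is fixed first, then the chain, then the tolerances, and last the radius
    [D], so large that arcs are nearly straight. Boundary arcs are never parametrized: the sum with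
    a disc enters only through discs of radius [D] inside it and through its supporting lines, which
    turns the geometry into polynomial inequalities. *)

Definition in_disc (R : realFieldType) (c1 c2 r x y : R) : Prop :=
  (x - c1) ^+ 2 + (y - c2) ^+ 2 <= r ^+ 2.

Definition convex2 (R : realFieldType) (T : R -> R -> Prop) : Prop :=
  forall x1 y1 x2 y2 t, 0 <= t <= 1 -> T x1 y1 -> T x2 y2 ->
  T ((1 - t) * x1 + t * x2) ((1 - t) * y1 + t * y2).

Definition rolling (R : realFieldType) (D : R) (T : R -> R -> Prop) : Prop :=
  forall x y, T x y ->
  exists c1 c2, in_disc c1 c2 D x y /\ forall x' y', in_disc c1 c2 D x' y' -> T x' y'.

Section Cross.
Variable R : rcfType.
Implicit Types (T : R -> R -> Prop).

(** [W] is the squared distance of a point from the centre of a disc of radius [D]; [p] and [q] are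
    the inner products of the vector to the centre with a vector of length [l] and with its normal.
    Advancing [t] times that vector can leave the disc only if the point is near the boundary and
    the centre lies almost sideways. Then [q >= l * D / 2], and a sideways correction [m] of the
    order of the sag of an arc leads back into the disc. *)
Lemma disc_step (D l t p q W : R) : 0 < D -> 0 < l -> 0 <= t -> 0 <= p -> 0 <= q ->
  2 * t * l <= D -> W <= D ^+ 2 -> p ^+ 2 + q ^+ 2 = l ^+ 2 * W ->
  exists2 m, 0 <= m <= 2 * t ^+ 2 * l / D &
    W - 2 * t * p - 2 * m * q + (t ^+ 2 + m ^+ 2) * l ^+ 2 <= D ^+ 2.
Proof.
move=> D0 l0 t0 p0 q0 tl WD pq.
have tl2 : 4 * (t * l) ^+ 2 <= D ^+ 2.
  have : 0 <= t * l by rewrite mulr_ge0// ltW.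
  nra.
have m0 : 0 <= 2 * t ^+ 2 * l / D.
  by rewrite divr_ge0 ?(ltW D0)// !mulr_ge0 ?sqr_ge0// ltW.
have [pt|pt] := leP (t * l ^+ 2) (2 * p).
  exists 0; first by rewrite lexx.
  have : t * (t * l ^+ 2) <= t * (2 * p) by rewrite ler_wpM2l.
  nra.
have [Wt|Wt] := leP (W + (t * l) ^+ 2) (D ^+ 2).
  exists 0; first by rewrite lexx.
  have : 0 <= t * p by rewrite mulr_ge0.
  rewrite exprMn in Wt; nra.
set m := 2 * t ^+ 2 * l / D; exists m; first by rewrite m0 lexx.
have mD : m * D = 2 * t ^+ 2 * l by rewrite /m divfK// gt_eqF.
have p2 : 4 * p ^+ 2 <= (t * l ^+ 2) ^+ 2 by nra.
have qlb : l * D <= 2 * q.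
  suff : (l * D) ^+ 2 <= (2 * q) ^+ 2.
    by rewrite ler_pXn2r// nnegrE mulr_ge0// ltW.
  have -> : (2 * q) ^+ 2 = 4 * (l ^+ 2 * W) - 4 * p ^+ 2 by rewrite -pq; ring.
  have h1 : l ^+ 2 * (D ^+ 2 - (t * l) ^+ 2) <= l ^+ 2 * W.
    by rewrite ler_wpM2l ?sqr_ge0//; lra.
  have h2 : l ^+ 2 * (4 * (t * l) ^+ 2) <= l ^+ 2 * D ^+ 2.
    by rewrite ler_wpM2l ?sqr_ge0.
  have e1 : (t * l ^+ 2) ^+ 2 = l ^+ 2 * (t * l) ^+ 2 by ring.
  have e2 : (l * D) ^+ 2 = l ^+ 2 * D ^+ 2 by ring.
  rewrite e1 in p2; rewrite e2.
  have h3 : 0 <= l ^+ 2 * (t * l) ^+ 2 by rewrite mulr_ge0// sqr_ge0.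
  rewrite mulrBr mulrCA in h1 h2.
  lra.
have ml : 2 * (m * l) <= D.
  have : (2 * (m * l)) * D <= D * D.
    have -> : 2 * (m * l) * D = 4 * (t * l) ^+ 2.
      by transitivity (2 * l * (m * D)); [ring | rewrite mD; ring].
    by rewrite -expr2.
  by rewrite ler_pM2r.
have h1 : m * (l * D) <= m * (2 * q) by rewrite ler_wpM2l.
have h2 : (m * l) * (2 * (m * l)) <= (m * l) * D.
  by rewrite ler_wpM2l// mulr_ge0// ltW.
have h3 : m * (l * D) = 2 * (t * l) ^+ 2.
  by transitivity (l * (m * D)); [ring | rewrite mD; ring].
have h4 : 0 <= t * p by rewrite mulr_ge0.
lra.
Qed.

(** [disc_step] with [t = 2 + k] gives a point of [T] ahead of [w], displaced by [m <= b] towards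
    the centre. The given point is displaced by [b] to the other side and is at most [k] steps
    behind. So the segment joining them meets the line through [w] in direction [d] at a parameter
    of at least [(- k + (2 + k)) / 2 = 1]. *)
Lemma core_cross T c1 c2 D w1 w2 d1 d2 s l a b k th :
  convex2 T -> (forall x y, in_disc c1 c2 D x y -> T x y) ->
  in_disc c1 c2 D w1 w2 -> 0 < D -> 0 < l -> l ^+ 2 = d1 ^+ 2 + d2 ^+ 2 ->
  s ^+ 2 = 1 -> 0 <= k -> - k <= a -> 0 <= th <= 1 ->
  2 * (2 + k) * l <= D -> 2 * (2 + k) ^+ 2 * l / D <= b ->
  0 <= d1 * (c1 - w1) + d2 * (c2 - w2) ->
  0 <= s * (d1 * (c2 - w2) - d2 * (c1 - w1)) ->
  T (w1 + a * d1 + b * s * d2) (w2 + a * d2 - b * s * d1) ->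
  T (w1 + th * d1) (w2 + th * d2).
Proof.
move=> cT dT dw D0 l0 ld s1 k0 ka /andP[th0 th1] tl tb p0 q0 Ty.
have t0 : 0 <= 2 + k by lra.
set W := (w1 - c1) ^+ 2 + (w2 - c2) ^+ 2.
have WD : W <= D ^+ 2 by exact: dw.
have pq : (d1 * (c1 - w1) + d2 * (c2 - w2)) ^+ 2 +
   (s * (d1 * (c2 - w2) - d2 * (c1 - w1))) ^+ 2 = l ^+ 2 * W.
  by rewrite exprMn s1 ld /W; ring.
have [m /andP[m0 mb] hm] := disc_step D0 l0 t0 p0 q0 tl WD pq.
set t := 2 + k in t0 tl tb hm mb.
have b0 : 0 < b.
  apply: lt_le_trans tb; rewrite divr_gt0// mulr_gt0// mulr_gt0// exprn_gt0//.
  by rewrite /t; lra.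
have Tu : T (w1 + t * d1 - m * s * d2) (w2 + t * d2 + m * s * d1).
  apply: dT; rewrite /in_disc; apply: le_trans hm.
  suff -> : (w1 + t * d1 - m * s * d2 - c1) ^+ 2 +
       (w2 + t * d2 + m * s * d1 - c2) ^+ 2 =
    W - 2 * t * (d1 * (c1 - w1) + d2 * (c2 - w2)) -
     2 * m * (s * (d1 * (c2 - w2) - d2 * (c1 - w1))) +
     (t ^+ 2 + m ^+ 2 * s ^+ 2) * (d1 ^+ 2 + d2 ^+ 2).
    by rewrite s1 -ld mulr1.
  by rewrite /W; ring.
have mb' : m <= b by exact: le_trans mb tb.
have bm : 0 < b + m by lra.
set la := b / (b + m).
have lab : la * (b + m) = b by rewrite /la divfK// gt_eqF.
have la0 : 2^-1 <= la by rewrite /la ler_pdivlMr//; lra.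
have la1 : la <= 1 by rewrite /la ler_pdivrMr//; lra.
have := cT _ _ _ _ la _ Ty Tu; set g := (1 - la) * a + la * t.
have -> : (1 - la) * (w1 + a * d1 + b * s * d2) +
    la * (w1 + t * d1 - m * s * d2) = w1 + g * d1 + (b - la * (b + m)) * s * d2.
  by rewrite /g; ring.
have -> : (1 - la) * (w2 + a * d2 - b * s * d1) +
    la * (w2 + t * d2 + m * s * d1) = w2 + g * d2 - (b - la * (b + m)) * s * d1.
  by rewrite /g; ring.
rewrite lab subrr !mul0r addr0 subr0 => Tg.
have {}Tg : T (w1 + g * d1) (w2 + g * d2) by apply: Tg; lra.
have g1 : 1 <= g.
  have h1 : (1 - la) * (- k) <= (1 - la) * a by rewrite ler_wpM2l//; lra.
  rewrite /g /t; nra.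
have g0 : 0 < g by lra.
have := cT _ _ _ _ (th / g) _ (dT _ _ dw) Tg.
have hx u v : (1 - th / g) * u + th / g * (u + g * v) = u + th * v.
  by rewrite mulrDr mulrA divfK ?gt_eqF//; ring.
rewrite !hx; apply.
by rewrite divr_ge0 ?(ltW g0)//= ler_pdivrMr// mul1r (le_trans th1).
Qed.

(** Resolves [y] into its components [a] and [b] along and across [d]. Since [y] is within [rho] of
    [w] and [d] has length at least [l0], the component [a] is at least [- rho / l0]. *)
Lemma cross_aux T c1 c2 D l0 rho w1 w2 d1 d2 s y1 y2 th :
  convex2 T -> (forall x y, in_disc c1 c2 D x y -> T x y) ->
  in_disc c1 c2 D w1 w2 -> 0 < D -> 0 < l0 -> 2 * (2 + rho / l0) * rho <= D ->
  s ^+ 2 = 1 -> 0 <= th <= 1 -> 0 <= rho ->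
  l0 ^+ 2 <= d1 ^+ 2 + d2 ^+ 2 <= rho ^+ 2 ->
  (y1 - w1) ^+ 2 + (y2 - w2) ^+ 2 <= rho ^+ 2 ->
  0 <= d1 * (c1 - w1) + d2 * (c2 - w2) ->
  0 <= s * (d1 * (c2 - w2) - d2 * (c1 - w1)) ->
  s * (d1 * (y2 - w2) - d2 * (y1 - w1)) <=
    - (2 * (2 + rho / l0) ^+ 2 * rho ^+ 3 / D) ->
  T y1 y2 -> T (w1 + th * d1) (w2 + th * d2).
Proof.
move=> cT dT dw D0 l00 rD s1 th01 rho0 /andP[ld dr] yw p0 q0 cy Ty.
set k := rho / l0; have k0 : 0 <= k by rewrite divr_ge0// ltW.
have kl0 : k * l0 = rho by rewrite /k divfK// gt_eqF.
have S0 : 0 <= d1 ^+ 2 + d2 ^+ 2 by rewrite addr_ge0 ?sqr_ge0.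
pose l := Num.sqrt (d1 ^+ 2 + d2 ^+ 2).
have l2 : l ^+ 2 = d1 ^+ 2 + d2 ^+ 2 by rewrite sqr_sqrtr.
have l_ge0 : 0 <= l by exact: sqrtr_ge0.
have l0l : l0 <= l by rewrite -(@ler_pXn2r _ 2) ?nnegrE ?(ltW l00)// l2.
have lr : l <= rho by rewrite -(@ler_pXn2r _ 2) ?nnegrE// l2.
have l_gt0 : 0 < l by exact: lt_le_trans l00 l0l.
have l2_gt0 : 0 < l ^+ 2 by rewrite exprn_gt0.
set e1 := y1 - w1 in yw cy *; set e2 := y2 - w2 in yw cy *.
pose a := (d1 * e1 + d2 * e2) / l ^+ 2.
pose b := - (s * (d1 * e2 - d2 * e1)) / l ^+ 2.
have al : a * l ^+ 2 = d1 * e1 + d2 * e2 by rewrite /a divfK// gt_eqF.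
have bl : b * l ^+ 2 = - (s * (d1 * e2 - d2 * e1)) by rewrite /b divfK// gt_eqF.
have Ey1 : w1 + a * d1 + b * s * d2 = y1.
  suff : (w1 + a * d1 + b * s * d2) * l ^+ 2 = y1 * l ^+ 2.
    by move/(mulIf (lt0r_neq0 l2_gt0)).
  transitivity (w1 * l ^+ 2 + (a * l ^+ 2) * d1 + s * (b * l ^+ 2) * d2); first by ring.
  transitivity (w1 * l ^+ 2 + (d1 * e1 + d2 * e2) * d1 - s ^+ 2 * (d1 * e2 - d2 * e1) * d2).
    by rewrite al bl; ring.
  by rewrite s1 l2 /e1 /e2; ring.
have Ey2 : w2 + a * d2 - b * s * d1 = y2.
  suff : (w2 + a * d2 - b * s * d1) * l ^+ 2 = y2 * l ^+ 2.
    by move/(mulIf (lt0r_neq0 l2_gt0)).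
  transitivity (w2 * l ^+ 2 + (a * l ^+ 2) * d2 - s * (b * l ^+ 2) * d1); first by ring.
  transitivity (w2 * l ^+ 2 + (d1 * e1 + d2 * e2) * d2 + s ^+ 2 * (d1 * e2 - d2 * e1) * d1).
    by rewrite al bl; ring.
  by rewrite s1 l2 /e1 /e2; ring.
apply: (@core_cross T c1 c2 D w1 w2 d1 d2 s l a b k th) => //; last by rewrite Ey1 Ey2.
- have cs : (d1 * e1 + d2 * e2) ^+ 2 <= (l * rho) ^+ 2.
    have e : (d1 * e1 + d2 * e2) ^+ 2 =
        l ^+ 2 * (e1 ^+ 2 + e2 ^+ 2) - (d1 * e2 - d2 * e1) ^+ 2 by rewrite l2; ring.
    have h1 := sqr_ge0 (d1 * e2 - d2 * e1).
    have h2 : l ^+ 2 * (e1 ^+ 2 + e2 ^+ 2) <= l ^+ 2 * rho ^+ 2.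
      by rewrite ler_wpM2l// ltW.
    by rewrite e exprMn; lra.
  have := ler_wsqrtr cs; rewrite !sqrtr_sqr (ger0_norm (mulr_ge0 l_ge0 rho0)).
  rewrite ler_norml -al => /andP[h _].
  have h1 : rho * l <= k * l ^+ 2.
    by rewrite -kl0 expr2 mulrA ler_wpM2r// ler_wpM2l.
  by rewrite -(ler_pM2r l2_gt0); lra.
- have : 2 * (2 + k) * l <= 2 * (2 + k) * rho by rewrite ler_wpM2l//; lra.
  by move/le_trans; apply.
- rewrite -(ler_pM2r l2_gt0) bl.
  have h : 2 * (2 + k) ^+ 2 * l / D * l ^+ 2 <= 2 * (2 + k) ^+ 2 * rho ^+ 3 / D.
    have -> : 2 * (2 + k) ^+ 2 * l / D * l ^+ 2 = 2 * (2 + k) ^+ 2 * l ^+ 3 / D by ring.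
    apply: ler_wpM2r; first by rewrite invr_ge0 ltW.
    apply: ler_wpM2l; first by rewrite mulr_ge0// sqr_ge0.
    by rewrite ler_pXn2r ?nnegrE.
  by apply: le_trans h _; rewrite lerNr.
Qed.

(* Were both [x] and [x'] in [T], far from the line [z1 z2] on its two sides,
   a disc of [T] through the crossing point together with [x] or [x'] would
   force [z1] or [z2] into [T]. *)
Lemma cross T D l0 rho E z11 z12 z21 z22 x1 x2 x1' x2' th ps :
  convex2 T -> rolling D T -> 0 < D -> 0 < l0 -> 0 <= rho ->
  2 * (2 + rho / l0) * rho <= D ->
  0 <= th <= 1 -> 0 <= ps <= 1 ->
  (1 - th) * z11 + th * z21 = (1 - ps) * x1 + ps * x1' ->
  (1 - th) * z12 + th * z22 = (1 - ps) * x2 + ps * x2' ->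
  T x1 x2 -> T x1' x2' -> ~ T z11 z12 -> ~ T z21 z22 ->
  l0 ^+ 2 <= (z21 - z11) ^+ 2 + (z22 - z12) ^+ 2 <= rho ^+ 2 ->
  (x1' - x1) ^+ 2 + (x2' - x2) ^+ 2 <= rho ^+ 2 ->
  2 * (2 + rho / l0) ^+ 2 * rho ^+ 3 / D <= E ->
  E <= (z21 - z11) * (x2 - z12) - (z22 - z12) * (x1 - z11) ->
  (z21 - z11) * (x2' - z12) - (z22 - z12) * (x1' - z11) <= - E -> False.
Proof.
move=> cT rT D0 l00 rho0 rD th01 ps01 ew1 ew2 Tx Tx' nz1 nz2 ld xx' EE cx cx'.
set w1 := (1 - th) * z11 + th * z21 in ew1; set w2 := (1 - th) * z12 + th * z22 in ew2.
have Tw : T w1 w2 by rewrite ew1 ew2; exact: cT.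
have [c1 [c2 [dw dT]]] := rT _ _ Tw.
set d1 := z21 - z11 in ld cx cx'; set d2 := z22 - z12 in ld cx cx'.
have /andP[ps0 ps1] := ps01.
have scal u v p : 0 <= p <= 1 -> u ^+ 2 + v ^+ 2 <= rho ^+ 2 ->
    (p * u) ^+ 2 + (p * v) ^+ 2 <= rho ^+ 2.
  move=> /andP[p0 p1]; apply: le_trans; rewrite !exprMn -mulrDr ler_piMl//.
    by rewrite addr_ge0 ?sqr_ge0.
  by rewrite expr_le1.
have xw : (x1 - w1) ^+ 2 + (x2 - w2) ^+ 2 <= rho ^+ 2.
  have -> : (x1 - w1) ^+ 2 = (ps * (x1' - x1)) ^+ 2 by rewrite ew1; ring.
  have -> : (x2 - w2) ^+ 2 = (ps * (x2' - x2)) ^+ 2 by rewrite ew2; ring.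
  exact: scal.
have xw' : (x1' - w1) ^+ 2 + (x2' - w2) ^+ 2 <= rho ^+ 2.
  have -> : (x1' - w1) ^+ 2 = ((1 - ps) * (x1' - x1)) ^+ 2 by rewrite ew1; ring.
  have -> : (x2' - w2) ^+ 2 = ((1 - ps) * (x2' - x2)) ^+ 2 by rewrite ew2; ring.
  by apply: scal => //; apply/andP; split; lra.
have ew u v : d1 * (v - w2) - d2 * (u - w1) = d1 * (v - z12) - d2 * (u - z11).
  by rewrite /w1 /w2 /d1 /d2; ring.
have {}cx : E <= d1 * (x2 - w2) - d2 * (x1 - w1) by rewrite ew.
have {}cx' : d1 * (x2' - w2) - d2 * (x1' - w1) <= - E by rewrite ew.
set ee := 2 * _ ^+ 2 * _ / _ in EE.
have h2 s : s ^+ 2 = 1 -> 0 <= d1 * (c1 - w1) + d2 * (c2 - w2) ->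
   0 <= s * (d1 * (c2 - w2) - d2 * (c1 - w1)) ->
   forall y1 y2, (y1 - w1) ^+ 2 + (y2 - w2) ^+ 2 <= rho ^+ 2 ->
   s * (d1 * (y2 - w2) - d2 * (y1 - w1)) <= - ee -> T y1 y2 -> False.
  move=> s1 p0 q0 y1 y2 yw cy Ty; apply: nz2.
  have -> : z21 = w1 + (1 - th) * d1 by rewrite /w1 /d1; ring.
  have -> : z22 = w2 + (1 - th) * d2 by rewrite /w2 /d2; ring.
  apply: (cross_aux cT dT dw D0 l00 rD s1 _ rho0 ld yw p0 q0 cy Ty).
  by move/andP: th01 => [? ?]; apply/andP; split; lra.
have h1 s : s ^+ 2 = 1 -> d1 * (c1 - w1) + d2 * (c2 - w2) <= 0 ->
   0 <= s * (d1 * (c2 - w2) - d2 * (c1 - w1)) ->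
   forall y1 y2, (y1 - w1) ^+ 2 + (y2 - w2) ^+ 2 <= rho ^+ 2 ->
   s * (d1 * (y2 - w2) - d2 * (y1 - w1)) <= - ee -> T y1 y2 -> False.
  move=> s1 p0 q0 y1 y2 yw cy Ty; apply: nz1.
  have -> : z11 = w1 + th * (- d1) by rewrite /w1 /d1; ring.
  have -> : z12 = w2 + th * (- d2) by rewrite /w2 /d2; ring.
  have sN : (- s) ^+ 2 = 1 by rewrite sqrrN.
  apply: (@cross_aux T c1 c2 D l0 rho w1 w2 (- d1) (- d2) (- s) y1 y2 th) => //.
  - by rewrite !sqrrN.
  - by lra.
  - by lra.
  - by rewrite -/ee; lra.
(* The quadrant of the disc's centre as seen from [w] decides: the centre lies towards [z1] or [z2],
   and that point is forced into [T], using the one of [x] and [x'] on the far side of the line from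
   the centre. *)
have [p0|p0] := leP 0 (d1 * (c1 - w1) + d2 * (c2 - w2));
  have [q0|q0] := leP 0 (d1 * (c2 - w2) - d2 * (c1 - w1)).
- by apply: (h2 1 _ p0 _ x1' x2' xw' _ Tx'); rewrite ?expr1n ?mul1r//; lra.
- by apply: (h2 (-1) _ p0 _ x1 x2 xw _ Tx); rewrite ?sqrrN ?expr1n ?mulN1r//; lra.
- by apply: (h1 1 _ (ltW p0) _ x1' x2' xw' _ Tx'); rewrite ?expr1n ?mul1r//; lra.
- by apply: (h1 (-1) _ (ltW p0) _ x1 x2 xw _ Tx); rewrite ?sqrrN ?expr1n ?mulN1r//; lra.
Qed.
End Cross.

Section CrossSeg.
Variable R : rcfType.
Implicit Types (T : R -> R -> Prop).

(** Produces the crossing point that [cross] expects. The change of sign of the cross product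
    determines [ps]; the two linear forms, both increasing from [z1] to [z2], show that the crossing
    point does not come before [z1] or after [z2]. *)
Lemma cross_seg T D l0 rho E p1 q1 p2 q2 z11 z12 z21 z22 x1 x2 x1' x2' :
  convex2 T -> rolling D T -> 0 < D -> 0 < l0 -> 0 <= rho ->
  2 * (2 + rho / l0) * rho <= D -> 0 < E ->
  p1 * z11 + q1 * z12 <= p1 * x1 + q1 * x2 ->
  p1 * z11 + q1 * z12 <= p1 * x1' + q1 * x2' ->
  p1 * z11 + q1 * z12 < p1 * z21 + q1 * z22 ->
  p2 * x1 + q2 * x2 <= p2 * z21 + q2 * z22 ->
  p2 * x1' + q2 * x2' <= p2 * z21 + q2 * z22 ->
  p2 * z11 + q2 * z12 < p2 * z21 + q2 * z22 ->
  T x1 x2 -> T x1' x2' -> ~ T z11 z12 -> ~ T z21 z22 ->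
  l0 ^+ 2 <= (z21 - z11) ^+ 2 + (z22 - z12) ^+ 2 <= rho ^+ 2 ->
  (x1' - x1) ^+ 2 + (x2' - x2) ^+ 2 <= rho ^+ 2 ->
  2 * (2 + rho / l0) ^+ 2 * rho ^+ 3 / D <= E ->
  E <= (z21 - z11) * (x2 - z12) - (z22 - z12) * (x1 - z11) ->
  (z21 - z11) * (x2' - z12) - (z22 - z12) * (x1' - z11) <= - E -> False.
Proof.
move=> cT rT D0 l00 rho0 rD E0 f1x f1x' f1z f2x f2x' f2z Tx Tx' nz1 nz2 ld xx' EE cx cx'.
set d1 := z21 - z11 in ld cx cx'; set d2 := z22 - z12 in ld cx cx'.
set c := (X in E <= X) in cx; set c' := (X in X <= - E) in cx'.
have cc : 0 < c - c' by lra.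
pose ps := c / (c - c').
have psc : ps * (c - c') = c by rewrite /ps divfK// gt_eqF.
have ps0 : 0 <= ps by rewrite divr_ge0// ?(ltW cc)//; lra.
have ps1 : ps <= 1 by rewrite ler_pdivrMr//; lra.
pose w1 := (1 - ps) * x1 + ps * x1'; pose w2 := (1 - ps) * x2 + ps * x2'.
have cw : d1 * (w2 - z12) - d2 * (w1 - z11) = 0.
  transitivity (c - ps * (c - c')); last by rewrite psc subrr.
  by rewrite /c /c' /w1 /w2; ring.
pose q := d1 ^+ 2 + d2 ^+ 2.
have q0 : 0 < q by move/andP: ld => [ld _]; apply: lt_le_trans ld; rewrite exprn_gt0.
pose th := (d1 * (w1 - z11) + d2 * (w2 - z12)) / q.
have thq : th * q = d1 * (w1 - z11) + d2 * (w2 - z12) by rewrite /th divfK// gt_eqF.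
have ew1 : (1 - th) * z11 + th * z21 = w1.
  have -> : (1 - th) * z11 + th * z21 = z11 + th * d1 by rewrite /d1; ring.
  suff : (z11 + th * d1) * q = w1 * q by move/(mulIf (lt0r_neq0 q0)).
  transitivity (z11 * q + (th * q) * d1); first by ring.
  rewrite thq; transitivity (w1 * q + d2 * (d1 * (w2 - z12) - d2 * (w1 - z11))).
    by rewrite /q; ring.
  by rewrite cw mulr0 addr0.
have ew2 : (1 - th) * z12 + th * z22 = w2.
  have -> : (1 - th) * z12 + th * z22 = z12 + th * d2 by rewrite /d2; ring.
  suff : (z12 + th * d2) * q = w2 * q by move/(mulIf (lt0r_neq0 q0)).
  transitivity (z12 * q + (th * q) * d2); first by ring.
  rewrite thq; transitivity (w2 * q - d1 * (d1 * (w2 - z12) - d2 * (w1 - z11))).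
    by rewrite /q; ring.
  by rewrite cw mulr0 subr0.
have av a a' b : a <= b -> a' <= b -> (1 - ps) * a + ps * a' <= b.
  move=> ab ab'; have h1 : (1 - ps) * a <= (1 - ps) * b by rewrite ler_wpM2l// subr_ge0.
  have h2 : ps * a' <= ps * b by rewrite ler_wpM2l.
  by lra.
have th0 : 0 <= th.
  have h : p1 * z11 + q1 * z12 <= p1 * w1 + q1 * w2.
    have hh := av (- (p1 * x1 + q1 * x2)) (- (p1 * x1' + q1 * x2')) (- (p1 * z11 + q1 * z12)).
    rewrite !lerN2 in hh; have {}hh := hh f1x f1x'; rewrite -lerN2; apply: le_trans hh.
    by rewrite /w1 /w2 le_eqVlt; apply/orP; left; apply/eqP; ring.
  have e : p1 * w1 + q1 * w2 - (p1 * z11 + q1 * z12) =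
      th * (p1 * z21 + q1 * z22 - (p1 * z11 + q1 * z12)) by rewrite -ew1 -ew2; ring.
  have h2 : 0 <= th * (p1 * z21 + q1 * z22 - (p1 * z11 + q1 * z12)) by rewrite -e subr_ge0.
  by rewrite pmulr_lge0// in h2; rewrite subr_gt0.
have th1 : th <= 1.
  have h : p2 * w1 + q2 * w2 <= p2 * z21 + q2 * z22.
    have hh := av _ _ _ f2x f2x'; apply: le_trans hh.
    by rewrite /w1 /w2 le_eqVlt; apply/orP; left; apply/eqP; ring.
  have e : p2 * z21 + q2 * z22 - (p2 * w1 + q2 * w2) =
      (1 - th) * (p2 * z21 + q2 * z22 - (p2 * z11 + q2 * z12)) by rewrite -ew1 -ew2; ring.
  have h2 : 0 <= (1 - th) * (p2 * z21 + q2 * z22 - (p2 * z11 + q2 * z12)) by rewrite -e subr_ge0.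
  by rewrite pmulr_lge0 ?subr_ge0 ?subr_gt0// in h2.
apply: (@cross R T D l0 rho E z11 z12 z21 z22 x1 x2 x1' x2' th ps) => //.
- by rewrite th0 th1.
- by rewrite ps0 ps1.
Qed.

(** Violating an inequality of the cap only serves to place [X] within [g] of the height [Yt]. A
    disc of [T] through [X] cannot rise above [Yt], so its centre is almost straight below [X], with
    horizontal offset at most [D / 40]. Going down by [1 / 4] then lowers the squared distance from
    the centre by nearly [D / 2], which pays for a horizontal move of up to 4. *)
Lemma near_top T D Yt K0 Rr B x0 rho Xx Xy zx zy :
  rolling D T -> 0 < D -> 0 < B -> 0 <= K0 ->
  (forall x y, T x y -> y <= Yt) -> `|Xx| <= Rr -> `|x0| <= Rr ->
  4 ^+ 3 * (4 ^+ 3 * (K0 + 2 * B * Rr)) <= D -> 64 + 4 * rho ^+ 2 <= D ->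
  T Xx Xy ->
  (Yt - K0 < Xy) \/ (Yt - K0 + B * x0 + B / 2 < Xy + B * Xx) \/
  (Yt - K0 - B * x0 + B / 2 < Xy - B * Xx) ->
  `|zx - Xx| <= 4 -> Xy - rho <= zy <= Xy - 4^-1 -> T zx zy.
Proof.
move=> rT D0 B0 K00 TY Xr xr gD rD TX nc zX /andP[zy1 zy2].
have [c1 [c2 [dX dT]]] := rT _ _ TX.
have Yc : c2 + D <= Yt.
  by apply: (TY c1); apply: dT; rewrite /in_disc subrr expr0n add0r addrC addKr.
apply: dT; rewrite /in_disc.
set g := K0 + 2 * B * Rr in gD.
have BR1 : B * `|Xx| <= B * Rr by rewrite ler_wpM2l// ltW.
have BR2 : B * `|x0| <= B * Rr by rewrite ler_wpM2l// ltW.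
have {nc} fg : D - g <= Xy - c2.
  have a1 : B * Xx <= B * `|Xx| by rewrite ler_wpM2l ?ler_norm// ltW.
  have a2 : - (B * Xx) <= B * `|Xx|.
    by rewrite -mulrN -normrN ler_wpM2l ?ler_norm// ltW.
  have a3 : B * x0 <= B * `|x0| by rewrite ler_wpM2l ?ler_norm// ltW.
  have a4 : - (B * x0) <= B * `|x0|.
    by rewrite -mulrN -normrN ler_wpM2l ?ler_norm// ltW.
  have a5 : 0 <= B * `|Xx| by rewrite mulr_ge0// ltW.
  by rewrite /g; case: nc => [|[|]] h; lra.
have g0 : 0 <= g by rewrite /g; have := mulr_ge0 (ltW B0) (normr_ge0 Xx); lra.
set f := Xy - c2 in fg; set m := Xx - c1.
have dX' : m ^+ 2 + f ^+ 2 <= D ^+ 2 by [].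
have f0 : 0 <= f by lra.
have m2 : m ^+ 2 <= (D / 40) ^+ 2.
  have h1 : (D - g) ^+ 2 <= f ^+ 2 by rewrite ler_pXn2r ?nnegrE//; lra.
  have h2 : g * D <= (D / 64 / 64) * D by rewrite ler_wpM2r ?(ltW D0)//; lra.
  have h3 := sqr_ge0 g; have h4 := sqr_ge0 D.
  lra.
have mD : `|m| <= D / 40.
  rewrite -(@ler_pXn2r _ 2) ?nnegrE//; last by lra.
  by rewrite real_normK ?num_real.
set dx := zx - Xx in zX; set dy := Xy - zy.
have dy1 : 4^-1 <= dy by rewrite /dy; lra.
have dy2 : dy <= rho by rewrite /dy; lra.
have -> : (zx - c1) ^+ 2 + (zy - c2) ^+ 2 =
   (m ^+ 2 + f ^+ 2) + 2 * (dx * m) - 2 * (dy * f) + dx ^+ 2 + dy ^+ 2.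
  by rewrite /m /f /dx /dy; ring.
have e1 : dx * m <= 4 * (D / 40).
  rewrite (le_trans (ler_norm _))// normrM.
  by apply: ler_pM.
have e2 : 4^-1 * (D - g) <= dy * f by apply: ler_pM => //; lra.
have e3 : dx ^+ 2 <= 4 ^+ 2.
  by rewrite -real_normK ?num_real// ler_pXn2r ?nnegrE.
have e4 : dy ^+ 2 <= rho ^+ 2 by rewrite ler_pXn2r ?nnegrE//; lra.
lra.
Qed.

End CrossSeg.

(** * The chain of lower edges *)

Section Chain.
Variable R : realFieldType.
Variable N : nat.
Local Notation n := (N%:R : R).

(* The linear term breaks the symmetry that would give the middle edge of a chain
   of odd length slope 0. *)
Definition depth (j : nat) : R :=
  if (j < N)%N then j%:R * (n - j%:R) + j%:R / 2 else 0.
Definition descent (j : nat) : R := depth j.+1 - depth j.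
Definition mid_depth (j : nat) : R := (depth j + depth j.+1) / 2.

Hypothesis N2 : (2 <= N)%N.

Lemma depth0 : depth 0 = 0.
Proof. by rewrite /depth; case: ifP => // _; rewrite !mul0r addr0. Qed.

Lemma depthN : depth N = 0. Proof. by rewrite /depth ltnn. Qed.

Lemma descentE j : (j.+1 < N)%N -> descent j = n - 2^-1 - 2 * j%:R.
Proof.
move=> jN; rewrite /descent /depth jN (ltnW jN) -[j.+1%:R]natr1; lra.
Qed.

Lemma natN_ge2 : 2 <= n. Proof. by rewrite ler_nat. Qed.

Lemma natN_pred : (N.-1)%:R = n - 1 :> R.
Proof. by case: N N2 => // k _; rewrite -natr1 addrK. Qed.

Lemma depth_last : depth N.-1 = (3 / 2) * (n - 1).
Proof.
rewrite /depth ifT; last by lia.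
by rewrite natN_pred; lra.
Qed.

Lemma descent_last j : j.+1 = N -> descent j = - ((3 / 2) * (n - 1)).
Proof.
move=> jN; rewrite /descent jN depthN sub0r.
by rewrite (_ : j = N.-1) ?depth_last//; lia.
Qed.

Lemma edge_cases j : (j < N)%N -> (j.+1 < N)%N \/ j.+1 = N.
Proof. lia. Qed.

(** The lower bound makes every edge steep once scaled by [St], so that the translates cutting out
    the edges touch them far from their caps; it also makes one end of each edge clearly deeper than
    its middle. *)
Lemma descent_abs j : (j < N)%N -> 2^-1 <= `|descent j| <= 2 * n.
Proof.
have n2 := natN_ge2.
case/edge_cases => [jN|jN].
  rewrite descentE//.
  have j0 : 0 <= j%:R :> R by [].
  have jn : j%:R <= n by rewrite ler_nat; lia.
  case: (leqP N (2 * j)) => h.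
    have h' : n <= 2 * j%:R by rewrite -natrM ler_nat.
    by rewrite ler0_norm; [apply/andP; split; lra | lra].
  have h' : 2 * j%:R + 1 <= n by rewrite -natrM natr1 ler_nat.
  by rewrite ger0_norm; [apply/andP; split; lra | lra].
rewrite (descent_last jN) normrN ger0_norm; first by apply/andP; split; lra.
by lra.
Qed.

Lemma descent0 : 3 / 2 <= descent 0.
Proof. have n2 := natN_ge2; rewrite descentE ?N2//; lra. Qed.

Lemma descent_lastN : descent N.-1 <= - (3 / 2).
Proof. have n2 := natN_ge2; rewrite descent_last; first by lra. by lia. Qed.

Lemma consec_ge0 (a b : nat) : 0 <= (a%:R - b%:R) * (a%:R - b%:R - 1) :> R.
Proof.
case: (leqP a b) => h.
  have h' : a%:R <= b%:R :> R by rewrite ler_nat.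
  nra.
have h' : b%:R + 1 <= a%:R :> R by rewrite natr1 ler_nat.
nra.
Qed.

(** Concavity of the depths. For an edge other than the last, the difference of the two sides is
    [(k - j) * (k - j - 1)], a product of consecutive integers, and it is larger still at [k = N],
    where the depth is put to 0. *)
Lemma depth_le_edge j k : (j < N)%N -> (k <= N)%N ->
  depth k <= depth j + descent j * (k%:R - j%:R).
Proof.
have n2 := natN_ge2.
case/edge_cases => [jN|jN] kN.
  rewrite descentE// {2}/depth (ltnW jN).
  have h := consec_ge0 k j.
  have j0 : 0 <= j%:R :> R by [].
  rewrite /depth; case: ltnP => kN'; first by lra.
  have -> : k = N by lia.
  have jn : j%:R + 2 <= n :> R by rewrite -natrD ler_nat; lia.
  have h2 : 0 <= (n - j%:R) * (n - j%:R - 1) by rewrite mulr_ge0//; lra.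
  lra.
rewrite (descent_last jN) (_ : j = N.-1); last by lia.
rewrite depth_last natN_pred.
rewrite /depth; case: ltnP => kN'; last by rewrite (_ : k = N); [lra|lia].
have k0 : 0 <= k%:R :> R by [].
have kn : k%:R + 1 <= n :> R by rewrite natr1 ler_nat.
have h1 : 0 <= (n - k%:R) * (n - 1 - k%:R) by rewrite mulr_ge0//; lra.
have h2 : 0 <= k%:R * (n - k%:R - 1) by rewrite mulr_ge0//; lra.
lra.
Qed.

Lemma depth_in k : (0 < k < N)%N -> 1 <= depth k.
Proof.
move=> /andP[k0 kN]; rewrite /depth kN.
have h1 : 1 <= k%:R :> R by rewrite ler1n.
have h2 : k%:R + 1 <= n :> R by rewrite natr1 ler_nat.
have h3 : 0 <= (k%:R - 1) * (n - k%:R - 1) by rewrite mulr_ge0//; lra.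
lra.
Qed.

Lemma depth_bound k : 0 <= depth k <= 2 * n ^+ 2.
Proof.
have n2 := natN_ge2.
rewrite /depth; case: ltnP => kN; last by rewrite lexx mulr_ge0// sqr_ge0.
have h1 : 0 <= k%:R :> R by [].
have h2 : k%:R <= n :> R by rewrite ler_nat ltnW.
apply/andP; split.
  by rewrite addr_ge0 ?mulr_ge0 ?subr_ge0// invr_ge0.
nra.
Qed.

Lemma mid_ge j : (j < N)%N -> 2^-1 <= mid_depth j <= 2 * n ^+ 2.
Proof.
move=> jN; have /andP[a1 a2] := depth_bound j; have /andP[b1 b2] := depth_bound j.+1.
apply/andP; split; last by rewrite /mid_depth; lra.
case: j jN a1 a2 b1 b2 => [|j] jN a1 a2 b1 b2.
  by have := @depth_in 1 (N2); rewrite /mid_depth; lra.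
have := @depth_in j.+1 jN; rewrite /mid_depth; lra.
Qed.

(* A vertex of the chain lies below the chord joining the midpoints of two
   edges separated by it, quantitatively. *)
Lemma mid_chord i j : (i < j < N)%N ->
  mid_depth j - mid_depth i + (j%:R - i%:R) <= (j%:R - i%:R) * descent i.
Proof.
have n2 := natN_ge2.
move=> /andP[ij jN].
have iN : (i.+1 < N)%N by lia.
have i0 : 0 <= i%:R :> R by [].
have ij' : i%:R + 1 <= j%:R :> R by rewrite natr1 ler_nat.
have sq : j%:R - i%:R <= (j%:R - i%:R) ^+ 2 :> R by nra.
have mE k : (k.+1 < N)%N -> mid_depth k = k%:R * (n + 2^-1) - k%:R ^+ 2 + n / 2 - 4^-1 - k%:R.
  by move=> kN; rewrite /mid_depth /depth kN (ltnW kN) -[k.+1%:R]natr1; lra.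
rewrite descentE// (mE i iN).
case: (edge_cases jN) => jN'; first by rewrite (mE j jN'); lra.
have jE : j = N.-1 by lia.
have -> : mid_depth j = (3 / 4) * (n - 1).
  by rewrite /mid_depth jN' depthN jE depth_last; lra.
have jn : j%:R = n - 1 :> R by rewrite jE natN_pred.
rewrite jn in ij' sq *; lra.
Qed.

(** The line of an edge, extended to both ends of the base, has depths [a] and [b] there. They are
    nonnegative by concavity; and as the edge has an inner vertex [k] of depth at least 1, which is
    a weighted mean of [a] and [b], their sum is at least 1. *)
Lemma edge_ends j : (j < N)%N ->
  [/\ 0 <= depth j - descent j * j%:R, 0 <= depth j + descent j * (n - j%:R) &
  1 <= (depth j - descent j * j%:R) + (depth j + descent j * (n - j%:R))].
Proof.
move=> jN; have n2 := natN_ge2.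
have h1 := depth_le_edge jN (leq0n N); have h2 := depth_le_edge jN (leqnn N).
rewrite depth0 sub0r in h1; rewrite depthN in h2.
set a := depth j - _ * _; set b := depth j + _ * _.
have a0 : 0 <= a by rewrite /a; lra.
have b0 : 0 <= b by rewrite /b; lra.
split => //.
have [k [kN kk]] : exists k, (0 < k < N)%N /\ (k = j \/ k = j.+1).
  by case: j jN {h1 h2 a b a0 b0} => [|j] jN; [exists 1%N | exists j.+1];
    split; [lia|right|lia|left].
have kn : k%:R <= n :> R by rewrite ler_nat; lia.
have k0 : 0 <= k%:R :> R by [].
have n0 : 0 < n by lra.
have : depth k = depth j + descent j * (k%:R - j%:R).
  case: kk => ->; first by rewrite subrr mulr0 addr0.
  by rewrite -[j.+1%:R]natr1 addrAC subrr add0r mulr1 /descent addrCA subrr addr0.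
have dk := depth_in kN.
move=> e.
have e2 : n * depth k = (n - k%:R) * a + k%:R * b by rewrite e /a /b; ring.
have e3 : n * depth k <= n * (a + b).
  have : 0 <= k%:R * a by rewrite mulr_ge0.
  have : 0 <= (n - k%:R) * b by rewrite mulr_ge0// subr_ge0.
  by rewrite e2; move=> *; lra.
rewrite ler_pM2l// in e3; lra.
Qed.

End Chain.

(** * The model polygon *)

Section Arith.
Variable R : realFieldType.
Implicit Types (w s mi mj jj U kap y d E : R).

(** With [mids_lower], the estimates behind [not_two_mids]: on which side of the line through the
    points below the middles [i] and [j] a point lies whose abscissa is [w / 2 + d] beyond middle
    [i]. Here [jj] stands for [j - i], [s] for [St], and [U] for [n ^+ 2 * St * k1], the order of
    the errors. *)
Lemma mids_upper jj w s mi mj U kap y d E :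
  0 < w -> 0 < s -> 1 <= jj -> 2^-1 <= mi -> 2^-1 <= mj -> 0 <= kap -> - (2 * U) <= y ->
  - (8 * U) <= s * (mj - mi) * d -> 4 ^+ 3 * U <= s -> 4 ^+ 3 * U <= s * w -> 4 * 4 * E <= s * w ->
  E <= (jj * w) * (y - (- (s * mi) - 2 * kap)) - (- (s * (mj - mi))) * (w / 2 + d).
Proof.
move=> w0 s0 jj1 hmi hmj k0 hy hd Us Usw Es.
have jw : 0 <= jj * w by rewrite mulr_ge0 ?(ltW w0)//; lra.
have sw : 0 <= s * w by rewrite mulr_ge0 ?(ltW w0) ?(ltW s0).
have g1 := ler_wpM2l jw hy.
have g2 : (jj * w) * (4 ^+ 3 * U) <= (jj * w) * s by rewrite ler_wpM2l.
have g4 : 1 * mi <= jj * mi by rewrite ler_wpM2r//; lra.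
have g5 : jj * 2^-1 <= jj * mi by rewrite ler_wpM2l//; lra.
have g3 : (s * w) * (jj / 4 + 8^-1) <= (s * w) * (jj * mi + (mj - mi) / 2).
  by rewrite ler_wpM2l//; lra.
have g6 : 0 <= (jj * w) * (2 * kap) by rewrite mulr_ge0//; lra.
have g7 : 1 * (s * w) <= jj * (s * w) by rewrite ler_wpM2r.
lra.
Qed.

Lemma mids_lower jj w s mi mj dr U kap y d E :
  0 < w -> 0 < s -> 1 <= jj -> 0 <= kap -> kap <= U -> y <= - (s * mi + s * dr / 2) + 2 * U ->
  mj - mi + jj <= jj * dr ->
  s * (mj - mi) * d <= 8 * U -> 4 ^+ 3 * U <= s -> 4 ^+ 3 * U <= s * w -> 4 * 4 * E <= s * w ->
  (jj * w) * (y - (- (s * mi) - 2 * kap)) - (- (s * (mj - mi))) * (w / 2 + d) <= - E.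
Proof.
move=> w0 s0 jj1 k0 kU hy mc hd Us Usw Es.
have jw : 0 <= jj * w by rewrite mulr_ge0 ?(ltW w0)//; lra.
have sw : 0 <= s * w by rewrite mulr_ge0 ?(ltW w0) ?(ltW s0).
have g1 := ler_wpM2l jw hy.
have g2 : (jj * w) * (4 ^+ 3 * U) <= (jj * w) * s by rewrite ler_wpM2l.
have g8 : (jj * w) * kap <= (jj * w) * U by rewrite ler_wpM2l.
have g3 := ler_wpM2l sw mc.
have g7 : 1 * (s * w) <= jj * (s * w) by rewrite ler_wpM2r.
lra.
Qed.

(** With [mid_roof_lower], the estimates behind [not_mid_and_roof]: the left and the right end of an
    edge, up to errors [dx] and [dy], lie on different sides of the line from its middle to the roof
    point [(xi, Y)]. *)
Lemma mid_roof_upper s w dep dr xi x0 kap Y dx dy U E :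
  0 < s -> 0 < w -> 0 <= Y -> 0 <= kap -> kap <= U -> E <= U ->
  4 ^+ 5 * U <= s * (w * dep + dr * (xi - x0)) ->
  `|xi - (x0 + w / 2)| <= 4 -> `|dy| <= 2 * U ->
  `|(Y + s * (dep + dr / 2) + 2 * kap) * dx| <= 4 * 4 * U ->
  E <= (xi - (x0 + w / 2)) * (- (s * dep) + dy - (- (s * (dep + dr / 2)) - 2 * kap)) -
     (Y - (- (s * (dep + dr / 2)) - 2 * kap)) * (x0 + dx - (x0 + w / 2)).
Proof.
move=> s0 w0 Y0 k0 kU EU hW h1 hdy hdx.
have U0 : 0 <= U by lra.
have g1 : `|(xi - (x0 + w / 2)) * (2 * kap + dy)| <= 4 * (4 * U).
  rewrite normrM; apply: ler_pM => //.
  apply: le_trans (ler_normD _ _) _; rewrite ger0_norm; lra.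
have g2 : 0 <= (Y + 2 * kap) * w by rewrite mulr_ge0 ?(ltW w0)//; lra.
move: g1 hdx; rewrite !ler_norml => /andP[a1 a2] /andP[b1 b2].
lra.
Qed.

Lemma mid_roof_lower s w dep dr xi x0 kap Y dx dy U E :
  0 < s -> 0 < w -> 0 <= Y -> 0 <= kap -> kap <= U -> E <= U ->
  4 ^+ 5 * U <= s * (w * dep + dr * (xi - x0)) ->
  `|xi - (x0 + w / 2)| <= 4 -> `|dy| <= 2 * U ->
  `|(Y + s * (dep + dr / 2) + 2 * kap) * dx| <= 4 * 4 * U ->
  (xi - (x0 + w / 2)) * (- (s * (dep + dr)) + dy - (- (s * (dep + dr / 2)) - 2 * kap)) -
     (Y - (- (s * (dep + dr / 2)) - 2 * kap)) * (x0 + w + dx - (x0 + w / 2)) <= - E.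
Proof.
move=> s0 w0 Y0 k0 kU EU hW h1 hdy hdx.
have U0 : 0 <= U by lra.
have g1 : `|(xi - (x0 + w / 2)) * (2 * kap + dy)| <= 4 * (4 * U).
  rewrite normrM; apply: ler_pM => //.
  apply: le_trans (ler_normD _ _) _; rewrite ger0_norm; lra.
have g2 : 0 <= (Y + 2 * kap) * w by rewrite mulr_ge0 ?(ltW w0)//; lra.
move: g1 hdx; rewrite !ler_norml => /andP[a1 a2] /andP[b1 b2].
lra.
Qed.

End Arith.

Section Small.
Variables (R : rcfType) (B : R).
(** The width of a steep side, which descends from height 1 to height 0. *)
Definition flare := B / 4.
(** The height of the two ends of the probed part of the roof ([roof_om]). Being positive, it keeps
    the probes [xi] away from the ends of the chain, as [edge_gap] needs. *)
Definition inset := B / 64.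
End Small.

(* The unit of length is half the width of the roof.  N is the number of lower
   edges, B the slope of the cap, St the vertical scale of the chain of lower edges
   and k1 the width of the boxes next to its vertices; kap bounds the deviation of
   boundary arcs from straight lines, khat the size of the perturbation of the
   body, and E is the tolerance in the crossing lemma. *)
Record params_ok (R : rcfType) (N : nat) (B St k1 kap khat E : R) : Prop := ParamsOk {
  pN2 : (2 <= N)%N;
  pB0 : 0 < B;
  pB1 : 4 ^+ 3 * B <= 1;
  pk10 : 0 < k1;
  pk1n : 2 * 4 * 4 * (2 * 4 * 4 * ((N%:R : R) ^+ 3 * k1)) <= inset B * flare B;
  pSk1 : 2 <= St * k1 ^+ 2;
  pkap0 : 0 < kap;
  pkapE : 4 ^+ 3 * (4 ^+ 3 * (4 ^+ 3 * kap)) <= k1 * B ^+ 2;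
  pkhat0 : 0 <= khat;
  pkhatE : 4 ^+ 3 * (4 ^+ 3 * (4 ^+ 3 * khat)) <= k1 * B ^+ 2;
  pE0 : 0 < E;
  pEE : 4 ^+ 3 * (4 ^+ 3 * (4 ^+ 3 * E)) <= k1 * B ^+ 2 }.

Section Shape.
Variables (R : rcfType) (N : nat) (B St k1 kap khat E : R).
Local Notation n := (N%:R : R).
Local Notation ee := (flare B).
Local Notation tau := (inset B).

Definition om := 1 + ee - tau * ee.
Definition ww := 2 * (1 + ee) / n.
Definition xv (j : nat) := - (1 + ee) + j%:R * ww.
Definition edge (j : nat) (x : R) := - (St * depth R N j) - St * descent R N j / ww * (x - xv j).
(** The corners are at abscissas [1 / 2] (height [1 + B / 2]), [1] (height [1]) and [1 + ee] (height
    [0]), and at their mirror images. *)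
Definition roof (x : R) :=
  Num.min (Num.min (1 + B / 2) (Num.min (1 + B * (1 - x)) (1 + B * (1 + x))))
          (Num.min ((1 + ee - x) / ee) ((1 + ee + x) / ee)).
Definition mx (j : nat) := xv j + ww / 2.
(** The translates realize the lines only up to an error [kap]; the offset [2 * kap], here and in
    [Xy], makes sure that the probes lie outside [K]. *)
Definition my (j : nat) := - (St * mid_depth R N j) - 2 * kap.
Definition Xy (x : R) := roof x + 2 * kap.

(** Wide enough to contain everything within [khat] of the box at vertex [k] ([vbox_near]), and
    still above the chain and well below height 0. *)
Definition near_vertex (k : nat) (x y : R) :=
  [/\ `|x - xv k| <= 4 * k1, `|y + St * depth R N k| <= 2 * n ^+ 2 * St * k1,
      (forall j, (j < N)%N -> edge j x <= y) & y <= - (St * k1 / 2)].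

Hypothesis P : params_ok N B St k1 kap khat E.
Let N2 := pN2 P.
Let B0 := pB0 P.
Let B1 := pB1 P.
Let k10 := pk10 P.
Let k1n := pk1n P.
Let Sk1 := pSk1 P.
Let kap0 := pkap0 P.
Let kapE := pkapE P.
Let E0 := pE0 P.
Let EE := pEE P.

Local Tactic Notation "lra_with" ne_hyp_list(hs) :=
  clear - hs R N B St k1 kap khat E P N2 B0 B1 k10 k1n Sk1 kap0 kapE E0 EE; lra.

Lemma n_ge2 : 2 <= n. Proof. exact: natN_ge2. Qed.
Lemma ee_gt0 : 0 < ee. Proof. by rewrite divr_gt0. Qed.
Lemma ee_le : 4 ^+ 4 * ee <= 1. Proof. have h := B1; rewrite /flare; lra. Qed.
Lemma tau_gt0 : 0 < tau. Proof. by rewrite divr_gt0. Qed.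
Lemma tau_le : 4 ^+ 3 * (4 ^+ 3 * tau) <= 1. Proof. have h := B1; rewrite /inset; lra. Qed.
Lemma tauee_gt0 : 0 < tau * ee. Proof. by rewrite mulr_gt0 ?tau_gt0 ?ee_gt0. Qed.
Lemma tauee_le : 4 ^+ 3 * (4 ^+ 3 * (tau * ee)) <= ee.
Proof.
have h1 := tau_le; have h2 := ee_gt0.
have h3 := ler_wpM2r (ltW h2) h1; lra.
Qed.
Lemma ww_mul : ww * n = 2 * (1 + ee).
Proof. by have h1 := n_ge2; rewrite /ww divfK// gt_eqF//; lra. Qed.
Lemma ww_gt0 : 0 < ww.
Proof. by have h1 := n_ge2; have h2 := ee_gt0; rewrite divr_gt0//; lra. Qed.
Lemma ww_le : ww <= 1 + ee.
Proof.
have h1 := n_ge2; have h2 := ww_gt0; have h3 := ww_mul.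
have h4 : ww * 2 <= ww * n by rewrite ler_pM2l.
lra.
Qed.
Lemma n3k1 : 2 * 4 * 4 * (2 * 4 * 4 * (n ^+ 3 * k1)) <= 64^-1 ^+ 2.
Proof.
apply: le_trans k1n _; have h1 := tau_le; have h2 := ee_le.
have h3 := ee_gt0; have h4 := tau_gt0.
by rewrite expr2; apply: ler_pM; lra.
Qed.
Lemma n2k1 : 4 ^+ 3 * (n ^+ 2 * k1) <= 64^-1 ^+ 2.
Proof.
have h := n3k1; have n2 := n_ge2.
have h1 : 2 * (n ^+ 2 * k1) <= n ^+ 3 * k1.
  rewrite (exprS n 2) -(mulrA n); apply: ler_wpM2r => //.
  by rewrite mulr_ge0 ?sqr_ge0// ltW.
have h3 : 0 <= n ^+ 3 * k1 by rewrite mulr_ge0 ?exprn_ge0 ?(ltW k10)//; lra.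
lra.
Qed.
Lemma k1_small : 4 ^+ 3 * k1 <= 64^-1 ^+ 2.
Proof.
have h := n2k1; have n2 := n_ge2.
have h3 : 1 * k1 <= n ^+ 2 * k1.
  apply: ler_wpM2r; first exact: ltW.
  by rewrite -(expr1n _ 2) ler_pXn2r ?nnegrE//; lra.
lra.
Qed.
Lemma St_gt0 : 0 < St.
Proof.
have h : 0 < St * k1 ^+ 2 by apply: lt_le_trans Sk1.
by rewrite pmulr_lgt0// exprn_gt0 in h.
Qed.
Lemma Sk1_ge : 4 ^+ 3 * (4 ^+ 3 * 64) <= St * k1.
Proof.
have h := k1_small; have h2 := Sk1.
have h3 : 0 < St * k1 by rewrite mulr_gt0// St_gt0.
have h4 : (St * k1) * (4 ^+ 3 * k1) <= (St * k1) * 64^-1 ^+ 2 by rewrite ler_pM2l.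
lra.
Qed.
Lemma St_ge : 4 ^+ 3 * (4 ^+ 3 * 64) <= St.
Proof.
have h := Sk1_ge; have s0 := St_gt0; have h2 := k1_small; apply: le_trans h _.
by rewrite ler_piMr ?(ltW s0)//; lra.
Qed.
Lemma B2 : B ^+ 2 <= 64^-1 * B.
Proof.
have h1 := B1; rewrite expr2; apply: ler_wpM2r; [exact: ltW | lra].
Qed.
Lemma k1B2 : k1 * B ^+ 2 <= 64^-1 ^+ 2.
Proof.
have h1 := B2; have h2 := k1_small; have h3 : 0 <= B ^+ 2 := sqr_ge0 _.
have h4 : k1 * B ^+ 2 <= 1 * B ^+ 2 by rewrite ler_wpM2r//; lra.
have h5 := B1; lra.
Qed.

Lemma edge_vertex j k : (j < N)%N -> (k <= N)%N -> edge j (xv k) <= - (St * depth R N k).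
Proof.
move=> jN kN; have w0 := ww_gt0; have s0 := St_gt0.
rewrite /edge /xv.
have -> : St * descent R N j / ww * (- (1 + ee) + k%:R * ww - (- (1 + ee) + j%:R * ww)) =
   St * (descent R N j * (k%:R - j%:R)) * (ww / ww) by ring.
rewrite divff ?gt_eqF// mulr1 -opprD lerN2 -mulrDr ler_pM2l//.
exact: depth_le_edge.
Qed.

(** The chain reaches depths of at most [2 * qq] ([depth_bound]), so [inbox] holds the polygon
    together with the probes; [rho] bounds distances within it ([inbox_dist]). *)
Definition qq := n ^+ 2 * St.
Definition rho := 8 * qq.
Definition inbox (x y : R) := `|x| <= 2 /\ - (3 * qq) <= y <= qq.

Lemma qq_ge : 4 ^+ 3 * (4 ^+ 3 * 64) <= qq.
Proof.
have h := St_ge; have n2 := n_ge2; apply: le_trans h _.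
have h1 : 1 * St <= n ^+ 2 * St.
  apply: ler_wpM2r; first exact: ltW St_gt0.
  by rewrite -(expr1n _ 2) ler_pXn2r ?nnegrE//; lra.
by rewrite /qq; lra.
Qed.

Lemma inbox_dist x y x' y' : inbox x y -> inbox x' y' ->
  (x' - x) ^+ 2 + (y' - y) ^+ 2 <= rho ^+ 2.
Proof.
move=> [hx /andP[y1 y2]] [hx' /andP[y1' y2']]; have q1 := qq_ge.
have h1 : (x' - x) ^+ 2 <= 4 ^+ 2.
  rewrite -real_normK ?num_real// ler_pXn2r ?nnegrE//.
  by apply: le_trans (ler_normB _ _) _; lra.
have h2 : (y' - y) ^+ 2 <= (4 * qq) ^+ 2.
  rewrite -real_normK ?num_real// ler_pXn2r ?nnegrE//; last by lra.
  by rewrite ler_norml; apply/andP; split; lra.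
have h3 : 1 * 1 <= qq * qq by apply: ler_pM; lra.
rewrite /rho; lra.
Qed.

Lemma xv_bound k : (k <= N)%N -> - (1 + ee) <= xv k <= 1 + ee.
Proof.
move=> kN; have h := ww_mul; have w0 := ww_gt0.
have h1 : k%:R * ww <= n * ww by rewrite ler_wpM2r ?(ltW w0)// ler_nat.
have h2 : 0 <= k%:R * ww by rewrite mulr_ge0// ltW.
by rewrite /xv; apply/andP; split; lra.
Qed.

Lemma near_inbox k x y : (k <= N)%N -> near_vertex k x y -> inbox x y.
Proof.
move=> kN [hx hy _ hn]; have /andP[x1 x2] := xv_bound kN.
have k1s := k1_small; have e1 := ee_le; have q1 := qq_ge.
split.
  move: hx; rewrite !ler_norml => /andP[hx1 hx2]; apply/andP; split; lra.
have /andP[d1 d2] := depth_bound R N2 k.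
have s0 := St_gt0.
have h1 : St * depth R N k <= St * (2 * n ^+ 2) by rewrite ler_pM2l.
have h2 : (n ^+ 2 * St) * (4 ^+ 3 * k1) <= (n ^+ 2 * St) * 64^-1 ^+ 2.
  by rewrite ler_wpM2l// mulr_ge0 ?sqr_ge0// ltW.
have h3 : 0 <= n ^+ 2 * St by rewrite mulr_ge0 ?sqr_ge0// ltW.
have h4 : 0 <= St * k1 by rewrite mulr_ge0 ?(ltW s0)// ltW.
move: hy; rewrite ler_norml => /andP[hy1 hy2]; rewrite /qq in q1 *.
by apply/andP; split; lra.
Qed.

Lemma kap_small : 4 ^+ 3 * kap <= 64^-1 ^+ 2.
Proof. have h1 := kapE; have h2 := k1B2; lra. Qed.

Lemma mid_inbox j : (j < N)%N -> inbox (mx j) (my j).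
Proof.
move=> jN; have /andP[x1 x2] := xv_bound (ltnW jN).
have w0 := ww_gt0; have w1 := ww_le; have e1 := ee_le; have q1 := qq_ge.
have s0 := St_gt0; have k1s := kap_small; have k0 := kap0.
have /andP[m1 m2] := mid_ge R N2 jN.
have h1 : St * mid_depth R N j <= St * (2 * n ^+ 2) by rewrite ler_pM2l.
have h2 : 0 <= St * mid_depth R N j by rewrite mulr_ge0 ?(ltW s0)//; lra.
split; first by rewrite /mx ler_norml; apply/andP; split; lra.
by rewrite /my; rewrite /qq in q1 *; apply/andP; split; lra.
Qed.

Lemma roof_le x : roof x <= 1 + B / 2.
Proof. by rewrite /roof !ge_min lexx. Qed.

Lemma roof_geP x y : (y <= roof x) = [&& y <= 1 + B / 2, y <= 1 + B * (1 - x),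
  y <= 1 + B * (1 + x), y <= (1 + ee - x) / ee & y <= (1 + ee + x) / ee].
Proof. by rewrite /roof !le_min -!andbA. Qed.

Lemma om_bounds : 1 < om /\ om < 1 + ee.
Proof.
have h1 := tauee_gt0; have h2 := tauee_le; have h3 := ee_gt0.
by rewrite /om; split; lra.
Qed.

Lemma roof_ge x : `|x| <= om -> tau <= roof x.
Proof.
rewrite ler_norml => /andP[x1 x2]; have [o1 o2] := om_bounds.
have e0 := ee_gt0; have e1 := ee_le; have t1 := tau_le; have b1 := B1; have b0 := B0.
have ht : (1 + ee - om) / ee = tau by rewrite /om; field; rewrite gt_eqF.
have Bx : B * `|x| <= B * 2.
  by rewrite ler_pM2l// ler_norml; apply/andP; split; lra.
have Bx1 : B * x <= B * 2 by rewrite ler_pM2l//; lra.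
have Bx2 : B * - x <= B * 2 by rewrite ler_pM2l//; lra.
rewrite roof_geP; apply/and5P; split; [lra_with b0 t1 Bx1 b1 Bx2 x2 x1| lra_with b0 t1 Bx1 b1 Bx2 x2 x1 | lra_with b0 t1 Bx1 b1 Bx2 x2 x1 | |];
  by rewrite -ht ler_pM2r ?invr_gt0//; lra_with b0 t1 Bx1 b1 Bx2 x2 x1.
Qed.

Lemma X_inbox x : `|x| <= om -> inbox x (Xy x).
Proof.
move=> hx; have h1 := roof_ge hx; have h2 := roof_le x; have [o1 o2] := om_bounds.
have h3 := tau_gt0; have h4 := kap_small; have h5 := kap0; have q1 := qq_ge.
have h6 := B1; have h7 := ee_le.
split; first by apply: le_trans hx _; lra.
by rewrite /Xy; apply/andP; split; lra.
Qed.

Section Excluded.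
Variables (T : R -> R -> Prop) (D : R).
Hypotheses (cT : convex2 T) (rT : rolling D T) (D0 : 0 < D).
Hypothesis D1 : 2 * (2 + rho / k1) * rho <= D.
Hypothesis D2 : 2 * (2 + rho / k1) ^+ 2 * rho ^+ 3 / D <= E.

Local Tactic Notation "lra_with" ne_hyp_list(hs) :=
  clear - hs R N B St k1 kap khat E P N2 B0 B1 k10 k1n Sk1 kap0 kapE E0 EE T D cT rT D0 D1 D2; lra.

Lemma cross_inbox p1 q1 p2 q2 z11 z12 z21 z22 x1 x2 x1' x2' :
  inbox z11 z12 -> inbox z21 z22 -> inbox x1 x2 -> inbox x1' x2' ->
  p1 * z11 + q1 * z12 <= p1 * x1 + q1 * x2 ->
  p1 * z11 + q1 * z12 <= p1 * x1' + q1 * x2' ->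
  p1 * z11 + q1 * z12 < p1 * z21 + q1 * z22 ->
  p2 * x1 + q2 * x2 <= p2 * z21 + q2 * z22 ->
  p2 * x1' + q2 * x2' <= p2 * z21 + q2 * z22 ->
  p2 * z11 + q2 * z12 < p2 * z21 + q2 * z22 ->
  T x1 x2 -> T x1' x2' -> ~ T z11 z12 -> ~ T z21 z22 ->
  k1 ^+ 2 <= (z21 - z11) ^+ 2 + (z22 - z12) ^+ 2 ->
  E <= (z21 - z11) * (x2 - z12) - (z22 - z12) * (x1 - z11) ->
  (z21 - z11) * (x2' - z12) - (z22 - z12) * (x1' - z11) <= - E -> False.
Proof.
move=> bz1 bz2 bx bx' h1 h2 h3 h4 h5 h6 Tx Tx' nz1 nz2 hl c1 c2.
have r0 : 0 <= rho by have q1' := qq_ge; rewrite /rho; lra.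
have l0 := k10.
apply: (cross_seg cT rT D0 l0 r0 D1 E0 h1 h2 h3 h4 h5 h6 Tx Tx' nz1 nz2 _ _ D2 c1 c2).
  by rewrite hl; exact: inbox_dist.
exact: inbox_dist.
Qed.

(** Provides, on every vertical line between the ends of the chain, a point of [T] that lies below
    the roof but far above the middles of the edges: an end for vertical crossing segments. *)
Lemma chord_below v1 v2 v1' v2' x :
  near_vertex 0 v1 v2 -> near_vertex N v1' v2' -> T v1 v2 -> T v1' v2' ->
  4 * k1 <= x + (1 + ee) -> 4 * k1 <= (1 + ee) - x ->
  exists2 y, T x y & - (2 * n ^+ 2 * St * k1) <= y <= - (St * k1 / 2).
Proof.
move=> [hx hy _ hu] [hx' hy' _ hu'] Tv Tv' h1 h2.
have k1s := k1_small; have e0 := ee_gt0; have wn' := ww_mul; have p1 := k10.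
move: hx hy hx' hy'; rewrite depth0// depthN// mulr0 addr0 !ler_norml.
rewrite /xv mul0r addr0 [n * ww]mulrC wn'.
move=> /andP[a1 a2] /andP[b1 b2] /andP[a1' a2'] /andP[b1' b2'].
have lt : 0 < v1' - v1 by lra.
pose t := (x - v1) / (v1' - v1).
have tE : t * (v1' - v1) = x - v1 by rewrite /t divfK// gt_eqF.
have t0 : 0 <= t by rewrite divr_ge0 ?(ltW lt)//; lra.
have t1 : t <= 1 by rewrite ler_pdivrMr//; lra.
exists ((1 - t) * v2 + t * v2').
  have -> : x = (1 - t) * v1 + t * v1' by lra.
  by apply: cT => //; rewrite t0 t1.
have u0 : 0 <= 1 - t by rewrite subr_ge0.
set b := 2 * n ^+ 2 * St * k1 in b1 b1' *; set c := St * k1 / 2 in hu hu' *.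
have q1 := ler_wpM2l u0 b1; have q2 := ler_wpM2l t0 b1'.
have q3 := ler_wpM2l u0 hu; have q4 := ler_wpM2l t0 hu'.
by apply/andP; split; lra_with q2 q1 q4 q3.
Qed.

Lemma ww_k1 : 4 * 4 * k1 <= ww.
Proof.
have h := ww_mul; have h1 := n2k1; have n2 := n_ge2; have e0 := ee_gt0; have p1 := k10.
have h2 : (n * k1) * 2 <= (n * k1) * n by rewrite ler_pM2l// mulr_gt0//; lra.
have h3 : n * (4 * 4 * k1) <= n * ww by lra.
by rewrite ler_pM2l// in h3; lra.
Qed.

Lemma U_ge : 4 ^+ 3 * (4 ^+ 3 * 64) <= n ^+ 2 * St * k1.
Proof.
have h := Sk1_ge; apply: le_trans h _; have n2 := n_ge2.
rewrite -mulrA ler_peMl//.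
  by rewrite mulr_ge0 ?(ltW k10)// ltW// St_gt0.
by rewrite -(expr1n _ 2) ler_pXn2r ?nnegrE//; lra.
Qed.

Lemma U_facts : [/\ 4 ^+ 3 * (n ^+ 2 * St * k1) <= St,
  4 ^+ 3 * (n ^+ 2 * St * k1) <= St * ww, kap <= n ^+ 2 * St * k1 & 4 * 4 * E <= St * ww].
Proof.
have U1 := U_ge; have ks := kap_small; have h2 := n2k1; have h3 := n3k1.
have s0 := St_gt0; have e0 := ee_gt0; have n2 := n_ge2; have wn' := ww_mul.
have EE' := EE; have kB := k1B2.
have h4 := ler_wpM2l (ltW s0) h2; have h5 := ler_wpM2l (ltW s0) h3.
have h6 : 4 ^+ 3 * (n ^+ 2 * St * k1) <= St * ww.
  have h7 : n * (4 ^+ 3 * (n ^+ 2 * St * k1)) <= n * (St * ww).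
    have -> : n * (St * ww) = St * (2 * (1 + ee)) by rewrite -wn'; ring.
    have se : 0 <= St * ee by rewrite mulr_ge0 ?(ltW s0) ?(ltW e0).
    by rewrite (exprS n 2) in h5; lra.
  by rewrite ler_pM2l// in h7; lra.
by split => //; lra_with h4 U1 ks h6 kB EE'.
Qed.

(** The crossing segment is vertical. Its lower end is the point of [T] near vertex [i.+1], which is
    below the line joining the two middles by [mid_chord]; its upper end is given by
    [chord_below]. *)
Lemma not_two_mids i j v1 v2 a1 a2 b1 b2 : (i < j < N)%N ->
  near_vertex i.+1 v1 v2 -> near_vertex 0 a1 a2 -> near_vertex N b1 b2 ->
  T v1 v2 -> T a1 a2 -> T b1 b2 -> ~ T (mx i) (my i) -> ~ T (mx j) (my j) -> False.
Proof.
move=> ijN nv na nb Tv Ta Tb ni nj.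
have /andP[ij jN] := ijN; have iN := ltn_trans ij jN.
have ij' : i%:R + 1 <= j%:R :> R by rewrite natr1 ler_nat.
have jj1 : 1 <= j%:R - i%:R :> R by rewrite lerBrDl.
have w0 := ww_gt0; have s0 := St_gt0.
have [U1 U2 U3 U4] := U_facts.
have bv := near_inbox (leq_trans iN (leqnn N)) nv.
have [hx hy _ hu] := nv.
have xvE : xv i.+1 = mx i + ww / 2 by rewrite /mx /xv -[i.+1%:R]natr1; lra.
have mxE : mx j - mx i = (j%:R - i%:R) * ww by rewrite /mx /xv; lra.
have ijw : 1 * ww <= (j%:R - i%:R) * ww by rewrite ler_pM2r.
have wk := ww_k1; have p1 := k10.
move: hx; rewrite xvE ler_norml => /andP[hx1 hx2].
have [y Ty /andP[y1 y2]] : exists2 y, T v1 y &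
    - (2 * n ^+ 2 * St * k1) <= y <= - (St * k1 / 2).
  have i0 : 0 <= i%:R * ww by rewrite mulr_ge0// ltW.
  have jn : (j%:R + 1) * ww <= n * ww by rewrite ler_pM2r// natr1 ler_nat.
  have wn' := ww_mul.
  by apply: (chord_below na nb Ta Tb); move: hx1 hx2 mxE; rewrite /mx /xv => *; lra.
set U := n ^+ 2 * St * k1 in U1 U2 U3.
have UE : 2 * n ^+ 2 * St * k1 = 2 * U by rewrite /U; ring.
rewrite UE in y1 hy.
have by_ : inbox v1 y.
  have [b1' _] := bv; split => //; have q1 := qq_ge.
  have q3 : U <= qq * 64^-1.
    have k1s := k1_small; rewrite (_ : U = qq * k1); last by rewrite /U /qq; ring.
    by rewrite ler_wpM2l//; lra_with q1 k1s.
  have q4 : 0 < St * k1 by rewrite mulr_gt0.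
  by apply/andP; split; lra_with q3 q1 y1 q4 y2.
have /andP[mi1 mi2] := mid_ge R N2 iN; have /andP[mj1 mj2] := mid_ge R N2 jN.
have mc := mid_chord R N2 ijN.
have dE : St * depth R N i.+1 = St * mid_depth R N i + St * descent R N i / 2.
  by rewrite /mid_depth /descent; lra.
rewrite dE in hy; move: hy; rewrite ler_norml => /andP[hy1 hy2].
have dev : `|St * (mid_depth R N j - mid_depth R N i) * (v1 - mx i - ww / 2)| <= 8 * U.
  have -> : 8 * U = (St * (2 * n ^+ 2)) * (4 * k1) by rewrite /U; ring.
  rewrite normrM; apply: ler_pM => //; last first.
    by rewrite ler_norml; apply/andP; split; lra_with hx1 hx2.
  rewrite normrM (gtr0_norm s0) ler_pM2l// ler_norml.
  by apply/andP; split; lra_with mj1 mi2 mj2 mi1.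
move: dev; rewrite ler_norml => /andP[dev1 dev2].
have d2E : my j - my i = - (St * (mid_depth R N j - mid_depth R N i)) by rewrite /my; ring.
have vE : v1 - mx i = ww / 2 + (v1 - mx i - ww / 2) by rewrite [RHS]addrC subrK.
have lt12 : mx i < mx j by lra_with ijw mxE w0.
apply: (@cross_inbox 1 0 1 0 (mx i) (my i) (mx j) (my j) v1 y v1 v2) => //.
- exact: mid_inbox.
- exact: mid_inbox.
- by rewrite !mul1r !mul0r !addr0; lra_with hx1 wk w0.
- by rewrite !mul1r !mul0r !addr0; lra_with hx1 wk w0.
- by rewrite !mul1r !mul0r !addr0.
- by rewrite !mul1r !mul0r !addr0; lra_with hx2 wk ijw mxE w0.
- by rewrite !mul1r !mul0r !addr0; lra_with hx2 wk ijw mxE w0.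
- by rewrite !mul1r !mul0r !addr0.
- rewrite mxE; have h : k1 ^+ 2 <= ((j%:R - i%:R) * ww) ^+ 2.
    by rewrite ler_pXn2r ?nnegrE//; lra_with wk ijw w0 p1.
  by apply: le_trans h _; rewrite lerDl sqr_ge0.
- by rewrite d2E mxE vE; apply: (@mids_upper _ _ _ _ _ _ U) => //; rewrite ltW// kap0.
- rewrite d2E mxE vE.
  by apply: (@mids_lower _ _ _ _ _ _ (descent R N i) U) => //; [rewrite ltW// kap0 | lra_with hy2].
Qed.

(** Up to the factor [St / ww], the right-hand side is the depth at [xi] of the line of edge [j]. It
    is affine in [xi], controlled at both ends of the base by [edge_ends], and [xi] stays [tau * ee]
    away from these ends. *)
Lemma edge_gap j xi : (j < N)%N -> `|xi| <= om ->
  4 ^+ 5 * (n ^+ 2 * k1) <= ww * depth R N j + descent R N j * (xi - xv j).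
Proof.
move=> jN; rewrite ler_norml => /andP[x1 x2].
have [a0 b0 ab] := edge_ends R N2 jN; have n2 := n_ge2; have wn' := ww_mul.
set a := depth R N j - _ * _ in a0 ab; set b := depth R N j + _ * _ in b0 ab.
set W := ww * _ + _.
have n0 : 0 < n by lra.
have e : n * W = a * (1 + ee - xi) + b * (1 + ee + xi).
  have -> : n * W = (ww * n) * depth R N j + n * (descent R N j * (xi + (1 + ee))) -
      descent R N j * j%:R * (ww * n) by rewrite /W /xv; ring.
  by rewrite wn' /a /b; ring.
have t0 := tauee_gt0; have kn := k1n.
have h1 : a * (tau * ee) <= a * (1 + ee - xi) by rewrite ler_wpM2l//; move: x2; rewrite /om => x2; lra.
have h2 : b * (tau * ee) <= b * (1 + ee + xi) by rewrite ler_wpM2l//; move: x1; rewrite /om => x1; lra.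
have h3 : 1 * (tau * ee) <= (a + b) * (tau * ee) by rewrite ler_wpM2r// ltW.
have h4 : n * (4 ^+ 5 * (n ^+ 2 * k1)) <= n * W by rewrite e; move: kn; rewrite (exprS n 2) => kn; lra.
by rewrite ler_pM2l// in h4.
Qed.

(** Here the crossing segment runs along edge [j], between points of [T] near its two ends. These
    are separated by the segment from the middle to the roof point, because by [edge_gap] that
    segment leaves the line of the edge fast enough. *)
Lemma not_mid_and_roof j xi v1 v2 u1 u2 : (j < N)%N -> `|xi| <= om ->
  near_vertex j v1 v2 -> near_vertex j.+1 u1 u2 ->
  T v1 v2 -> T u1 u2 -> ~ T (mx j) (my j) -> ~ T xi (Xy xi) -> False.
Proof.
move=> jN hxi nv nu Tv Tu nj nX.
have w0 := ww_gt0; have s0 := St_gt0; have k0 := kap0.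
have [U1 U2 U3 U4] := U_facts; have Ug := U_ge.
have bv := near_inbox (ltnW jN) nv; have bu := near_inbox jN nu.
have bm := mid_inbox jN; have bX := X_inbox hxi.
have [hvx hvy hve hvu] := nv; have [hux huy hue huu] := nu.
have gap := edge_gap jN hxi.
set U := n ^+ 2 * St * k1 in U1 U2 U3 Ug.
set W := ww * _ + _ in gap.
have gapS : 4 ^+ 5 * U <= St * W.
  by rewrite (_ : _ * U = St * (4 ^+ 5 * (n ^+ 2 * k1))) ?ler_pM2l// /U; ring.
have r1 := roof_ge hxi; have r2 := roof_le xi; have t0 := tau_gt0; have b1 := B1.
have ks := kap_small.
have Y0 : 0 <= Xy xi by rewrite /Xy; lra.
have Y2 : Xy xi <= 2 by rewrite /Xy; lra.
have /andP[m1 m2] := mid_ge R N2 jN.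
have midE : mid_depth R N j = depth R N j + descent R N j / 2 by rewrite /mid_depth /descent; lra_with R.
have depE : depth R N j.+1 = depth R N j + descent R N j by rewrite /descent; lra_with R.
have xvE : xv j.+1 = xv j + ww by rewrite /xv -[j.+1%:R]natr1; lra_with R.
have s1 := St_ge.
have smid : 0 <= St * mid_depth R N j by rewrite mulr_ge0 ?(ltW s0)//; lra_with m1.
have d2b : `|Xy xi + St * (depth R N j + descent R N j / 2) + 2 * kap| <= 4 * (n ^+ 2 * St).
  rewrite -midE ger0_norm; last by lra_with smid Y0 k0.
  have := ler_wpM2l (ltW s0) m2; have := qq_ge; rewrite /qq => *; lra.
have dxb x y : `|x - y| <= 4 * k1 ->
    `|(Xy xi + St * (depth R N j + descent R N j / 2) + 2 * kap) * (x - y)| <= 4 * 4 * U.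
  move=> h; rewrite normrM (_ : 4 * 4 * U = (4 * (n ^+ 2 * St)) * (4 * k1)); last by rewrite /U; ring.
  exact: ler_pM.
have UE : 2 * n ^+ 2 * St * k1 = 2 * U by rewrite /U; ring.
rewrite UE in hvy huy.
have EU : E <= U by have := EE; have := k1B2 => *; lra.
have xim : `|xi - (xv j + ww / 2)| <= 4.
  by have [h1 _] := bm; have [h2 _] := bX; apply: le_trans (ler_normB _ _) _; rewrite /mx in h1; lra_with h1 h2.
have myE : my j = - (St * (depth R N j + descent R N j / 2)) - 2 * kap by rewrite /my midE.
have em : edge j (mx j) = - (St * mid_depth R N j).
  rewrite /edge /mx midE; field; exact: lt0r_neq0.
have edgeE x : edge j x = - (St * depth R N j) + St * descent R N j / ww * xv j - St * descent R N j / ww * x.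
  by rewrite /edge; ring.
set sl := St * descent R N j / ww in edgeE.
have eX : edge j xi <= 0.
  have -> : edge j xi = - (St * W / ww) by rewrite /edge /W; field; exact: lt0r_neq0.
  by rewrite oppr_le0 divr_ge0 ?(ltW w0)//; lra_with gapS U3 k0.
have hv := hve j jN; have hu := hue j jN.
rewrite edgeE in hv; rewrite edgeE in hu; rewrite edgeE in em; rewrite edgeE in eX.
have sk : 0 < St * k1 by rewrite mulr_gt0.
have my0 : my j = - (St * mid_depth R N j) - 2 * kap by [].
have my2 : my j <= - 1 by have h := ler_wpM2l (ltW s0) m1; lra_with h my0 Ug U1 k0.
(* The first linear form is, up to a constant, the height over the line of edge [j]; the second is
   the height. *)
apply: (@cross_inbox sl 1 0 1 (mx j) (my j) xi (Xy xi) v1 v2 u1 u2) => //.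
- by rewrite !mul1r; lra_with my0 em hv k0.
- by rewrite !mul1r; lra_with my0 em hu k0.
- by rewrite !mul1r; lra_with my0 eX em Y0 k0.
- by rewrite !mul1r !mul0r !add0r; lra_with sk Y0 hvu.
- by rewrite !mul1r !mul0r !add0r; lra_with sk Y0 huu.
- by rewrite !mul1r !mul0r !add0r; lra_with my0 smid Y0 k0.
- have h : 1 ^+ 2 <= (Xy xi - my j) ^+ 2 by rewrite ler_pXn2r ?nnegrE//; lra_with my2 Y0 my0 smid k0.
  have h2 : k1 ^+ 2 <= 1 ^+ 2.
    by have h3 := k1_small; rewrite ler_pXn2r ?nnegrE ?(ltW k10)//; lra_with h3.
  by apply: le_trans h2 (le_trans h _); rewrite lerDr sqr_ge0.
- rewrite myE (_ : v2 = - (St * depth R N j) + (v2 + St * depth R N j)); last by ring.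
  rewrite (_ : v1 = xv j + (v1 - xv j)); last by ring.
  apply: (@mid_roof_upper _ _ _ _ _ _ _ _ _ _ _ U) => //; first exact: ltW.
  exact: dxb.
- rewrite myE (_ : u2 = - (St * (depth R N j + descent R N j)) + (u2 + St * depth R N j.+1)); last by rewrite depE; ring.
  rewrite (_ : u1 = xv j + ww + (u1 - xv j.+1)); last by rewrite xvE; ring.
  apply: (@mid_roof_lower _ _ _ _ _ _ _ _ _ _ _ U) => //; first exact: ltW.
  exact: dxb.
Qed.

(** Again the crossing segment is vertical, from the given point above the chord of the two roof
    points down to the point supplied by [chord_below]. *)
Lemma not_two_roofs x1 x2 x y a1 a2 b1 b2 :
  `|x1| <= om -> `|x2| <= om -> ee / 2 <= x2 - x1 -> x1 <= x <= x2 -> y <= 2 ->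
  near_vertex 0 a1 a2 -> near_vertex N b1 b2 -> T a1 a2 -> T b1 b2 -> T x y ->
  E <= (x2 - x1) * (y - Xy x1) - (Xy x2 - Xy x1) * (x - x1) ->
  ~ T x1 (Xy x1) -> ~ T x2 (Xy x2) -> False.
Proof.
move=> hx1 hx2 x12 /andP[xx1 xx2] y2 na nb Ta Tb Txy hE n1 n2.
have e0 := ee_gt0; have p1 := k10; have n_2 := n_ge2.
have x1' : - om <= x1 by move: hx1; rewrite ler_norml => /andP[].
have x2' : x2 <= om by move: hx2; rewrite ler_norml => /andP[].
have k4 : 4 * k1 <= tau * ee.
  have h := k1n; have h1 : 1 * k1 <= n ^+ 3 * k1.
    by rewrite ler_wpM2r ?(ltW p1)// -(expr1n _ 3) ler_pXn2r ?nnegrE//; lra.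
  lra.
have [y' Ty' /andP[y1' y2']] : exists2 y', T x y' &
    - (2 * n ^+ 2 * St * k1) <= y' <= - (St * k1 / 2).
  by apply: (chord_below na nb Ta Tb); move: x1' x2'; rewrite /om => *; lra.
have r1 := roof_ge hx1; have r2 := roof_ge hx2; have t0 := tau_gt0; have k0 := kap0.
have q1 := qq_ge; have s0 := St_gt0; have E0' := E0.
have sk := Sk1_ge.
have U3 : n ^+ 2 * St * k1 <= qq * 64^-1.
  have k1s := k1_small; rewrite (_ : n ^+ 2 * St * k1 = qq * k1); last by rewrite /qq; ring.
  by rewrite ler_wpM2l//; lra_with q1 k1s.
have xb : `|x| <= 2.
  have [o1 o2] := om_bounds; have e1 := ee_le.
  by rewrite ler_norml; apply/andP; split; lra_with e1 o2 x1' xx1 x2' xx2.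
have X1 : 0 < Xy x1 by rewrite /Xy; lra.
have X2 : 0 < Xy x2 by rewrite /Xy; lra.
have x12' : 0 < x2 - x1 by lra.
have f1 : 0 <= (x2 - x) * Xy x1 by rewrite mulr_ge0 ?(ltW X1)//; lra.
have f2 : 0 <= (x - x1) * Xy x2 by rewrite mulr_ge0 ?(ltW X2)//; lra_with xx1.
have y0 : 0 < y.
  have : 0 < (x2 - x1) * y by lra.
  by rewrite pmulr_rgt0.
have Ele : 2 * E <= ee.
  have h1 := EE; have h2 := k1_small; have h3 := B0; have h4 := B2.
  have h5 : k1 * B ^+ 2 <= 1 * B ^+ 2 by rewrite ler_wpM2r ?sqr_ge0//; lra_with h2.
  by rewrite /flare; lra_with h5 h4 h1 E0'.
apply: (@cross_inbox 1 0 1 0 x1 (Xy x1) x2 (Xy x2) x y x y') => //.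
- exact: X_inbox.
- exact: X_inbox.
- by split => //; apply/andP; split; lra_with y0 q1 y2.
- by split => //; apply/andP; split; lra_with U3 q1 y1' sk y2'.
- by rewrite !mul1r !mul0r !addr0.
- by rewrite !mul1r !mul0r !addr0.
- by rewrite !mul1r !mul0r !addr0; lra_with e0 x12.
- by rewrite !mul1r !mul0r !addr0.
- by rewrite !mul1r !mul0r !addr0.
- by rewrite !mul1r !mul0r !addr0; lra_with e0 x12.
- have h : k1 ^+ 2 <= (x2 - x1) ^+ 2.
    rewrite ler_pXn2r ?nnegrE ?(ltW p1) ?(ltW x12')//.
    have h5 := tau_le; have h6 : tau * ee <= 4^-1 * ee by rewrite ler_wpM2r ?(ltW e0)//; lra_with h5.
    lra_with h6 k4 xx2 xx1 x12.
  by apply: le_trans h _; rewrite lerDl sqr_ge0.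
- have g : (x2 - x1) * y' <= (x2 - x1) * (- 1) by rewrite ler_pM2l//; lra_with sk y2'.
  have g2 : 0 <= (x2 - x1) * (Xy x1) by rewrite mulr_ge0// ltW.
  by lra_with g Ele f2 f1 x12.
Qed.

End Excluded.
End Shape.

(** * Boxes inside the polygon next to the vertices of the chain *)

Section Boxes.
Variables (R : rcfType) (N : nat) (B St k1 kap khat E : R).
Local Notation n := (N%:R : R).
Local Notation ee := (flare B).
Local Notation ww := (ww N B).
Local Notation xv := (xv N B).
Local Notation edge := (edge N B St).
Local Notation near_vertex := (near_vertex N B St k1).

(** The boxes at the two ends keep a distance [2 * k1] from the end, where the chain is already at
    depth [3 * (St * k1 / ww)] ([edge_first], [edge_last]). At an inner vertex the box is raised
    instead, by more than edges of slope at most [2 * n * (St / ww)] can climb over its width. *)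
Definition box_x (k : nat) : R :=
  if k == 0%N then xv 0 + 2 * k1 else if k == N then xv N - 3 * k1 else xv k.
Definition box_y (k : nat) : R :=
  if (k == 0%N) || (k == N) then - (2 * (St * k1 / ww))
  else - (St * depth R N k) + 3 * n * (St * k1 / ww).
(** By [pSk1] its area [St * k1 ^+ 2 / ww] is at least [2 / ww], so a polygon that misses one box
    altogether has lost enough. *)
Definition vbox (k : nat) (x y : R) :=
  box_x k <= x <= box_x k + k1 /\ box_y k <= y <= box_y k + St * k1 / ww.

Hypothesis P : params_ok N B St k1 kap khat E.

Local Tactic Notation "lra_with" ne_hyp_list(hs) :=
  clear - hs R N B St k1 kap khat E P; lra.

Lemma Sk1_ww : St * k1 / 2 + 1 <= St * k1 / ww /\ St * k1 / ww <= n / 2 * (St * k1).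
Proof.
have w0 := ww_gt0 P; have wl := ww_le P; have el := ee_le P; have wn' := ww_mul P.
have sk := Sk1_ge P; have n2 := n_ge2 P; have e0 := ee_gt0 P.
split.
  rewrite ler_pdivlMr//.
  have h : (St * k1 / 2 + 1) * ww <= (St * k1 / 2 + 1) * (1 + ee) by rewrite ler_wpM2l//; lra.
  have h2 : (St * k1) * ee <= (St * k1) * 4^-1 by rewrite ler_wpM2l//; lra.
  by lra.
rewrite ler_pdivrMr//.
have -> : n / 2 * (St * k1) * ww = (ww * n) * (St * k1 / 2) by ring.
have h : 2 * (St * k1 / 2) <= (ww * n) * (St * k1 / 2) by rewrite wn' ler_wpM2r//; lra.
by lra.
Qed.

Lemma khat_small : 4 ^+ 3 * khat <= k1.
Proof.
have h := pkhatE P; have h2 := B2 P; have b0 := pB0 P; have b1 := pB1 P; have k0 := pk10 P.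
have h3 : k1 * B ^+ 2 <= k1 * 1 by rewrite ler_pM2l//; lra.
have h4 := pkhat0 P; lra.
Qed.

Lemma edge_lin j x x' : edge j x' = edge j x - St * descent R N j / ww * (x' - x).
Proof. by rewrite /edge; ring. Qed.

Lemma slope_bound j : (j < N)%N -> `|St * descent R N j / ww| <= 2 * n * (St / ww).
Proof.
move=> jN; have s0 := St_gt0 P; have w0 := ww_gt0 P.
have /andP[_ h] := descent_abs R (pN2 P) jN.
rewrite !normrM normfV (gtr0_norm s0) (gtr0_norm w0).
have -> : 2 * n * (St / ww) = St * (2 * n) / ww by ring.
by rewrite ler_pM2r ?invr_gt0// ler_pM2l.
Qed.

(** Every edge line passes below vertices 0 and 1, hence below the first edge between them, whose
    descent is at least [3 / 2]. *)
Lemma edge_first j x : (j < N)%N -> xv 0 <= x <= xv 1 ->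
  edge j x <= - (3 / 2 * (St / ww) * (x - xv 0)).
Proof.
move=> jN /andP[x0 x1]; have s0 := St_gt0 P; have w0 := ww_gt0 P.
have N1 : (1 <= N)%N := ltnW (pN2 P).
have h0 := edge_vertex P jN (leq0n N); have h1 := edge_vertex P jN N1.
rewrite depth0 ?(pN2 P)// mulr0 oppr0 in h0.
have hd := descent0 R (pN2 P).
have hd1 : descent R N 0 = depth R N 1 by rewrite /descent depth0 ?(pN2 P)// subr0.
rewrite hd1 in hd.
have xE : xv 1 = xv 0 + ww by rewrite /xv; ring.
rewrite xE in h1 x1.
pose t := (x - xv 0) / ww.
have tE : t * ww = x - xv 0 by rewrite /t divfK// gt_eqF.
have t0 : 0 <= t by rewrite divr_ge0 ?(ltW w0)//; lra.
have t1 : 0 <= 1 - t by rewrite subr_ge0 ler_pdivrMr//; lra.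
have -> : 3 / 2 * (St / ww) * (x - xv 0) = t * (St * (3 / 2)).
  by rewrite -tE; field; rewrite gt_eqF.
have -> : edge j x = (1 - t) * edge j (xv 0) + t * edge j (xv 0 + ww).
  rewrite (edge_lin j (xv 0) x) (edge_lin j (xv 0) (xv 0 + ww)) -tE; ring.
have g1 := ler_wpM2l t1 h0; have g2 := ler_wpM2l t0 h1.
have g3 : t * (St * (3 / 2)) <= t * (St * depth R N 1) by rewrite ler_wpM2l// ler_pM2l.
lra.
Qed.

Lemma edge_last j x : (j < N)%N -> xv N - ww <= x <= xv N ->
  edge j x <= - (3 / 2 * (St / ww) * (xv N - x)).
Proof.
move=> jN /andP[x0 x1]; have s0 := St_gt0 P; have w0 := ww_gt0 P.
have h0 := edge_vertex P jN (leqnn N); have h1 := edge_vertex P jN (leq_pred N).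
rewrite depthN ?(pN2 P)// mulr0 oppr0 in h0.
have hd := descent_lastN R (pN2 P).
have NE : N.-1.+1 = N by rewrite prednK// (ltnW (pN2 P)).
have hd1 : descent R N N.-1 = - depth R N N.-1 by rewrite /descent NE depthN ?(pN2 P)// sub0r.
rewrite hd1 in hd.
have xE : xv N.-1 = xv N - ww by rewrite /xv -[in X in _ = _ + X * _ - _]NE -natr1; ring.
rewrite xE in h1.
pose t := (xv N - x) / ww.
have tE : t * ww = xv N - x by rewrite /t divfK// gt_eqF.
have t0 : 0 <= t by rewrite divr_ge0 ?(ltW w0)//; lra.
have t1 : 0 <= 1 - t by rewrite subr_ge0 ler_pdivrMr//; lra.
have -> : 3 / 2 * (St / ww) * (xv N - x) = t * (St * (3 / 2)).
  by rewrite -tE; field; rewrite gt_eqF.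
have -> : edge j x = (1 - t) * edge j (xv N) + t * edge j (xv N - ww).
  rewrite (edge_lin j (xv N) x) (edge_lin j (xv N) (xv N - ww)).
  have -> : x - xv N = - (t * ww) by rewrite tE; ring.
  ring.
have g1 := ler_wpM2l t1 h0; have g2 := ler_wpM2l t0 h1.
have g3 : t * (St * (3 / 2)) <= t * (St * depth R N N.-1) by rewrite ler_wpM2l// ler_pM2l//; lra.
lra.
Qed.

Lemma vbox_near k x y x' y' : (k <= N)%N -> vbox k x y ->
  `|x' - x| <= khat -> `|y' - y| <= khat -> near_vertex k x' y'.
Proof.
move=> kN [/andP[x1 x2] /andP[y1 y2]]; rewrite !ler_norml => /andP[a1 a2] /andP[b1 b2].
have k0 := pk10 P; have ks := khat_small; have [q1 q2] := Sk1_ww.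
have sk := Sk1_ge P; have n2 := n_ge2 P; have h0 := pkhat0 P.
have s0 := St_gt0 P; have w0 := ww_gt0 P; have wk := ww_k1 P.
have k1s := k1_small P.
have nn : 2 * (n * (St * k1)) <= n ^+ 2 * (St * k1).
  by rewrite expr2 -mulrA ler_wpM2r// mulr_ge0//; lra.
have nS : St * k1 <= n * (St * k1) by rewrite ler_peMl//; lra.
have UE : 2 * n ^+ 2 * St * k1 = 2 * (n ^+ 2 * (St * k1)) by ring.
have slk : (St / ww) * (4 ^+ 3 * khat) <= St * k1 / ww.
  by rewrite mulrAC ler_wpM2r ?invr_ge0 ?(ltW w0)// ler_wpM2l// ltW.
have hb1 := h0; have sww : 0 <= St / ww by rewrite divr_ge0 ?(ltW s0) ?(ltW w0).
rewrite /near_vertex UE.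
have [kz|kz] := eqVneq k 0%N.
  move: x1 x2 y1 y2; rewrite /box_x /box_y kz eqxx /= depth0 ?(pN2 P)// mulr0 addr0 => x1 x2 y1 y2.
  split; [by rewrite ler_norml; apply/andP; split; lra_with x1 ks a2 a1 x2 y1 nn k1s sk q2 q1 b1 y2 b2 |
    by rewrite ler_norml; apply/andP; split; lra_with x1 ks a2 a1 x2 y1 nn k1s sk q2 q1 b1 y2 b2 | | by lra_with x1 ks a2 a1 x2 y1 nn k1s sk q2 q1 b1 y2 b2].
  move=> j jN; apply: le_trans (edge_first jN _) _.
    by rewrite /xv in x1 x2 *; apply/andP; split; lra_with x1 ks a2 a1 x2 wk.
  have g : (St / ww) * (2 * k1 - khat) <= (St / ww) * (x' - xv 0) by rewrite ler_wpM2l//; lra.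
  have e1 : St / ww * k1 = St * k1 / ww by ring.
  by lra.
have N0 : (N == 0%N) = false by have := pN2 P; case: (N).
have [kn|kn] := eqVneq k N.
  move: x1 x2 y1 y2; rewrite /box_x /box_y kn N0 eqxx orbT /= depthN ?(pN2 P)// mulr0 addr0 => x1 x2 y1 y2.
  split; [by rewrite ler_norml; apply/andP; split; lra_with x1 ks a2 a1 x2 y1 nn k1s sk q2 q1 b1 y2 b2 |
    by rewrite ler_norml; apply/andP; split; lra_with x1 ks a2 a1 x2 y1 nn k1s sk q2 q1 b1 y2 b2 | | by lra_with x1 ks a2 a1 x2 y1 nn k1s sk q2 q1 b1 y2 b2].
  move=> j jN; apply: le_trans (edge_last jN _) _.
    by apply/andP; split; lra_with x1 wk ks a2 a1 x2.
  have g : (St / ww) * (2 * k1 - khat) <= (St / ww) * (xv N - x') by rewrite ler_wpM2l//; lra_with x2 a2.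
  have e1 : St / ww * k1 = St * k1 / ww by ring.
  by lra_with g y1 slk k1s sk q1 ks b1.
move: x1 x2 y1 y2; rewrite /box_x /box_y (negbTE kz) (negbTE kn) /= => x1 x2 y1 y2.
have kin : (0 < k < N)%N by rewrite lt0n kz ltn_neqAle kn.
have dk := depth_in R kin.
have sd : St * 1 <= St * depth R N k by rewrite ler_pM2l.
have n3 : 3 * n * (St * k1 / ww) <= 3 * n * (n / 2 * (St * k1)).
  by rewrite ler_wpM2l// mulr_ge0//; lra.
have n4 : 3 * n * (n / 2 * (St * k1)) = (3 / 2) * (n ^+ 2 * (St * k1)) by ring.
have n5 : 0 <= 3 * n * (St * k1 / ww) by rewrite mulr_ge0//; lra_with n2 sk q1.
have U1 : 4 ^+ 3 * (n ^+ 2 * (St * k1)) <= St by have [h _ _ _] := U_facts P; lra_with h.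
split.
- by rewrite ler_norml; apply/andP; split; lra_with x1 ks a2 a1 x2.
- by rewrite ler_norml; apply/andP; split; lra_with n5 y1 nn k1s sk q2 q1 ks b1 n3 y2 b2.
- move=> j jN; rewrite (edge_lin j (xv k)).
  have ev := edge_vertex P jN kN; have sb := slope_bound jN.
  have g : `|St * descent R N j / ww * (x' - xv k)| <= 2 * n * (St / ww) * (k1 + khat).
    by rewrite normrM; apply: ler_pM => //; rewrite ler_norml; apply/andP; split; lra_with x1 k0 a1 x2 a2.
  have e1 : 2 * n * (St / ww) * (k1 + khat) = 2 * n * (St * k1 / ww) + 2 * n * (St / ww * khat) by ring.
  have e2 : n * ((St / ww) * (4 ^+ 3 * khat)) <= n * (St * k1 / ww) by rewrite ler_wpM2l//; lra.
  have e3 : 1 * (St * k1 / ww) <= n * (St * k1 / ww) by rewrite ler_wpM2r//; lra_with sk q1 n2.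
  move: g; rewrite ler_norml => /andP[g1 g2].
  by lra_with g1 e3 e2 ev y1 k1s sk q1 ks b1.
- by lra_with U1 n3 sd y2 nn k1s sk q2 q1 ks b2.
Qed.

End Boxes.

(** * Points excluded by few translates *)

Section Shift.
Variable R : rcfType.
Implicit Types (T : R -> R -> Prop).

Definition shifted T (u v x y : R) : Prop := T (x - u) (y - v).

Lemma shift_convex2 T u v : convex2 T -> convex2 (shifted T u v).
Proof.
move=> cT x1 y1 x2 y2 t t01 h1 h2.
rewrite /shifted (_ : _ - u = (1 - t) * (x1 - u) + t * (x2 - u)); last by ring.
by rewrite (_ : _ - v = (1 - t) * (y1 - v) + t * (y2 - v)); [exact: cT | ring].
Qed.

Lemma shift_rolling D T u v : rolling D T -> rolling D (shifted T u v).
Proof.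
move=> rT x y /rT[c1 [c2 [h1 h2]]]; exists (c1 + u), (c2 + v); split.
  rewrite /in_disc in h1 *; apply: le_trans h1; rewrite le_eqVlt; apply/orP; left.
  by apply/eqP; ring.
move=> x' y' h; apply: h2; rewrite /in_disc in h *; apply: le_trans h.
by rewrite le_eqVlt; apply/orP; left; apply/eqP; ring.
Qed.

(** The sloping lines meet the flat top at abscissas [x0 - 1 / 2] and [x0 + 1 / 2], matching the
    upper corners of [roof]. *)
Definition capset (B x0 t0 x y : R) : Prop :=
  [/\ y <= t0, y + B * x <= t0 + B * x0 + B / 2 & y - B * x <= t0 - B * x0 + B / 2].

End Shift.

(* C is the part of C1 between the two caps and C' its perturbation.  C1 lies
   below height Yt, and the upper cap is centred at abscissa x0, K0 lower. *)
Record body_ok (R : rcfType) (N : nat) (B St k1 khat E : R)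
    (D Yt K0 Rr x0 : R) (C1 C C' : R -> R -> Prop) : Prop := BodyOk {
  b_convex : convex2 C1;
  b_rolling : rolling D C1;
  b_D0 : 0 < D;
  b_D1 : 2 * (2 + rho N St / k1) * rho N St <= D;
  b_D2 : 2 * (2 + rho N St / k1) ^+ 2 * rho N St ^+ 3 / D <= E;
  b_D3 : 4 ^+ 3 * (4 ^+ 3 * (K0 + 2 * B * Rr)) <= D;
  b_D4 : 64 + 4 * rho N St ^+ 2 <= D;
  b_K0 : 0 <= K0;
  b_top : forall x y, C1 x y -> y <= Yt;
  b_wide : forall x y, C1 x y -> `|x| <= Rr;
  b_x0 : `|x0| <= Rr;
  b_cap : forall x y, C x y <->
    [/\ C1 x y, capset B x0 (Yt - K0) x y & capset B x0 (Yt - K0) (- x) (- y)];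
  b_sub : forall x y, C x y -> C' x y;
  b_hat : forall x y, C' x y -> exists x' y',
    [/\ C x' y', `|x' - x| <= khat & `|y' - y| <= khat] }.

Section Lost.
Variables (R : rcfType) (N : nat) (B St k1 kap khat E : R).
Local Notation n := (N%:R : R).
Local Notation ee := (flare B).
Local Notation tau := (inset B).
Local Notation om := (om B).
Local Notation near_vertex := (near_vertex N B St k1).
Local Notation mx := (mx N B).
Local Notation my := (my N St kap).
Local Notation Xy := (Xy B kap).
Local Notation roof := (roof B).

Hypothesis P : params_ok N B St k1 kap khat E.
Variables (D Yt K0 Rr x0 : R) (C1 C C' : R -> R -> Prop).
Hypothesis H : body_ok N B St k1 khat E D Yt K0 Rr x0 C1 C C'.

Lemma roof_om : roof om = tau /\ roof (- om) = tau.
Proof.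
have [o1 o2] := om_bounds P; have e0 := ee_gt0 P.
have ht : (1 + ee - om) / ee = tau by rewrite /om; field; rewrite gt_eqF.
have om0 : 0 <= om by lra.
have r1 : tau <= roof om by apply: (roof_ge P); rewrite ger0_norm.
have r2 : tau <= roof (- om) by apply: (roof_ge P); rewrite normrN ger0_norm.
split; apply/eqP; rewrite eq_le ?r1 ?r2 andbT /roof !ge_min -ht.
  by rewrite lexx !orbT.
by rewrite lexx !orbT.
Qed.

Lemma Xy_om : Xy om = tau + 2 * kap /\ Xy (- om) = tau + 2 * kap.
Proof. by rewrite /Xy; have [-> ->] := roof_om. Qed.

Section Witnesses.
Variables (I : finType) (v : I -> R * R).

Definition all_shifts (x y : R) := forall i, shifted C' (v i).1 (v i).2 x y.

(** Polygons violating this or the next hypothesis miss a whole box or rectangle and are treated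
    separately in [inscribed_loss]. *)
Hypothesis Qbox : forall k, (k <= N)%N -> exists x y, vbox N B St k1 k x y /\ all_shifts x y.
Hypothesis Qtop : exists x y, [/\ `|x| <= 1, 2 / 5 <= y <= 1 & all_shifts x y].

Local Tactic Notation "lra_with" ne_hyp_list(hs) :=
  clear - hs R N B St k1 kap khat E P D Yt K0 Rr x0 C1 C C' H I v Qbox Qtop; lra.

Lemma Q_hat i x y : all_shifts x y -> exists x' y',
  [/\ shifted C (v i).1 (v i).2 x' y', `|x' - x| <= khat & `|y' - y| <= khat].
Proof.
move=> /(_ i) /(b_hat H)[x' [y' [h1 h2 h3]]].
exists (x' + (v i).1), (y' + (v i).2); split; first by rewrite /shifted !addrK.
  by rewrite (_ : _ - x = x' - (x - (v i).1))//; ring.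
by rewrite (_ : _ - y = y' - (y - (v i).2))//; ring.
Qed.

Lemma C_vertex i k : (k <= N)%N ->
  exists x y, near_vertex k x y /\ shifted C (v i).1 (v i).2 x y.
Proof.
move=> kN; have [x [y [hb hQ]]] := Qbox kN; have [x' [y' [h1 h2 h3]]] := Q_hat i hQ.
by exists x', y'; split => //; apply: (vbox_near P kN hb).
Qed.

Lemma CC1 i x y : shifted C (v i).1 (v i).2 x y -> shifted C1 (v i).1 (v i).2 x y.
Proof. by move=> /(b_cap H)[]. Qed.

Lemma C_peak i : exists x y,
  [/\ `|x| <= 1 + khat, 2 / 5 - khat <= y <= 1 + khat & shifted C (v i).1 (v i).2 x y].
Proof.
have [x [y [h1 /andP[h2 h3] hQ]]] := Qtop; have [x' [y' [h4 h5 h6]]] := Q_hat i hQ.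
exists x', y'; move: h1 h5 h6; rewrite !ler_norml => /andP[a1 a2] /andP[b1 b2] /andP[c1 c2].
by split => //; apply/andP; split; lra.
Qed.

Lemma small_facts : [/\ 4 ^+ 3 * khat <= 1, 4 ^+ 3 * kap <= 1 & 4 ^+ 3 * tau <= 1].
Proof.
have h1 := khat_small P; have h2 := k1_small P; have h3 := kap_small P; have h4 := tau_le P.
have h5 := pk10 P; have h6 := tau_gt0 P.
by split; lra.
Qed.

(** The sides of the cap have slope at most [B], and the two points are at most 4 apart
    horizontally. *)
Lemma top_violation (u1 u2 x y x' y' : R) : `|x| <= 2 -> `|x'| <= 2 ->
  ~ capset B x0 (Yt - K0) (x - u1) (y - u2) ->
  capset B x0 (Yt - K0) (x' - u1) (y' - u2) -> y' - 4 * B <= y.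
Proof.
rewrite !ler_norml => /andP[a1 a2] /andP[b1 b2] nc [c1 c2 c3]; rewrite leNgt.
have b0 := pB0 P; apply/negP => hy; apply: nc.
have g1 : B * (x - x') <= B * 4 by rewrite ler_pM2l//; lra.
have g2 : B * (x' - x) <= B * 4 by rewrite ler_pM2l//; lra.
by split; lra.
Qed.

Lemma bottom_violation (u1 u2 x y x' y' : R) : `|x| <= 2 -> `|x'| <= 2 ->
  ~ capset B x0 (Yt - K0) (- (x - u1)) (- (y - u2)) ->
  capset B x0 (Yt - K0) (- (x' - u1)) (- (y' - u2)) -> y <= y' + 4 * B.
Proof.
rewrite !ler_norml => /andP[a1 a2] /andP[b1 b2] nc [c1 c2 c3]; rewrite leNgt.
have b0 := pB0 P; apply/negP => hy; apply: nc.
have g1 : B * (x - x') <= B * 4 by rewrite ler_pM2l//; lra.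
have g2 : B * (x' - x) <= B * 4 by rewrite ler_pM2l//; lra.
by split; lra.
Qed.

Lemma excluded_cases i x y : ~ shifted C' (v i).1 (v i).2 x y ->
  [\/ ~ shifted C1 (v i).1 (v i).2 x y,
      shifted C1 (v i).1 (v i).2 x y /\ ~ capset B x0 (Yt - K0) (x - (v i).1) (y - (v i).2) |
      ~ capset B x0 (Yt - K0) (- (x - (v i).1)) (- (y - (v i).2))].
Proof.
move=> nC'; have nC : ~ shifted C (v i).1 (v i).2 x y by move=> /(b_sub H).
have [c1|nc1] := pselect (shifted C1 (v i).1 (v i).2 x y); last by constructor 1.
have [c2|nc2] := pselect (capset B x0 (Yt - K0) (x - (v i).1) (y - (v i).2)); last by constructor 2.
by constructor 3 => c3; apply: nC; apply/(b_cap H).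
Qed.

(** No cap can be responsible: violating the upper one would put the point almost as high as the
    peak of the polygon, and violating the lower one almost as deep as the deeper end of edge
    [j]. *)
Lemma mid_excluded i j : (j < N)%N -> ~ shifted C' (v i).1 (v i).2 (mx j) (my j) ->
  ~ shifted C1 (v i).1 (v i).2 (mx j) (my j).
Proof.
move=> jN /excluded_cases nC.
have [sm1 sm2 sm3] := small_facts; have b1 := pB1 P; have k0 := pkap0 P; have kh0 := pkhat0 P.
have s0 := St_gt0 P; have sg := St_ge P.
have /andP[m1 _] := mid_ge R (pN2 P) jN.
have [mxb _] := mid_inbox P jN.
have smid : St * 2^-1 <= St * mid_depth R N j by rewrite ler_pM2l.
case: nC => // [[_ nc]|nc].
  have [x [y [hx /andP[hy _] /(b_cap H)[_ hc _]]]] := C_peak i.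
  have := top_violation mxb _ nc hc; rewrite /my => /(_ _) h.
  have : y - 4 * B <= - (St * mid_depth R N j) - 2 * kap by apply: h; lra.
  by move=> hh; lra.
have [U1 U2 U3 _] := U_facts P.
have [k [kN kd]] : exists k, (k <= N)%N /\ mid_depth R N j + 4^-1 <= depth R N k.
  have /andP[d1 _] := descent_abs R (pN2 P) jN; rewrite /mid_depth.
  have [h|h] := leP 0 (descent R N j).
    by exists j.+1; split => //; rewrite (ger0_norm h) in d1; rewrite /descent in d1; lra.
  by exists j; split; [exact: ltnW | rewrite (ltr0_norm h) in d1; rewrite /descent in d1; lra].
have [x [y [nv hc]]] := C_vertex i kN.
have [xb _] := near_inbox P kN nv.
have /(b_cap H)[_ _ hc3] := hc.
have hh := bottom_violation mxb xb nc hc3.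
have [_ hy _ _] := nv; move: hy; rewrite ler_norml => /andP[_ hy].
have sk : St * (mid_depth R N j + 4^-1) <= St * depth R N k by rewrite ler_pM2l.
have UE : 2 * n ^+ 2 * St * k1 = 2 * (n ^+ 2 * St * k1) by ring.
by rewrite UE in hy; rewrite /my in hh; lra.
Qed.

(** The lower cap is ruled out by a point of the translate near the left end of the chain. If the
    upper cap is violated, the roof point is nearly as high as the peak, and [near_top] applies
    below it. *)
Lemma roof_excluded i xi : `|xi| <= om -> ~ shifted C' (v i).1 (v i).2 xi (Xy xi) ->
  ~ shifted C1 (v i).1 (v i).2 xi (Xy xi) \/
  3 / 10 <= Xy xi /\ forall zx zy, `|zx - xi| <= 4 ->
    Xy xi - rho N St <= zy <= Xy xi - 4^-1 -> shifted C1 (v i).1 (v i).2 zx zy.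
Proof.
move=> hxi /excluded_cases nC.
have [sm1 sm2 sm3] := small_facts; have b1 := pB1 P; have k0 := pkap0 P; have kh0 := pkhat0 P.
have [Xb _] := X_inbox P hxi; have b0 := pB0 P.
case: nC => [nC|[c1 nc]|nc]; first by left.
  right; split.
    have [x [y [hx /andP[hy _] /(b_cap H)[_ hc _]]]] := C_peak i.
    have xb : `|x| <= 2 by lra.
    by have := top_violation Xb xb nc hc; lra.
  move=> zx zy hz /andP[z1 z2].
  apply: (near_top (b_rolling H) (b_D0 H) b0 (b_K0 H) (b_top H) (b_wide H c1) (b_x0 H)
            (b_D3 H) (b_D4 H) c1) => //.
  - apply: contrapT => hn; apply: nc; split; rewrite leNgt; apply/negP => h; apply: hn.
    + by left.
    + by right; left.
    + by right; right; lra.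
  - by rewrite (_ : _ - _ - _ = zx - xi)//; ring.
  - by apply/andP; split; lra.
have [x [y [nv hc]]] := C_vertex i (leq0n N).
have [xb _] := near_inbox P (leq0n N) nv; have /(b_cap H)[_ _ hc3] := hc.
have hh := bottom_violation Xb xb nc hc3.
have [_ _ _ hu] := nv; have r := roof_ge P hxi; have t0 := tau_gt0 P; have sk := Sk1_ge P.
by exfalso; rewrite /Xy in hh; lra.
Qed.

Lemma mid_roof_disjoint i j xi : (j < N)%N -> `|xi| <= om ->
  ~ shifted C' (v i).1 (v i).2 (mx j) (my j) -> ~ shifted C' (v i).1 (v i).2 xi (Xy xi) -> False.
Proof.
move=> jN hxi /(mid_excluded jN) nj /(roof_excluded hxi).
have [sm1 sm2 sm3] := small_facts; have k0 := pkap0 P.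
have s0 := St_gt0 P; have sg := St_ge P.
case=> [nX|[h3 hall]]; last first.
  apply: nj; apply: hall.
    have [mxb _] := mid_inbox P jN; have [Xb _] := X_inbox P hxi.
    by apply: le_trans (ler_normB _ _) _; lra.
  have /andP[m1 m2] := mid_ge R (pN2 P) jN.
  have [_ /andP[X1 X2]] := X_inbox P hxi; have [_ /andP[my1 my2]] := mid_inbox P jN.
  have smid : St * 2^-1 <= St * mid_depth R N j by rewrite ler_pM2l.
  have q1 := qq_ge P.
  by rewrite /rho; rewrite /my in my1 my2 *; apply/andP; split; lra.
have [x [y [nv hc]]] := C_vertex i (ltnW jN).
have [x' [y' [nv' hc']]] := C_vertex i jN.
exact: (not_mid_and_roof P (shift_convex2 (b_convex H)) (shift_rolling (b_rolling H))
  (b_D0 H) (b_D1 H) (b_D2 H) jN hxi nv nv' (CC1 hc) (CC1 hc') nj nX).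
Qed.

Lemma mids_disjoint i j j' : (j < N)%N -> (j' < N)%N -> (j < j')%N ->
  ~ shifted C' (v i).1 (v i).2 (mx j) (my j) ->
  ~ shifted C' (v i).1 (v i).2 (mx j') (my j') -> False.
Proof.
move=> jN j'N jj' /(mid_excluded jN) nj /(mid_excluded j'N) nj'.
have [a1 [a2 [na ha]]] := C_vertex i (leq0n N).
have [b1 [b2 [nb hb]]] := C_vertex i (leqnn N).
have [c1 [c2 [nc hc]]] := C_vertex i jN.
have jjN : (j < j' < N)%N by rewrite jj'.
exact: (not_two_mids P (shift_convex2 (b_convex H)) (shift_rolling (b_rolling H))
  (b_D0 H) (b_D1 H) (b_D2 H) jjN nc na nb (CC1 hc) (CC1 ha) (CC1 hb) nj nj').
Qed.

Lemma om_ge0 : 0 <= om. Proof. by have [o1 _] := om_bounds P; lra. Qed.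

(** The end points, at height [tau + 2 * kap], are too low for the upper cap to exclude them. *)
Lemma ends_excluded i (xi : R) : `|xi| = om -> ~ shifted C' (v i).1 (v i).2 xi (Xy xi) ->
  ~ shifted C1 (v i).1 (v i).2 xi (Xy xi).
Proof.
move=> hxi; have [sm1 sm2 sm3] := small_facts.
have e : Xy xi = tau + 2 * kap.
  have [h1 h2] := Xy_om.
  by case: (ler0P xi) hxi => _ hxi; [rewrite -[xi]opprK hxi|rewrite hxi].
case/roof_excluded => [|//|[h _]]; first by rewrite hxi.
by rewrite e in h; lra.
Qed.

(** The peak of the polygon is far above the horizontal chord joining the two end points, so
    [not_two_roofs] applies. *)
Lemma ends_disjoint i : ~ shifted C' (v i).1 (v i).2 (- om) (Xy (- om)) ->
  ~ shifted C' (v i).1 (v i).2 om (Xy om) -> False.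
Proof.
have o0 := om_ge0; have [o1 o2] := om_bounds P.
have ha : `|om| = om by rewrite ger0_norm.
have hb : `|- om| = om by rewrite normrN.
move=> /(ends_excluded hb) n1 /(ends_excluded ha) n2.
have [a1 [a2 [na hA]]] := C_vertex i (leq0n N).
have [b1 [b2 [nb hB]]] := C_vertex i (leqnn N).
have [x [y [hx /andP[y1 y2] hc]]] := C_peak i.
have [sm1 sm2 sm3] := small_facts; have [X1 X2] := Xy_om.
have ks := khat_small P; have kk := k1_small P; have e0 := ee_gt0 P; have el := ee_le P.
have te := tauee_le P; have kn := pk1n P; have hk : khat <= tau * ee.
  have h1 : 1 * k1 <= n ^+ 3 * k1.
    have nn2 := n_ge2 P; have k0 := pk10 P.
    by rewrite ler_wpM2r ?(ltW k0)// -(expr1n _ 3) ler_pXn2r ?nnegrE//; lra_with nn2.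
  by have kh0 := pkhat0 P; lra.
have omE : om = 1 + ee - tau * ee by [].
have hx' : - om <= x <= om.
  by move: hx; rewrite ler_norml => /andP[h1 h2]; apply/andP; split; lra_with h1 omE hk te o1 h2.
apply: (not_two_roofs P (shift_convex2 (b_convex H)) (shift_rolling (b_rolling H))
  (b_D0 H) (b_D1 H) (b_D2 H) (x1 := - om) (x2 := om) _ _ _ hx' _ na nb
  (CC1 hA) (CC1 hB) (CC1 hc)) => //; rewrite ?ha ?hb//; try lra.
rewrite X1 X2 subrr mul0r subr0.
have Es : E <= 1.
  by have h1 := pEE P; have h2 := k1B2 P; have h3 := pE0 P; lra_with h2 h1.
have k0 := pkap0 P.
have g : 2 * (y - (tau + 2 * kap)) <= (om - - om) * (y - (tau + 2 * kap)) by rewrite ler_wpM2r//; lra_with sm3 sm2 sm1 y1 o1.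
have h1 := pEE P; have h2 := k1B2 P; lra_with h2 h1 g sm3 sm2 sm1 y1.
Qed.

End Witnesses.

(** * Distribution of the excluded points among the translates *)

Section Pigeonhole.
Variable v : 'I_N.+2 -> R * R.
Hypothesis Qbox : forall k, (k <= N)%N -> exists x y, vbox N B St k1 k x y /\ all_shifts v x y.
Hypothesis Qtop : exists x y, [/\ `|x| <= 1, 2 / 5 <= y <= 1 & all_shifts v x y].
Hypothesis Qmid : forall j, (j < N)%N -> ~ all_shifts v (mx j) (my j).
Hypothesis Qroof : forall xi, `|xi| <= om -> ~ all_shifts v xi (Xy xi).

Let excl i x y := ~ shifted C' (v i).1 (v i).2 x y.

Local Tactic Notation "lra_with" ne_hyp_list(hs) :=
  clear - hs R N B St k1 kap khat E P D Yt K0 Rr x0 C1 C C' H v Qbox Qtop Qmid Qroof excl; lra.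

Lemma not_Q x y : ~ all_shifts v x y -> exists i, excl i x y.
Proof. by move=> /existsNP[i hi]; exists i. Qed.

Lemma two_left : exists a b : 'I_N.+2, forall xi, `|xi| <= om ->
  excl a xi (Xy xi) \/ excl b xi (Xy xi).
Proof.
have [f hf] : {f : 'I_N -> 'I_N.+2 & forall j, excl (f j) (mx j) (my j)}.
  by apply: (@choice _ _ (fun (j : 'I_N) i => excl i (mx j) (my j))) => j; exact/not_Q/Qmid.
have finj : injective f.
  move=> j j' ff; apply/val_inj => /=.
  case: (ltngtP j j') => // jj; exfalso.
    apply: (mids_disjoint Qbox Qtop (ltn_ord j) (ltn_ord j') jj (hf j)).
    by rewrite ff; exact: hf.
  apply: (mids_disjoint Qbox Qtop (ltn_ord j') (ltn_ord j) jj (hf j')).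
  by rewrite -ff; exact: hf.
have /eqP/cards2P[a [b [_ hab]]] : #|~: [set f j | j : 'I_N]| = 2.
  apply/eqP; rewrite -(eqn_add2l #|[set f j | j : 'I_N]|) cardsC.
  by rewrite card_imset// !card_ord addn2.
exists a, b => xi hxi; have [i hi] := not_Q (Qroof hxi).
have [/imsetP[j _ ij]|] := boolP (i \in [set f j | j : 'I_N]).
  exfalso; apply: (mid_roof_disjoint Qbox Qtop (ltn_ord j) hxi (hf j)).
  by rewrite -ij; exact: hi.
by rewrite -finset.in_setC hab !inE => /orP[] /eqP <-; [left|right].
Qed.

(** If the cap were what excludes [xi], that roof point would have height at least [3 / 10], so the
    end point [z] would be more than [1 / 4] below it and belong to the shifted [C1] by
    [near_top]. *)
Lemma excl_with_end i xi (z : R) : `|z| = om -> `|xi| <= om -> excl i z (Xy z) ->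
  excl i xi (Xy xi) -> ~ shifted C1 (v i).1 (v i).2 xi (Xy xi).
Proof.
move=> hz hxi /(ends_excluded Qbox Qtop hz) nz /(roof_excluded Qbox Qtop hxi)[//|[h hall]].
exfalso; apply: nz; apply: hall.
  have [o1 o2] := om_bounds P; have el := ee_le P.
  by apply: le_trans (ler_normB _ _) _; rewrite hz; lra.
have [sm1 sm2 sm3] := small_facts; have [X1 X2] := Xy_om.
have e : Xy z = tau + 2 * kap.
  by case: (ler0P z) hz => _ hz; [rewrite -[z]opprK hz|rewrite hz].
have [_ /andP[_ q1]] := X_inbox P hxi; have q2 := qq_ge P.
have k0 := pkap0 P; have t0 := tau_gt0 P.
by rewrite e /rho; apply/andP; split; lra.
Qed.

Lemma Xy_range xi : `|xi| <= om -> 0 <= Xy xi <= 3 / 2.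
Proof.
move=> h; have r1 := roof_ge P h; have r2 := roof_le B xi; have t0 := tau_gt0 P.
have [sm1 sm2 sm3] := small_facts; have b1 := pB1 P; have k0 := pkap0 P.
by rewrite /Xy; apply/andP; split; lra.
Qed.

(** The slack [d * (B / 256)] is of order [B ^+ 2], as [d >= ee / 2]. It absorbs both [E] and the
    passage from a point of the polygon to one of [C] within [khat]. *)
Lemma chord_slack (d e y y' x x' : R) : ee / 2 <= d <= 4 -> `|e| <= 2 ->
  `|x' - x| <= khat -> `|y' - y| <= khat ->
  d * (B / 256) <= d * y - e * x -> E <= d * y' - e * x'.
Proof.
move=> /andP[d1 d2] he hx hy h.
have kh0 := pkhat0 P; have kE := pkhatE P; have EE := pEE P; have E0 := pE0 P.
have ks := k1_small P; have b0 := pB0 P.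
have g1 : `|e * (x' - x)| <= 2 * khat by rewrite normrM; apply: ler_pM.
have d0 : 0 <= d by apply: le_trans d1; have e0 := ee_gt0 P; lra.
have g2 : `|d * (y' - y)| <= 4 * khat.
  by rewrite normrM; apply: ler_pM => //; rewrite ger0_norm.
move: g1 g2; rewrite !ler_norml => /andP[a1 a2] /andP[b1 b2].
have g3 : (ee / 2) * (B / 256) <= d * (B / 256) by rewrite ler_wpM2r// divr_ge0// ltW.
have g4 : k1 * B ^+ 2 <= 1 * B ^+ 2 by rewrite ler_wpM2r ?sqr_ge0//; lra.
have g5 : (ee / 2) * (B / 256) = B ^+ 2 * (1 / 8) / 256 by rewrite /flare; field.
lra.
Qed.

Lemma left_chord i xi x y : `|xi| <= om -> ee / 2 <= xi + om ->
  excl i (- om) (Xy (- om)) -> excl i xi (Xy xi) -> all_shifts v x y ->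
  - om + khat <= x <= xi - khat -> y <= 3 / 2 ->
  (xi + om) * (y - Xy (- om)) - (Xy xi - Xy (- om)) * (x + om) < (xi + om) * (B / 256).
Proof.
move=> hxi d1 e1 e2 hQ /andP[x1 x2] hy; rewrite ltNge; apply/negP => hc.
have o0 := om_ge0; have hb : `|- om| = om by rewrite normrN ger0_norm.
have n1 := ends_excluded Qbox Qtop hb e1; have n2 := excl_with_end hb hxi e1 e2.
have [a1 [a2 [na hA]]] := C_vertex Qbox i (leq0n N).
have [b1 [b2 [nb hB]]] := C_vertex Qbox i (leqnn N).
have [x' [y' [hC hx' hy']]] := Q_hat i hQ.
have xi2 : xi <= om by move: hxi; rewrite ler_norml => /andP[].
have [o1 o2] := om_bounds P; have el := ee_le P.
have /andP[r1 r2] := Xy_range hxi.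
have /andP[r3 r4] : 0 <= Xy (- om) <= 3 / 2 by apply: Xy_range; rewrite hb.
have [sm1 sm2 sm3] := small_facts.
have hx'' := hx'; have hy'' := hy'.
move: hx'' hy''; rewrite !ler_norml => /andP[c1 c2] /andP[c3 c4].
apply: (not_two_roofs P (shift_convex2 (b_convex H)) (shift_rolling (b_rolling H))
  (b_D0 H) (b_D1 H) (b_D2 H) (x1 := - om) (x2 := xi) _ _ _ _ _ na nb
  (CC1 hA) (CC1 hB) (CC1 hC) _ n1 n2) => //; rewrite ?hb ?opprK//.
- by apply/andP; split; lra_with c1 x1 c2 x2.
- by lra_with c4 sm1 hy.
- apply: (@chord_slack _ _ (y - Xy (- om)) _ (x + om) _ _ _ _ _ hc).
  + by apply/andP; split; lra_with d1 el o2 xi2.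
  + by rewrite ler_norml; apply/andP; split; lra_with r4 r1 r3 r2.
  + by rewrite (_ : _ - _ = x' - x)//; ring.
  + by rewrite (_ : _ - _ = y' - y)//; ring.
Qed.

Lemma right_chord i xi x y : `|xi| <= om -> ee / 2 <= om - xi ->
  excl i om (Xy om) -> excl i xi (Xy xi) -> all_shifts v x y ->
  xi + khat <= x <= om - khat -> y <= 3 / 2 ->
  (om - xi) * (y - Xy om) - (Xy xi - Xy om) * (om - x) < (om - xi) * (B / 256).
Proof.
move=> hxi d1 e1 e2 hQ /andP[x1 x2] hy; rewrite ltNge; apply/negP => hc.
have o0 := om_ge0; have hb : `|om| = om by rewrite ger0_norm.
have n1 := ends_excluded Qbox Qtop hb e1; have n2 := excl_with_end hb hxi e1 e2.
have [a1 [a2 [na hA]]] := C_vertex Qbox i (leq0n N).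
have [b1 [b2 [nb hB]]] := C_vertex Qbox i (leqnn N).
have [x' [y' [hC hx' hy']]] := Q_hat i hQ.
have xi2 : - om <= xi by move: hxi; rewrite ler_norml => /andP[].
have [o1 o2] := om_bounds P; have el := ee_le P.
have /andP[r1 r2] := Xy_range hxi.
have /andP[r3 r4] : 0 <= Xy om <= 3 / 2 by apply: Xy_range; rewrite hb.
have [sm1 sm2 sm3] := small_facts.
have hx'' := hx'; have hy'' := hy'.
move: hx'' hy''; rewrite !ler_norml => /andP[c1 c2] /andP[c3 c4].
apply: (not_two_roofs P (shift_convex2 (b_convex H)) (shift_rolling (b_rolling H))
  (b_D0 H) (b_D1 H) (b_D2 H) (x1 := xi) (x2 := om) _ _ _ _ _ na nb
  (CC1 hA) (CC1 hB) (CC1 hC) _ n2 n1) => //; rewrite ?hb ?opprK//.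
- by apply/andP; split; lra_with c1 x1 c2 x2.
- by lra_with c4 sm1 hy.
- have -> : (om - xi) * (y' - Xy xi) - (Xy om - Xy xi) * (x' - xi) =
      (om - xi) * (y' - Xy om) - (Xy xi - Xy om) * (om - x') by ring.
  apply: (@chord_slack _ _ (y - Xy om) _ (om - x) _ _ _ _ _ hc).
  + by apply/andP; split; lra_with d1 el o2 xi2.
  + by rewrite ler_norml; apply/andP; split; lra_with r4 r1 r3 r2.
  + by rewrite (_ : _ - _ = - (x' - x)) ?normrN//; ring.
  + by rewrite (_ : _ - _ = y' - y)//; ring.
Qed.

(* The N points below the lower edges use up N distinct translates; M steps of
   length st along the roof replace a connectedness argument. *)
Theorem lost_region (M : nat) (st : R) : 2 * om <= M%:R * st -> 0 < st ->
  exists xi xi', [/\ `|xi| <= om, `|xi'| <= om, xi <= xi' <= xi + st,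
   (forall x y, ee / 2 <= xi + om -> all_shifts v x y -> - om + khat <= x <= xi - khat -> y <= 3 / 2 ->
    (xi + om) * (y - Xy (- om)) - (Xy xi - Xy (- om)) * (x + om) < (xi + om) * (B / 256)) &
   (forall x y, ee / 2 <= om - xi' -> all_shifts v x y -> xi' + khat <= x <= om - khat -> y <= 3 / 2 ->
    (om - xi') * (y - Xy om) - (Xy xi' - Xy om) * (om - x) < (om - xi') * (B / 256))].
Proof.
move=> hM st0; have o0 := om_ge0; have [o1 o2] := om_bounds P.
have [a [b hab]] := two_left.
have M0 : 0 < M%:R :> R.
  have h : 0 < M%:R * st by lra.
  by rewrite pmulr_lgt0 in h.
pose g (k : nat) := - om + k%:R * (2 * om / M%:R).
have hstep : 2 * om / M%:R <= st by rewrite ler_pdivrMr// (mulrC st).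
have step0 : 0 <= 2 * om / M%:R by apply: divr_ge0; [lra | exact: ltW].
have g0 : g 0%N = - om by rewrite /g mul0r addr0.
have gM : g M = om by rewrite /g; field; rewrite gt_eqF.
have gin k : (k <= M)%N -> `|g k| <= om.
  move=> kM; rewrite /g ler_norml; apply/andP; split.
    by rewrite lerDl mulr_ge0.
  rewrite -[leRHS]gM /g lerD2l ler_wpM2r// ler_nat//.
(* The translate [a'] excludes the first grid point but, by [ends_disjoint], not the last one. At a
   step where it stops excluding, [b'] has to take over, and [b'] excludes the right end as well. *)
have main a' b' : (forall xi, `|xi| <= om -> excl a' xi (Xy xi) \/ excl b' xi (Xy xi)) ->
    excl a' (- om) (Xy (- om)) ->
  exists xi xi', [/\ `|xi| <= om, `|xi'| <= om, xi <= xi' <= xi + st,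
   excl a' (- om) (Xy (- om)) /\ excl a' xi (Xy xi) & excl b' om (Xy om) /\ excl b' xi' (Xy xi')].
  move=> hab' ha.
  have na : ~ excl a' om (Xy om) by move=> h; exact: (ends_disjoint Qbox Qtop ha h).
  have [k [kM pk npk]] : exists k, [/\ (k < M)%N, excl a' (g k) (Xy (g k)) &
       ~ excl a' (g k.+1) (Xy (g k.+1))].
    apply: contrapT => hn.
    have hall k : (k <= M)%N -> excl a' (g k) (Xy (g k)).
      elim: k => [_|k IH kM]; first by rewrite g0.
      by apply: contrapT => h; apply: hn; exists k; split => //; apply: IH; exact: ltnW.
    by apply: na; rewrite -gM; exact: hall.
  exists (g k), (g k.+1); split => //.
  - exact/gin/ltnW.
  - exact: gin.
  - by rewrite /g -[k.+1%:R]natr1; apply/andP; split; lra.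
  - split; first by case: (hab' om) => //; rewrite ger0_norm.
    by case: (hab' (g k.+1)) => //; exact: gin.
have [a' [b' [xi [xi' [h1 h2 h3 [h4 h5] [h6 h7]]]]]] : exists a' b' xi xi',
   [/\ `|xi| <= om, `|xi'| <= om, xi <= xi' <= xi + st,
   excl a' (- om) (Xy (- om)) /\ excl a' xi (Xy xi) & excl b' om (Xy om) /\ excl b' xi' (Xy xi')].
  have : excl a (- om) (Xy (- om)) \/ excl b (- om) (Xy (- om)).
    by apply: hab; rewrite normrN ger0_norm.
  case=> [ha|hb]; first by exists a, b; apply: main.
  by exists b, a; apply: main => // xi hxi; case: (hab xi hxi); [right|left].
exists xi, xi'; split => // x y hd hQ hx hy.
  exact: (left_chord h1 hd h4 h5 hQ hx hy).
exact: (right_chord h2 hd h6 h7 hQ hx hy).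
Qed.

End Pigeonhole.
End Lost.

(** * Translates cutting out the model polygon *)

(** The quantity [rho ^+ 2 / D] bounds the sag of an arc of radius [D] across the box. The cap must
    be at least that deep, and [kap] has to cover sag and perturbation times the largest norm of a
    normal vector in use. *)
Record support_ok (R : rcfType) (N : nat) (B St k1 kap khat : R)
    (D Yt K0 : R) (x0 : R) (C1 : R -> R -> Prop) : Prop := SupportOk {
  s_support : forall p q, p ^+ 2 + q ^+ 2 = 1 -> exists c1 c2,
    (forall x y, in_disc c1 c2 D x y -> C1 x y) /\
    (forall x y, C1 x y -> p * x + q * y <= p * c1 + q * c2 + D);
  s_bot : forall x y, C1 x y -> - Yt <= y;
  s_topdisc : forall x y, in_disc x0 (Yt - D) D x y -> C1 x y;
  s_K0 : rho N St ^+ 2 <= D * K0;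
  s_kap : (rho N St ^+ 2 / D + 2 * khat) *
    (2 + 2 * N%:R * (St / ww N B) + 1 / flare B) <= kap }.

Section Translates.
Variables (R : rcfType) (N : nat) (B St k1 kap khat E : R).
Local Notation n := (N%:R : R).
Local Notation ee := (flare B).
Local Notation ww := (ww N B).
Local Notation xv := (xv N B).
Local Notation edge := (edge N B St).
Local Notation roof := (roof B).
Local Notation inbox := (inbox N St).
Local Notation rho := (rho N St).

Hypothesis P : params_ok N B St k1 kap khat E.
Variables (D Yt K0 Rr x0 : R) (C1 C C' : R -> R -> Prop).
Hypothesis H : body_ok N B St k1 khat E D Yt K0 Rr x0 C1 C C'.
Hypothesis HS : support_ok N B St k1 kap khat D Yt K0 x0 C1.

Local Tactic Notation "lra_with" ne_hyp_list(hs) :=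
  clear - hs R N B St k1 kap khat E P D Yt K0 Rr x0 C1 C C' H HS; lra.

Lemma rho_facts : [/\ 1 <= rho, 4 * rho <= D, 4 ^+ 3 * K0 <= D & 0 <= B * Rr].
Proof.
have q1 := qq_ge P; have d4 := b_D4 H; have d3 := b_D3 H; have k0 := b_K0 H.
have b0 := pB0 P.
have r1 : 1 <= rho by rewrite /rho; lra.
have r0 : 0 <= B * Rr by rewrite mulr_ge0 ?(ltW b0)// (le_trans _ (b_x0 H)).
have r2 : 1 * rho <= rho ^+ 2 by rewrite expr2 ler_wpM2r//; lra.
split => //; lra.
Qed.

Lemma cap_deep x y : `|x| <= Rr -> y <= Yt - K0 - 2 * (B * Rr) -> capset B x0 (Yt - K0) x y.
Proof.
move=> hx hy; have b0 := pB0 P; have hx0 := b_x0 H.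
have [_ _ _ r0] := rho_facts.
have g1 : B * `|x| <= B * Rr by rewrite ler_pM2l.
have g2 : B * `|x0| <= B * Rr by rewrite ler_pM2l.
have a1 : `|B * x| <= B * Rr by rewrite normrM gtr0_norm.
have a2 : `|B * x0| <= B * Rr by rewrite normrM gtr0_norm.
move: a1 a2; rewrite !ler_norml => /andP[c1 c2] /andP[c3 c4].
by split; lra.
Qed.

(** Within the box the translate acts as a half-plane. The second condition says that the line is
    steep; the contact point is then about [D / 2] or more away from the top and the bottom of [C1],
    out of reach of the caps. *)
Lemma line_translate p q t m1 m2 : 0 < p ^+ 2 + q ^+ 2 -> 4 * q ^+ 2 <= p ^+ 2 + q ^+ 2 ->
  p ^+ 2 + q ^+ 2 <= (2 + 2 * n * (St / ww) + 1 / ee) ^+ 2 ->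
  p * m1 + q * m2 = t -> inbox m1 m2 ->
  exists u1 u2,
    (forall x y, inbox x y -> p * x + q * y <= t -> shifted C u1 u2 x y) /\
    (forall x y, shifted C' u1 u2 x y -> p * x + q * y <= t + kap).
Proof.
move=> pq0 qp pqL mt bm.
set L := 2 + _ + _ in pqL.
have [r1 rD KD BR] := rho_facts; have D0 := b_D0 H; have d3 := b_D3 H; have K00 := b_K0 H.
have L0 : 0 <= L.
  have n2 := n_ge2 P; have s0 := St_gt0 P; have w0 := ww_gt0 P; have e0 := ee_gt0 P.
  have h1 : 0 <= 2 * n * (St / ww) by rewrite mulr_ge0 ?divr_ge0 ?(ltW s0) ?(ltW w0)//; lra.
  have h2 : 0 <= 1 / ee by rewrite divr_ge0// ltW.
  by rewrite /L; lra.
pose l := Num.sqrt (p ^+ 2 + q ^+ 2).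
have l2 : l ^+ 2 = p ^+ 2 + q ^+ 2 by rewrite sqr_sqrtr// ltW.
have l0 : 0 < l by rewrite sqrtr_gt0.
have lL : l <= L by rewrite -(@ler_pXn2r _ 2) ?nnegrE ?(ltW l0)// l2.
pose a := p / l; pose b := q / l.
have al : a * l = p by rewrite /a divfK// gt_eqF.
have bl : b * l = q by rewrite /b divfK// gt_eqF.
have ab1 : a ^+ 2 + b ^+ 2 = 1.
  have : (a ^+ 2 + b ^+ 2) * l ^+ 2 = 1 * l ^+ 2.
    by rewrite mul1r [RHS]l2 -al -bl; ring.
  by apply: mulIf; rewrite expf_neq0// gt_eqF.
have b2 : (2 * b) ^+ 2 <= 1.
  have h : (2 * b) ^+ 2 * l ^+ 2 <= 1 * l ^+ 2.
    by rewrite mul1r [leRHS]l2 (_ : _ * _ = 4 * q ^+ 2)// -bl; ring.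
  by move: h; rewrite ler_pM2r// exprn_gt0.
have [c1 [c2 [hd hs]]] := s_support HS ab1.
pose k0 := rho ^+ 2 / D.
have k0D : k0 * D = rho ^+ 2 by rewrite /k0 divfK// gt_eqF.
have k00 : 0 <= k0 by rewrite divr_ge0 ?sqr_ge0// ltW.
have k0r : k0 <= rho.
  rewrite ler_pdivrMr// expr2 ler_pM2l; lra_with rD r1.
have bb : - (1 / 2) <= b <= 1 / 2.
  have h := ler_wsqrtr b2; rewrite sqrtr_sqr sqrtr1 in h.
  by move: h; rewrite ler_norml => /andP[h1 h2]; apply/andP; split; lra_with h1 h2.
have aa : `|a| <= 1.
  rewrite -(@ler_pXn2r _ 2) ?nnegrE// real_normK ?num_real// expr1n.
  by have := sqr_ge0 b; lra.
have cD1 : c2 + D <= Yt.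
  by apply: (b_top H (x := c1)); apply: hd; rewrite /in_disc subrr expr0n add0r addrC addKr.
have cD2 : - Yt <= c2 - D.
  by apply: (s_bot HS (x := c1)); apply: hd; rewrite /in_disc subrr expr0n add0r addrC addKr sqrrN.
(* The contact point [c + D * (a, b)] goes to a point [k0] beyond the line, so that the disc alone
   covers the part of the half-plane in the box. *)
exists (m1 + k0 * a - (c1 + D * a)), (m2 + k0 * b - (c2 + D * b)).
move: bb => /andP[bb1 bb2].
have Db1 : D * b <= D * (1 / 2) by rewrite ler_pM2l.
have Db2 : D * - (1 / 2) <= D * b by rewrite ler_pM2l.
have kb1 : k0 * b <= k0 * (1 / 2) by rewrite ler_wpM2l.
have kb2 : k0 * - (1 / 2) <= k0 * b by rewrite ler_wpM2l.
split.
  move=> x y bx hxy.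
  have hab : a * (x - m1) + b * (y - m2) <= 0.
    have h : (a * (x - m1) + b * (y - m2)) * l <= 0 * l.
      rewrite mul0r (_ : _ * l = (a * l) * x + (b * l) * y - ((a * l) * m1 + (b * l) * m2)); last by ring.
      by rewrite al bl mt subr_le0.
    by move: h; rewrite ler_pM2r.
  have dist := inbox_dist P bm bx.
  have y12 : - rho <= y - m2 <= rho.
    have h : `|y - m2| ^+ 2 <= rho ^+ 2.
      by rewrite real_normK ?num_real//; apply: le_trans dist; rewrite lerDr sqr_ge0.
    rewrite ler_pXn2r ?nnegrE// in h; last by lra_with r1.
    by rewrite -ler_norml.
  move: y12 => /andP[y1 y2].
  have C1xy : C1 (x - (m1 + k0 * a - (c1 + D * a))) (y - (m2 + k0 * b - (c2 + D * b))).
    apply: hd; rewrite /in_disc.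
    have -> : (x - (m1 + k0 * a - (c1 + D * a)) - c1) ^+ 2 +
      (y - (m2 + k0 * b - (c2 + D * b)) - c2) ^+ 2 =
      ((x - m1) ^+ 2 + (y - m2) ^+ 2) + 2 * ((D - k0) * (a * (x - m1) + b * (y - m2))) +
      (a ^+ 2 + b ^+ 2) * (D - k0) ^+ 2 by ring.
    rewrite ab1 mul1r.
    have h1 : (D - k0) * (a * (x - m1) + b * (y - m2)) <= 0 by rewrite mulr_ge0_le0//; lra_with k0r rD r1.
    have h2 : k0 * k0 <= k0 * D by rewrite ler_wpM2l//; lra_with k0r rD r1.
    lra_with h2 h1 dist k0D.
  apply/(b_cap H); split => //; apply: cap_deep.
  - exact: (b_wide H C1xy).
  - lra_with y2 kb2 Db1 cD1 k0r d3 rD r1.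
  - by rewrite normrN; exact: (b_wide H C1xy).
  - lra_with y1 kb1 Db2 cD2 k0r d3 rD r1.
move=> x y /(b_hat H)[x' [y' [/(b_cap H)[hC1 _ _] hx hy]]].
have h1 := hs _ _ hC1.
set X := x - _ in hx; set Y := y - _ in hy.
have g1 : `|a * (x' - X)| <= 1 * khat by rewrite normrM; apply: ler_pM.
have g2 : `|b * (y' - Y)| <= 1 * khat.
  by rewrite normrM; apply: ler_pM => //; rewrite ler_norml; apply/andP; split; lra_with bb1 bb2.
move: g1 g2; rewrite !ler_norml => /andP[g1 g2] /andP[g3 g4].
have e : a * x + b * y = a * X + b * Y + (a * m1 + b * m2) + (k0 - D) * (a ^+ 2 + b ^+ 2) - (a * c1 + b * c2).
  rewrite /X /Y; ring.
have fin : (a * x + b * y) <= (a * m1 + b * m2) + (k0 + 2 * khat).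
  by rewrite e ab1; lra_with g3 g1 h1.
have fl := ler_wpM2r (ltW l0) fin.
have el : (a * x + b * y) * l = p * x + q * y by rewrite -al -bl; ring.
have em : (a * m1 + b * m2 + (k0 + 2 * khat)) * l = t + (k0 + 2 * khat) * l.
  by rewrite -mt -al -bl; ring.
rewrite el em in fl; apply: le_trans fl _; rewrite lerD2l.
apply: le_trans (s_kap HS); rewrite -/L -/k0 ler_wpM2l//.
by have h := pkhat0 P; lra_with g2 g1 k00.
Qed.

Lemma cap_translate h : inbox 0 h ->
  exists u1 u2,
   (forall x y, inbox x y -> y <= h -> y + B * x <= h + B / 2 -> y - B * x <= h + B / 2 ->
     shifted C u1 u2 x y) /\
   (forall x y, shifted C' u1 u2 x y ->
     [/\ y <= h + kap, y + B * x <= h + B / 2 + kap & y - B * x <= h + B / 2 + kap]).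
Proof.
move=> bh; have [r1 rD KD BR] := rho_facts; have D0 := b_D0 H; have K00 := b_K0 H.
have rK := s_K0 HS; have d3 := b_D3 H.
have YD : D <= Yt.
  have h1 : - Yt <= Yt - D - D.
    apply: (s_bot HS (x := x0)); apply: (s_topdisc HS).
    by rewrite /in_disc subrr expr0n add0r (_ : _ - _ = - D) ?sqrrN//; ring.
  lra.
exists (- x0), (h - (Yt - K0)); split.
  move=> x y bx y1 y2 y3.
  have dist := inbox_dist P bh bx; rewrite subr0 in dist.
  have y12 : - rho <= y - h <= rho.
    have hh : `|y - h| ^+ 2 <= rho ^+ 2.
      by rewrite real_normK ?num_real//; apply: le_trans dist; rewrite lerDr sqr_ge0.
    rewrite ler_pXn2r ?nnegrE// in hh; last by lra.
    by rewrite -ler_norml.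
  move: y12 => /andP[y4 y5].
  have C1xy : C1 (x - - x0) (y - (h - (Yt - K0))).
    apply: (s_topdisc HS); rewrite /in_disc.
    have -> : (x - - x0 - x0) ^+ 2 + (y - (h - (Yt - K0)) - (Yt - D)) ^+ 2 =
      (x ^+ 2 + (y - h) ^+ 2) + 2 * ((D - K0) * (y - h)) + (D - K0) ^+ 2 by ring.
    have h1 : (D - K0) * (y - h) <= 0 by rewrite mulr_ge0_le0//; lra.
    have h2 : K0 * K0 <= K0 * D by rewrite ler_wpM2l//; lra.
    lra.
  apply/(b_cap H); split => //.
    by split; lra_with y1 y2 y3.
  apply: cap_deep; first by rewrite normrN; exact: (b_wide H C1xy).
  lra.
move=> x y /(b_hat H)[x' [y' [/(b_cap H)[_ [h1 h2 h3] _] hx hy]]].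
have b0 := pB0 P; have b1 := pB1 P; have kh0 := pkhat0 P.
have kk : 2 * khat <= kap.
  apply: le_trans (s_kap HS).
  have k00 : 0 <= rho ^+ 2 / D by rewrite divr_ge0 ?sqr_ge0// ltW.
  set L := 2 + _ + _; have L1 : 1 <= L.
    have n2 := n_ge2 P; have s0 := St_gt0 P; have w0 := ww_gt0 P; have e0 := ee_gt0 P.
    have g1 : 0 <= 2 * n * (St / ww) by rewrite mulr_ge0 ?divr_ge0 ?(ltW s0) ?(ltW w0)//; lra_with n2 e0.
    have g2 : 0 <= 1 / ee by rewrite divr_ge0// ltW.
    by rewrite /L; lra.
  have g : (rho ^+ 2 / D + 2 * khat) * 1 <= (rho ^+ 2 / D + 2 * khat) * L by rewrite ler_wpM2l//; lra.
  lra.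
set X := x - _ in hx; set Y := y - _ in hy.
have g1 : `|B * (x' - X)| <= 1 * khat.
  by rewrite normrM; apply: ler_pM => //; rewrite gtr0_norm//; lra.
move: g1 hy; rewrite !ler_norml => /andP[g1 g2] /andP[g3 g4].
rewrite /X /Y in g1 g2 g3 g4.
by split; lra_with g3 kk kh0 h1 g1 h2 g2 h3.
Qed.

Lemma edge_mid j : edge j (mx N B j) = - (St * mid_depth R N j).
Proof.
by rewrite /edge /mx /mid_depth /descent; field; rewrite gt_eqF// (ww_gt0 P).
Qed.

Lemma edge_mid_inbox j : (j < N)%N -> inbox (mx N B j) (- (St * mid_depth R N j)).
Proof.
move=> jN; have [h1 /andP[h2 h3]] := mid_inbox P jN; have k0 := pkap0 P; have q0 := qq_ge P.
split => //; rewrite /my in h2 h3.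
have /andP[m1 m2] := mid_ge R (pN2 P) jN; have s0 := St_gt0 P.
have g1 : St * mid_depth R N j <= St * (2 * n ^+ 2) by rewrite ler_pM2l.
have g2 : 0 <= St * mid_depth R N j by rewrite mulr_ge0 ?(ltW s0)//; lra.
by rewrite /qq in q0 *; apply/andP; split; lra.
Qed.

Lemma edge_translate j : (j < N)%N -> exists u : R * R,
  (forall x y, inbox x y -> edge j x <= y -> shifted C u.1 u.2 x y) /\
  (forall x y, shifted C' u.1 u.2 x y -> edge j x - kap <= y).
Proof.
move=> jN; pose sl := St * descent R N j / ww.
have eE x : edge j x = - (St * depth R N j) + sl * xv j - sl * x by rewrite /edge /sl; ring.
have s0 := St_gt0 P; have w0 := ww_gt0 P; have wl := ww_le P; have el := ee_le P; have sg := St_ge P.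
have e0 := ee_gt0 P.
have SW : 64 <= St / ww by rewrite ler_pdivlMr//; lra.
have sb := slope_bound P jN.
have /andP[d1 _] := descent_abs R (pN2 P) jN.
have sl2 : 2 <= `|sl|.
  rewrite /sl !normrM normfV (gtr0_norm s0) (gtr0_norm w0).
  have -> : St * `|descent R N j| / ww = (St / ww) * `|descent R N j| by ring.
  have g : (St / ww) * 2^-1 <= (St / ww) * `|descent R N j| by rewrite ler_wpM2l//; lra.
  lra.
have slsq : 4 <= sl ^+ 2.
  rewrite -real_normK ?num_real//; have g : 2 * 2 <= `|sl| * `|sl| by apply: ler_pM.
  by rewrite expr2; lra.
have n0 : 0 <= 2 * n * (St / ww) by have n2 := n_ge2 P; rewrite mulr_ge0//; lra.
have ie0 : 0 <= 1 / ee by rewrite divr_ge0// ltW.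
have slb : sl ^+ 2 <= (2 * n * (St / ww)) ^+ 2.
  by rewrite -real_normK ?num_real// ler_pXn2r ?nnegrE.
have [|||||u1 [u2 [h1 h2]]] := @line_translate (- sl) (- 1) (St * depth R N j - sl * xv j)
    (mx N B j) (- (St * mid_depth R N j)).
- by rewrite !sqrrN expr1n; lra.
- by rewrite !sqrrN expr1n; lra.
- rewrite !sqrrN expr1n; set Z := 2 * n * _ in n0 slb *; set W := 1 / ee in ie0 *.
  have g1 : 0 <= Z * W by rewrite mulr_ge0.
  have g2 := sqr_ge0 W.
  lra.
- by rewrite -edge_mid eE; ring.
- exact: edge_mid_inbox.
- exists (u1, u2); split=> x y h /=.
    by move=> hy; apply: h1 => //; rewrite eE in hy; lra.
  by have := h2 _ _ h; rewrite eE => hh; lra.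
Qed.

Lemma side_translate (s : R) : s ^+ 2 = 1 -> exists u : R * R,
  (forall x y, inbox x y -> y <= (1 + ee + s * x) / ee -> shifted C u.1 u.2 x y) /\
  (forall x y, shifted C' u.1 u.2 x y -> y <= (1 + ee + s * x) / ee + kap).
Proof.
move=> s1; have e0 := ee_gt0 P; have el := ee_le P.
have s0 := St_gt0 P; have w0 := ww_gt0 P.
have n0 : 0 <= 2 * n * (St / ww).
  by have n2 := n_ge2 P; rewrite !mulr_ge0 ?invr_ge0 ?(ltW s0) ?(ltW w0)//; lra.
have W4 : 4 <= 1 / ee by rewrite ler_pdivlMr//; lra.
have eE x : (1 + ee + s * x) / ee = 1 / ee + 1 + s / ee * x by field; rewrite gt_eqF.
have p2 : (- (s / ee)) ^+ 2 = (1 / ee) ^+ 2 by rewrite sqrrN !exprMn s1 expr1n.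
have W16 : 4 * 4 <= (1 / ee) ^+ 2 by rewrite expr2; apply: ler_pM.
have [|||||u1 [u2 [h1 h2]]] := @line_translate (- (s / ee)) 1 (1 / ee + 1) (- s) 1.
- by rewrite p2 expr1n; lra.
- by rewrite p2 expr1n; lra.
- rewrite p2 expr1n; set Z := 2 * n * _ in n0 *; set W := 1 / ee in W4 W16 *.
  have g1 : 0 <= Z * W by rewrite mulr_ge0//; lra.
  have g2 := sqr_ge0 Z.
  lra.
- have -> : - (s / ee) * - s + 1 * 1 = s ^+ 2 / ee + 1 by ring.
  by rewrite s1.
- have q0 := qq_ge P; split; last by apply/andP; split; lra.
  rewrite normrN; have h : `|s| ^+ 2 <= 1 ^+ 2 by rewrite real_normK ?num_real// s1 expr1n.
  by rewrite ler_pXn2r ?nnegrE// in h; lra.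
- exists (u1, u2); split=> x y h /=.
    by move=> hy; apply: h1 => //; rewrite eE in hy; lra.
  by have := h2 _ _ h; rewrite eE => hh; lra.
Qed.

(* The lowered roof passes through the points (-(1 + ee), -3 kap) and
   (1 + ee, -3 kap). *)
Definition low_level : R := B * (1 / 2 + ee) - 3 * kap.

Theorem translates_exist : exists (ue : nat -> R * R) (ul ur ut uw : R * R),
  let edges x y := forall j, (j < N)%N -> shifted C' (ue j).1 (ue j).2 x y in
  let K x y := [/\ edges x y, shifted C' ul.1 ul.2 x y, shifted C' ur.1 ur.2 x y &
                   shifted C' ut.1 ut.2 x y] in
  let L x y := edges x y /\ shifted C' uw.1 uw.2 x y in
  [/\ forall x y, inbox x y -> (forall j, (j < N)%N -> edge j x <= y) -> y <= roof x -> K x y,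
      forall x y, K x y -> [/\ inbox x y, `|x| <= 1 + ee + kap, y <= roof x + kap &
        forall j, (j < N)%N -> edge j x - kap <= y],
      forall x y, L x y -> K x y &
      forall x y, K x y -> ~ L x y ->
        low_level < y \/ B * (1 + ee - `|x|) - 3 * kap < y].
Proof.
pose PE j (u : R * R) := (j < N)%N ->
   (forall x y, inbox x y -> edge j x <= y -> shifted C u.1 u.2 x y) /\
   (forall x y, shifted C' u.1 u.2 x y -> edge j x - kap <= y).
have [ue hue] : {ue : nat -> R * R & forall j, PE j (ue j)}.
  apply: choice => j; case: (ltnP j N) => jN.
    by have [u hu] := edge_translate jN; exists u.
  by exists (0, 0) => /=; rewrite /PE ltnNge jN.
have [ul [hl1 hl2]] := side_translate (expr1n R 2).
have sN1 : (- 1) ^+ 2 = 1 :> R by rewrite sqrrN expr1n.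
have [ur [hr1 hr2]] := side_translate sN1.
have k0 := pkap0 P; have ks := kap_small P; have b0 := pB0 P; have b1 := pB1 P.
have q0 := qq_ge P; have e0 := ee_gt0 P; have el := ee_le P.
have Be : B * ee <= 64^-1 * B by rewrite mulrC ler_pM2r//; lra.
have Be0 : 0 <= B * ee by rewrite mulr_ge0 ?ltW.
have bt : inbox 0 (1 + B / 2) by split; [rewrite normr0 | apply/andP; split; lra].
have bw : inbox 0 low_level.
  by split; [rewrite normr0 | rewrite /low_level; apply/andP; split; lra].
have [t1 [t2 [ht1 ht2]]] := cap_translate bt.
have [w1 [w2 [hw1 hw2]]] := cap_translate bw.
exists ue, ul, ur, (t1, t2), (w1, w2) => edges K L.
have s0 := St_gt0 P; have w0 := ww_gt0 P; have n2 := n_ge2 P.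
have N0 : (0 < N)%N := ltnW (pN2 P).
have NE : N.-1.+1 = N by rewrite prednK.
have dl0 := descent0 R (pN2 P); have dlN := descent_lastN R (pN2 P).
pose s := St * descent R N 0 / ww; pose s' := - (St * descent R N N.-1 / ww).
have s_gt0 : 0 < s by rewrite /s divr_gt0// mulr_gt0//; lra.
have s'_gt0 : 0 < s'.
  by rewrite /s' oppr_gt0 pmulr_llt0 ?invr_gt0// pmulr_rlt0//; lra_with dlN.
have xv0E : xv 0 = - (1 + ee) by rewrite /xv mul0r addr0.
have e0E x : edge 0 x = - (s * (x + (1 + ee))).
  by rewrite /edge depth0 ?(pN2 P)// xv0E /s; ring.
have wn' := ww_mul P.
have eNE x : edge N.-1 x = - (s' * ((1 + ee) - x)).
  have xvE : xv N.-1 = (1 + ee) - ww.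
    have : n = N.-1%:R + 1 by rewrite natr1 NE.
    move=> nE; rewrite /xv; rewrite nE in wn'; lra_with wn'.
  have dE : depth R N N.-1 = - descent R N N.-1 by rewrite /descent NE depthN ?(pN2 P)// sub0r opprK.
  rewrite /edge xvE dE /s'; field; by rewrite gt_eqF.
have sb : s * (1 + ee) <= qq N St /\ s' * (1 + ee) <= qq N St.
  have /andP[_ h1] := descent_abs R (pN2 P) N0.
  have NN : (N.-1 < N)%N by rewrite NE.
  have /andP[_ h2] := descent_abs R (pN2 P) NN.
  have aux (t d : R) : 0 <= d -> d <= 2 * n -> t = St * d / ww -> t * (1 + ee) <= qq N St.
    move=> d0 dn ->; have -> : St * d / ww * (1 + ee) = St * d * (n / 2) * ((ww * n / ww) / n).
      rewrite wn'; field; rewrite !gt_eqF//; lra_with n2.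
    have -> : (ww * n / ww) / n = 1 by field; rewrite !gt_eqF//; lra_with n2.
    rewrite mulr1 /qq; have g : (St * n / 2) * d <= (St * n / 2) * (2 * n).
      by rewrite ler_wpM2l// divr_ge0// mulr_ge0 ?(ltW s0)//; lra.
    lra_with g.
  split.
    by apply: (aux _ (descent R N 0)) => //; [lra_with dl0 | move: h1; rewrite ger0_norm//; lra_with dl0].
  apply: (aux _ (- descent R N N.-1)) => //; [lra_with dlN | by move: h2; rewrite ler0_norm//; lra_with dlN|].
  by rewrite /s'; ring.
have [sb1 sb2] := sb.
have edges_lb x y : edges x y -> - (s * (x + (1 + ee))) - kap <= y /\ - (s' * ((1 + ee) - x)) - kap <= y.
  move=> he; have h1 := (hue _ N0).2 _ _ (he _ N0).
  have NN : (N.-1 < N)%N by rewrite NE.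
  have h2 := (hue _ NN).2 _ _ (he _ NN).
  by rewrite e0E in h1; rewrite eNE in h2.
have inb x y : `|x| <= 1 + ee + kap -> - (s * (x + (1 + ee))) - kap <= y -> y <= 2 -> inbox x y.
  rewrite ler_norml => /andP[x1 x2] hy y2; split; first by rewrite ler_norml; apply/andP; split; lra_with x1 el ks x2.
  have g : s * (x + (1 + ee)) <= s * (2 * (1 + ee) + kap) by rewrite ler_pM2l//; lra_with x2.
  have g2 : s * (2 * kap) <= s * (1 + ee) by rewrite ler_pM2l//; lra_with e0 ks.
  by apply/andP; split; lra_with g2 g hy sb q0 ks y2.
have Kb x y : K x y -> [/\ inbox x y, `|x| <= 1 + ee + kap, y <= roof x + kap &
        forall j, (j < N)%N -> edge j x - kap <= y].
  move=> [he hl hr ht].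
  have [y1 y2] := edges_lb _ _ he.
  have yl := hl2 _ _ hl; have yr := hr2 _ _ hr; have [yt1 yt2 yt3] := ht2 _ _ ht.
  rewrite mul1r in yl; rewrite mulN1r in yr.
  have xb : `|x| <= 1 + ee + kap.
    have ie : 4 <= ee^-1 by rewrite -div1r ler_pdivlMr//; lra_with el.
    rewrite ler_norml; apply/andP; split.
      have g : - (2 * kap) <= (s + ee^-1) * (x + (1 + ee)) by lra_with yl y1.
      rewrite leNgt; apply/negP => hx.
      have g2 : (s + ee^-1) * (x + (1 + ee)) <= (s + ee^-1) * (- kap) by rewrite ler_wpM2l//; lra_with ie s_gt0 hx.
      have g3 : 4 * kap <= (s + ee^-1) * kap by rewrite ler_wpM2r//; lra_with k0 ie s_gt0.
      lra_with g3 g2 yl y1 k0.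
    have g : - (2 * kap) <= (s' + ee^-1) * ((1 + ee) - x) by lra_with yr y2.
    rewrite leNgt; apply/negP => hx.
    have g2 : (s' + ee^-1) * ((1 + ee) - x) <= (s' + ee^-1) * (- kap) by rewrite ler_wpM2l//; lra_with ie s'_gt0 hx.
    have g3 : 4 * kap <= (s' + ee^-1) * kap by rewrite ler_wpM2r//; lra_with k0 ie s'_gt0.
    lra_with g3 g2 yr y2 k0.
  split => //.
  - apply: inb => //; lra_with yt1 b1 ks.
  - rewrite -lerBlDr roof_geP; apply/and5P; split; lra_with yt1 yt2 yt3 yr yl.
  - by move=> j jN; exact: (hue _ jN).2 _ _ (he _ jN).
split => //.
- move=> x y bx he hr; move: hr; rewrite roof_geP => /and5P[r1 r2 r3 r4 r5].
  split.
  + by move=> j jN; apply: (b_sub H); apply: (hue _ jN).1 => //; exact: he.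
  + by apply: (b_sub H); apply: hl1 => //; rewrite mul1r.
  + by apply: (b_sub H); apply: hr1 => //; rewrite mulN1r.
  + by apply: (b_sub H); apply: ht1 => //; lra_with r2 r3.
- move=> x y [he hw]; have [yw1 yw2 yw3] := hw2 _ _ hw.
  have [y1 y2] := edges_lb _ _ he; rewrite /low_level in yw1 yw2 yw3.
  (* Left of the foot the lowered roof would be below [- 3 * kap + kap], error included, but the
     first edge above [- kap]. The [3 * kap] in [low_level] is chosen for this. *)
  have X0 : 0 <= x + (1 + ee).
    rewrite leNgt; apply/negP => hx.
    have g : (s + B) * (x + (1 + ee)) <= 0 by rewrite mulr_ge0_le0//; lra_with s_gt0 b0 hx.
    lra_with g yw3 y1 k0.
  have X1 : 0 <= (1 + ee) - x.
    rewrite leNgt; apply/negP => hx.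
    have g : (s' + B) * ((1 + ee) - x) <= 0 by rewrite mulr_ge0_le0//; lra_with s'_gt0 b0 hx.
    lra_with g yw2 y2 k0.
  have Bie : B <= ee^-1 by rewrite -div1r ler_pdivlMr//; lra_with Be b1.
  have m1 : B * (x + (1 + ee)) <= ee^-1 * (x + (1 + ee)) by rewrite ler_wpM2r.
  have m2 : B * ((1 + ee) - x) <= ee^-1 * ((1 + ee) - x) by rewrite ler_wpM2r.
  have bx : inbox x y.
    by apply: inb => //; [rewrite ler_norml; apply/andP; split; lra_with X0 k0 X1 yw1 Be b1 | lra_with X0 k0 X1 yw1 Be b1].
  split => //.
  + by apply: (b_sub H); apply: hl1 => //; rewrite mul1r; lra_with m1 yw3 k0.
  + by apply: (b_sub H); apply: hr1 => //; rewrite mulN1r; lra_with m2 yw2 k0.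
  + by apply: (b_sub H); apply: ht1 => //; lra_with yw1 Be b1 k0 yw2 yw3.
- move=> x y hK hL; have [bx _ _ _] := Kb _ _ hK.
  have [he _ _ _] := hK.
  have : ~ shifted C w1 w2 x y by move=> hC; apply: hL; split => //; exact: (b_sub H hC).
  have [h1|h1] := ltP low_level y; first by left.
  have [h2|h2] := ltP (B * (1 + ee - `|x|) - 3 * kap) y; first by right.
  have Bx1 : B * x <= B * `|x| by rewrite ler_pM2l// ler_norm.
  have Bx2 : - (B * x) <= B * `|x| by rewrite -mulrN ler_pM2l// -normrN ler_norm.
  by case; apply: hw1 => //; rewrite /low_level; lra_with Bx1 h2 Bx2.
Qed.

End Translates.

(** * Covering by trapezoids *)

(** Areas are compared by covering with trapezoids that have two vertical, possibly degenerate,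
    sides; what remains is case analysis and polynomial arithmetic. *)
Record trapezoid (R : Type) := Trapezoid {
  t_left : R; t_right : R; t_low : R; t_low_slope : R; t_high : R; t_high_slope : R }.

Section Cover.
Variable R : rcfType.
Implicit Type t : trapezoid R.

Definition t_in t (x y : R) := t_left t <= x <= t_right t /\
  t_low t + t_low_slope t * x <= y <= t_high t + t_high_slope t * x.

Definition t_height t x := t_high t + t_high_slope t * x - (t_low t + t_low_slope t * x).

Definition t_ok t := [/\ t_left t <= t_right t, 0 <= t_height t (t_left t) &
  0 <= t_height t (t_right t)].

Definition t_area t :=
  (t_right t - t_left t) * (t_height t (t_left t) + t_height t (t_right t)) / 2.

Definition t_box (p q r s : R) := Trapezoid p q r 0 s 0.

Definition ts_in s (x y : R) := foldr (fun t P => t_in t x y \/ P) False s.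
Definition ts_ok s := foldr (fun t P => t_ok t /\ P) True s.
Definition ts_area s := foldr (fun t (r : R) => t_area t + r) 0 s.

Lemma t_box_ok p q r s : p <= q -> r <= s -> t_ok (t_box p q r s).
Proof. by move=> pq rs; split=> //; rewrite /t_height /= !mul0r; lra. Qed.

Lemma t_box_area p q r s : t_area (t_box p q r s) = (q - p) * (s - r).
Proof. by rewrite /t_area /t_height /=; field. Qed.

Lemma t_box_in p q r s x y : p <= x <= q -> r <= y <= s -> t_in (t_box p q r s) x y.
Proof. by move=> h1 h2; split => //=; rewrite !mul0r !addr0. Qed.

End Cover.

(** * Area between the roof and the lowered roof *)

Section Loss.
Variables (R : rcfType) (N : nat) (B St k1 kap khat E : R).
Local Notation n := (N%:R : R).
Local Notation ee := (flare B).
Local Notation tau := (inset B).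
Local Notation om := (om B).
Local Notation xv := (xv N B).
Local Notation edge := (edge N B St).
Local Notation ww := (ww N B).
Local Notation mx := (mx N B).
Local Notation my := (my N St kap).
Local Notation Xy := (Xy B kap).
Local Notation roof := (roof B).
Local Notation inbox := (inbox N St).
Local Notation low_level := (low_level B kap).

Hypothesis P : params_ok N B St k1 kap khat E.

Local Tactic Notation "lra_with" ne_hyp_list(hs) :=
  clear - hs R N B St k1 kap khat E P; lra.

Lemma kap_B : 4 ^+ 3 * kap <= B * ee.
Proof.
have h := pkapE P; have k1s := k1_small P; have k0 := pkap0 P.
have g : k1 * B ^+ 2 <= 1 * B ^+ 2 by rewrite ler_wpM2r ?sqr_ge0//; lra.
have -> : B * ee = B ^+ 2 / 4 by rewrite /flare; ring.
lra.
Qed.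

Lemma khat_B : 4 ^+ 3 * khat <= B * ee.
Proof.
have h := pkhatE P; have k1s := k1_small P; have k0 := pkhat0 P.
have g : k1 * B ^+ 2 <= 1 * B ^+ 2 by rewrite ler_wpM2r ?sqr_ge0//; lra.
have -> : B * ee = B ^+ 2 / 4 by rewrite /flare; ring.
lra.
Qed.

(** Vertical strips between the two roofs, cut at the corners of [roof]; the last two boxes cover
    the slivers beyond the feet. *)
Definition shell : seq (trapezoid R) :=
  [:: t_box (- (1 / 2)) (1 / 2) low_level (1 + B / 2 + kap);
      Trapezoid (1 / 2) 1 (B * (1 + ee) - 3 * kap) (- B) (1 + B + kap) (- B);
      Trapezoid (- 1) (- (1 / 2)) (B * (1 + ee) - 3 * kap) B (1 + B + kap) B;
      Trapezoid 1 (1 + ee) (B * (1 + ee) - 3 * kap) (- B) ((1 + ee) / ee + kap) (- (1 / ee));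
      Trapezoid (- (1 + ee)) (- 1) (B * (1 + ee) - 3 * kap) B ((1 + ee) / ee + kap) (1 / ee);
      t_box (1 + ee) (1 + ee + kap) (- (4 * kap)) kap;
      t_box (- (1 + ee + kap)) (- (1 + ee)) (- (4 * kap)) kap].

Lemma shell_ok : ts_ok shell.
Proof.
have e0 := ee_gt0 P; have el := ee_le P; have b0 := pB0 P; have b1 := pB1 P.
have k0 := pkap0 P; have ks := kap_small P.
have Be : B * ee <= 64^-1 * ee by rewrite ler_pM2r//; lra.
have Be0 : 0 <= B * ee by rewrite mulr_ge0 ?ltW.
split; first by apply: t_box_ok; [lra | rewrite /low_level; lra].
have a1 : (1 + ee) / ee = 1 / ee + 1 by field; rewrite gt_eqF.
have a2 : 1 / ee * ee = 1 by field; rewrite gt_eqF.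
do 4 (split; first by split; rewrite /t_height /=; lra_with Be k0 el e0 a1).
split; first by apply: t_box_ok; lra.
by split => //; apply: t_box_ok; lra.
Qed.

(** The lowered roof has the same bevel, so the terms [3 * B / 4] cancel. By [kap_B] the term
    [- 2 * (B * ee)] pays for all errors in [kap]. *)
Lemma shell_area : ts_area shell <= 2 + B / 4.
Proof.
have e0 := ee_gt0 P; have el := ee_le P; have b0 := pB0 P; have b1 := pB1 P.
have k0 := pkap0 P; have ks := kap_small P; have kb := kap_B.
have ke : kap * ee <= kap * 1 by rewrite ler_wpM2l ?(ltW k0)//; lra.
have kk : kap * kap <= kap * 1 by rewrite ler_wpM2l ?(ltW k0)//; lra.
have Bee : 0 <= B * ee ^+ 2 by rewrite mulr_ge0 ?sqr_ge0// ltW.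
have -> : ts_area shell = 2 + ee - 2 * (B * ee) - B * ee ^+ 2 + 8 * kap + 8 * (kap * ee) + 10 * (kap * kap).
  rewrite /ts_area /= !t_box_area /t_area /t_height /= /low_level; field; by rewrite gt_eqF.
have eE : ee = B / 4 by [].
lra.
Qed.

Lemma shell_cover x y : `|x| <= 1 + ee + kap -> y <= roof x + kap ->
  low_level < y \/ B * (1 + ee - `|x|) - 3 * kap < y -> ts_in shell x y.
Proof.
have e0 := ee_gt0 P; have el := ee_le P; have b0 := pB0 P; have b1 := pB1 P.
have k0 := pkap0 P; have ks := kap_small P.
move=> hx; rewrite -lerBlDr roof_geP => /and5P[r1 r2 r3 r4 r5] hy.
have Bk : B * kap <= 1 * kap by rewrite ler_pM2r//; lra.
have ieE z : (1 + ee + z) / ee = (1 + ee) / ee + 1 / ee * z by field; rewrite gt_eqF.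
have r4' : (1 + ee + - x) / ee = (1 + ee - x) / ee by [].
rewrite -r4' !ieE in r4 r5.
have zl z : 1 + ee <= z -> (1 + ee) / ee + 1 / ee * - z <= 0.
  move=> hz; rewrite -ieE pmulr_lle0 ?invr_gt0//; lra.
have [xp|xn] := leP 0 x.
  rewrite (ger0_norm xp) in hx hy.
  have hB z : z <= x -> B * z <= B * x by rewrite ler_pM2l.
  have hB' z : x <= z -> B * x <= B * z by rewrite ler_pM2l.
  have [h1|h1] := leP x (1 / 2).
    left; apply: t_box_in; apply/andP; split; try lra.
    by have := hB' _ h1; case: hy; rewrite /low_level; lra_with R.
  have hy' : B * (1 + ee - x) - 3 * kap < y.
    by have := hB _ (ltW h1); case: hy; rewrite /low_level; lra_with R.
  have [h2|h2] := leP x 1.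
    by right; left; split => /=; apply/andP; split; lra_with h1 h2 hy' r2.
  have [h3|h3] := leP x (1 + ee).
    by do 3 right; left; split => /=; apply/andP; split; lra_with h2 h3 hy' r4.
  do 5 right; left; apply: t_box_in; apply/andP; split; try lra.
    by have := hB' _ hx; lra.
  by have := zl _ (ltW h3); lra.
rewrite (ltr0_norm xn) in hx hy.
have hB z : z <= - x -> B * z <= B * - x by rewrite ler_pM2l.
have hB' z : - x <= z -> B * - x <= B * z by rewrite ler_pM2l.
have [h1|h1] := leP (- x) (1 / 2).
  left; apply: t_box_in; apply/andP; split; try lra.
  by have := hB' _ h1; case: hy; rewrite /low_level; lra_with R.
have hy' : B * (1 + ee - - x) - 3 * kap < y.
  by have := hB _ (ltW h1); case: hy; rewrite /low_level; lra_with R.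
have [h2|h2] := leP (- x) 1.
  by do 2 right; left; split => /=; apply/andP; split; lra_with h2 h1 hy' r3.
have [h3|h3] := leP (- x) (1 + ee).
  by do 4 right; left; split => /=; apply/andP; split; lra_with h3 h2 hy' r5.
do 6 right; left; apply: t_box_in; apply/andP; split; try lra.
  by have := hB' _ hx; lra.
by have := zl _ (ltW h3); rewrite opprK; lra.
Qed.

Variables (D Yt K0 Rr x0 : R) (C1 C C' : R -> R -> Prop).
Hypothesis H : body_ok N B St k1 khat E D Yt K0 Rr x0 C1 C C'.
Variable K : R -> R -> Prop.
Hypothesis K_in : forall x y, inbox x y -> (forall j, (j < N)%N -> edge j x <= y) ->
  y <= roof x -> K x y.
Hypothesis K_roof : forall x y, K x y -> y <= roof x + kap.
Hypothesis K_edge : forall x y, K x y -> forall j, (j < N)%N -> edge j x - kap <= y.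

Local Tactic Notation "lra_with" ne_hyp_list(hs) :=
  clear - hs R N B St k1 kap khat E P D Yt K0 Rr x0 C1 C C' H K K_in K_roof K_edge; lra.

Lemma edge_le0 j x : (j < N)%N -> `|x| <= 1 + ee -> edge j x <= 0.
Proof.
move=> jN; rewrite ler_norml => /andP[x1 x2]; have w0 := ww_gt0 P; have wn' := ww_mul P.
have h0 := edge_vertex P jN (leq0n N); have h1 := edge_vertex P jN (leqnn N).
rewrite depth0 ?(pN2 P)// mulr0 oppr0 in h0; rewrite depthN ?(pN2 P)// mulr0 oppr0 in h1.
have x0E : xv 0 = - (1 + ee) by rewrite /xv mul0r addr0.
have xNE : xv N = 1 + ee by rewrite /xv; lra.
rewrite x0E in h0; rewrite xNE in h1.
rewrite (edge_lin N B St j (- (1 + ee)) (1 + ee)) in h1; rewrite (edge_lin N B St j (- (1 + ee)) x).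
set sl := St * _ / _ in h1 *; set c := edge j _ in h0 h1 *.
have e0 := ee_gt0 P.
have [s0|s0] := leP 0 sl.
  have g : sl * 0 <= sl * (x - - (1 + ee)) by rewrite ler_wpM2l//; lra.
  lra.
have g : - sl * (x - - (1 + ee)) <= - sl * (1 + ee - - (1 + ee)) by rewrite ler_wpM2l//; lra.
lra.
Qed.

Lemma K_upper x y : `|x| <= 1 + ee -> 0 <= y <= 1 + B / 2 -> y <= roof x -> K x y.
Proof.
move=> hx /andP[y0 y1] hy; have q1 := qq_ge P; have el := ee_le P; have b1 := pB1 P.
apply: K_in => //; first by split; [lra | apply/andP; split; lra].
by move=> j jN; apply: le_trans y0; exact: edge_le0.
Qed.

Lemma K_vbox k x y : (k <= N)%N -> vbox N B St k1 k x y -> K x y.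
Proof.
move=> kN hb; have kh0 := pkhat0 P.
have nv : near_vertex N B St k1 k x y.
  by apply: (vbox_near P kN hb); rewrite subrr normr0.
have [hx _ he hu] := nv; apply: K_in => //; first exact: (near_inbox P kN nv).
have /andP[v1 v2] := xv_bound P kN; have sk := Sk1_ge P; have e0 := ee_gt0 P; have el := ee_le P.
have b0 := pB0 P; have b1 := pB1 P.
have ke : 4 * k1 <= ee.
  have h := pk1n P; have n2 := n_ge2 P; have k0 := pk10 P; have t1 := tau_le P; have t0 := tau_gt0 P.
  have h1 : 1 * k1 <= n ^+ 3 * k1 by rewrite ler_wpM2r ?(ltW k0)// -(expr1n _ 3) ler_pXn2r ?nnegrE//; lra.
  have h2 := tauee_le P; lra.
move: hx; rewrite ler_norml => /andP[x1 x2].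
have ieE z : (1 + ee + z) / ee = 1 / ee * (1 + ee + z) by ring.
have ie z : - ee <= 1 + ee + z -> - 1 <= (1 + ee + z) / ee.
  by move=> hz; rewrite ler_pdivlMr//; lra.
have i1 : - 1 <= (1 + ee + x) / ee by apply: ie; lra.
have i2 : - 1 <= (1 + ee + - x) / ee by apply: ie; lra.
have Bx1 : B * x <= B * 2 by rewrite ler_pM2l//; lra.
have Bx2 : B * - x <= B * 2 by rewrite ler_pM2l//; lra.
by rewrite roof_geP; apply/and5P; split; lra_with b0 sk hu Bx1 b1 Bx2 i2 i1.
Qed.

(* The part of the bounding box above the roof. *)
Definition excess : seq (trapezoid R) :=
  [:: Trapezoid (1 / 2) 1 (1 + B) (- B) (1 + B / 2) 0;
      Trapezoid (- 1) (- (1 / 2)) (1 + B) B (1 + B / 2) 0;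
      Trapezoid 1 om ((1 + ee) / ee) (- (1 / ee)) (1 + B / 2) 0;
      Trapezoid (- om) (- 1) ((1 + ee) / ee) (1 / ee) (1 + B / 2) 0].

Lemma excess_ok : ts_ok excess.
Proof.
have e0 := ee_gt0 P; have el := ee_le P; have b0 := pB0 P; have b1 := pB1 P.
have [o1 o2] := om_bounds P; have tl := tau_le P; have t0 := tau_gt0 P.
have a1 : (1 + ee) / ee = 1 / ee + 1 by field; rewrite gt_eqF.
have a2 : 1 / ee * om = 1 / ee + 1 - tau by rewrite /om; field; rewrite gt_eqF.
by do 4 (split; first by split; rewrite /t_height /=; lra_with b0 o1 a1 a2 tl).
Qed.

Lemma excess_area : ts_area excess = B / 4 + ee * (1 - tau) * (1 + B - tau).
Proof.
have e0 := ee_gt0 P.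
rewrite /ts_area /= /t_area /t_height /= /om; field; by rewrite gt_eqF.
Qed.

Lemma excess_cover x y : `|x| <= om -> y <= 1 + B / 2 -> y <= roof x \/ ts_in excess x y.
Proof.
move=> hx hy; have [h|h] := boolP (y <= roof x); [by left | right].
move: h; rewrite roof_geP hy /=.
have e0 := ee_gt0 P; have el := ee_le P; have b0 := pB0 P; have b1 := pB1 P.
have ieE z : (1 + ee + z) / ee = (1 + ee) / ee + 1 / ee * z by field; rewrite gt_eqF.
have a1 : (1 + ee) / ee = 1 / ee + 1 by field; rewrite gt_eqF.
have Be : B * ee <= 1 * 1 by apply: ler_pM; lra.
have Bi : B <= 1 / ee by rewrite ler_pdivlMr// -[1]mulr1.
have r4' : (1 + ee + - x) / ee = (1 + ee - x) / ee by [].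
rewrite -r4' !ieE => hn.
have gB z : 0 <= z -> [/\ B * z <= 1 / ee * z, 0 <= B * z & 0 <= 1 / ee * z].
  by move=> hz; split; [rewrite ler_wpM2r | rewrite mulr_ge0// ltW | rewrite mulr_ge0// divr_ge0// ltW].
have gI z : 1 / 2 <= z -> 1 / ee * (1 / 2) <= 1 / ee * z.
  by move=> hz; rewrite ler_wpM2l// divr_ge0// ltW.
have gJ z : 1 / 2 <= z -> B * (1 / 2) <= B * z.
  by move=> hz; rewrite ler_wpM2l// ltW.
move: hx; rewrite ler_norml => /andP[x1 x2].
have [h1|h1] := ltP 1 x.
  have x10 : 0 <= x - 1 by lra.
  have x11 : 0 <= x by lra.
  have [g1 g2 g3] := gB _ x10; have [g4 g5 g6] := gB _ x11.
  do 2 right; left; split => /=; apply/andP; split; lra_with h1 x2 g2 g1 hn Bi a1 b0 hy.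
have [h2|h2] := ltP x (- 1).
  have x10 : 0 <= - x - 1 by lra.
  have x11 : 0 <= - x by lra.
  have [g1 g2 g3] := gB _ x10; have [g4 g5 g6] := gB _ x11.
  do 3 right; left; split => /=; apply/andP; split; lra_with x1 h2 g2 g1 hn Bi a1 b0 hy.
have x1p : 0 <= 1 + x by lra.
have x1m : 0 <= 1 - x by lra.
have [g1 g2 g3] := gB _ x1p; have [g4 g5 g6] := gB _ x1m.
have [h3|h3] := ltP (1 / 2) x.
  have [g7 g8] := (gI _ (ltW h3), gJ _ (ltW h3)).
  left; split => /=; apply/andP; split; lra_with h3 h1 g8 g4 g1 hn a1 b0 hy.
have [h4|h4] := ltP x (- (1 / 2)).
  have h4' : 1 / 2 <= - x by lra.
  have [g7 g8] := (gI _ h4', gJ _ h4').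
  right; left; split => /=; apply/andP; split; lra_with h2 h4 g8 g4 g1 hn a1 b0 hy.
exfalso; move/negP: hn; apply.
have x2p : 1 / 2 <= 1 + x by lra.
have x2m : 1 / 2 <= 1 - x by lra.
have g7 := gI _ x2p; have g8 := gJ _ x2p; have g9 := gI _ x2m; have g10 := gJ _ x2m.
by apply/and4P; split; lra_with g10 hy g8 g9 Bi a1 g7.
Qed.

(** * Area lost by an inscribed polygon *)

Variable v : 'I_N.+2 -> R * R.
Local Notation Q := (all_shifts C' v).
Hypothesis Q_sub : forall x y, Q x y -> K x y.

Local Tactic Notation "lra_with" ne_hyp_list(hs) :=
  clear - hs R N B St k1 kap khat E P D Yt K0 Rr x0 C1 C C' H K K_in K_roof K_edge v Q_sub; lra.

Lemma Q_mid j : (j < N)%N -> ~ Q (mx j) (my j).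
Proof.
move=> jN /Q_sub /K_edge /(_ j jN); rewrite (edge_mid P) /my.
by have k0 := pkap0 P; lra.
Qed.

Lemma Q_roof xi : ~ Q xi (Xy xi).
Proof. by move=> /Q_sub /K_roof; rewrite /Xy; have k0 := pkap0 P; lra. Qed.

(** The sum of the vertical sides of the trapezoid under a chord: [tau + 2 * kap] at the end and at
    most [1 + B / 2 + 2 * kap] at the other side, each raised by the slack [B / 256]. *)
Definition chord_bound := 1 + B / 2 + tau + 4 * kap + B / 128.

(** If [xi] is within [ee / 2] of the left end, the chord says nothing, but the steep side keeps the
    roof below [1 / 2 + tau] there. *)
Lemma chord_trap_left xi : `|xi| <= om ->
  (forall x y, ee / 2 <= xi + om -> Q x y -> - om + khat <= x <= xi - khat -> y <= 3 / 2 ->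
    (xi + om) * (y - Xy (- om)) - (Xy xi - Xy (- om)) * (x + om) < (xi + om) * (B / 256)) ->
  exists t, [/\ t_ok t, t_area t <= (xi + om) * chord_bound / 2 &
    forall x y, Q x y -> - om + khat <= x <= xi - khat -> 0 <= y -> y <= 1 + B / 2 ->
      y <= roof x -> t_in t x y].
Proof.
move=> hxi hc; have [_ X1] := Xy_om P; have kh0 := pkhat0 P; have k0 := pkap0 P.
have e0 := ee_gt0 P; have el := ee_le P; have b0 := pB0 P; have b1 := pB1 P.
have [o1 o2] := om_bounds P; have tl := tau_le P; have t0 := tau_gt0 P.
have rx := roof_ge P hxi; have rx2 := roof_le B xi.
move: hxi; rewrite ler_norml => /andP[x1 x2].
have [h|h] := leP (ee / 2) (xi + om).
  pose sl := (Xy xi - Xy (- om)) / (xi + om).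
  have slE : sl * (xi + om) = Xy xi - Xy (- om) by rewrite /sl divfK// gt_eqF//; lra.
  have hl : t_height (Trapezoid (- om) xi 0 0 (Xy (- om) + sl * om + B / 256) sl) (- om) =
      tau + 2 * kap + B / 256 by rewrite /t_height /= X1; ring.
  have hr : t_height (Trapezoid (- om) xi 0 0 (Xy (- om) + sl * om + B / 256) sl) xi =
      Xy xi + B / 256 by rewrite /t_height /= -[Xy xi](subrK (Xy (- om))) -slE; ring.
  exists (Trapezoid (- om) xi 0 0 (Xy (- om) + sl * om + B / 256) sl); split.
  - by split; rewrite /= ?hl ?hr /Xy; lra_with x1 t0 b0 k0 rx.
  - rewrite /t_area hl hr [t_left _]/= [t_right _]/= opprK ler_pM2r ?invr_gt0// ler_wpM2l//; first by lra_with x1.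
    by rewrite /chord_bound /Xy; lra_with rx2.
  - move=> x y hQ hx y0 y1 hr'.
    have y2 : y <= 3 / 2 by lra_with y1 b1.
    have hh := hc _ _ h hQ hx y2; move: hx => /andP[hx1 hx2].
    split => /=; first by apply/andP; split; lra_with hx1 kh0 hx2.
    rewrite !mul0r addr0 y0 /=.
    have p0 : 0 < xi + om by lra_with h e0.
    have : (xi + om) * y <= (xi + om) * (Xy (- om) + sl * om + B / 256 + sl * x).
      have -> : (xi + om) * (Xy (- om) + sl * om + B / 256 + sl * x) =
         (xi + om) * Xy (- om) + (sl * (xi + om)) * (x + om) + (xi + om) * (B / 256) by ring.
      by rewrite slE; lra_with hh.
    by rewrite ler_pM2l.
exists (t_box (- om) xi 0 (1 / 2 + tau)); split.
- by apply: t_box_ok; lra_with x1 t0.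
- rewrite t_box_area opprK subr0 -mulrA ler_wpM2l//; first by lra.
  by rewrite /chord_bound /inset; lra.
- move=> x y _ /andP[hx1 hx2] y0 y1 hr.
  apply: t_box_in; first by apply/andP; split; lra_with hx1 kh0 hx2.
  rewrite y0 /=; move: hr; rewrite roof_geP => /and5P[_ _ _ _ h5].
  apply: le_trans h5 _; rewrite ler_pdivrMr//; rewrite /om in hx2 h x1 x2; lra.
Qed.

Lemma chord_trap_right xi : `|xi| <= om ->
  (forall x y, ee / 2 <= om - xi -> Q x y -> xi + khat <= x <= om - khat -> y <= 3 / 2 ->
    (om - xi) * (y - Xy om) - (Xy xi - Xy om) * (om - x) < (om - xi) * (B / 256)) ->
  exists t, [/\ t_ok t, t_area t <= (om - xi) * chord_bound / 2 &
    forall x y, Q x y -> xi + khat <= x <= om - khat -> 0 <= y -> y <= 1 + B / 2 ->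
      y <= roof x -> t_in t x y].
Proof.
move=> hxi hc; have [X1 _] := Xy_om P; have kh0 := pkhat0 P; have k0 := pkap0 P.
have e0 := ee_gt0 P; have el := ee_le P; have b0 := pB0 P; have b1 := pB1 P.
have [o1 o2] := om_bounds P; have tl := tau_le P; have t0 := tau_gt0 P.
have rx := roof_ge P hxi; have rx2 := roof_le B xi.
move: hxi; rewrite ler_norml => /andP[x1 x2].
have [h|h] := leP (ee / 2) (om - xi).
  pose sl := (Xy xi - Xy om) / (om - xi).
  have slE : sl * (om - xi) = Xy xi - Xy om by rewrite /sl divfK// gt_eqF//; lra.
  have hr : t_height (Trapezoid xi om 0 0 (Xy om + sl * om + B / 256) (- sl)) om =
      tau + 2 * kap + B / 256 by rewrite /t_height /= X1; ring.
  have hl : t_height (Trapezoid xi om 0 0 (Xy om + sl * om + B / 256) (- sl)) xi =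
      Xy xi + B / 256 by rewrite /t_height /= -[Xy xi](subrK (Xy om)) -slE; ring.
  exists (Trapezoid xi om 0 0 (Xy om + sl * om + B / 256) (- sl)); split.
  - by split; rewrite /= ?hl ?hr /Xy; lra_with x2 rx t0 b0 k0.
  - rewrite /t_area hl hr [t_left _]/= [t_right _]/= ler_pM2r ?invr_gt0// ler_wpM2l//; first by lra_with x2.
    by rewrite /chord_bound /Xy; lra_with rx2.
  - move=> x y hQ hx y0 y1 hr'.
    have y2 : y <= 3 / 2 by lra_with y1 b1.
    have hh := hc _ _ h hQ hx y2; move: hx => /andP[hx1 hx2].
    split => /=; first by apply/andP; split; lra_with hx1 kh0 hx2.
    rewrite !mul0r addr0 y0 /=.
    have p0 : 0 < om - xi by lra_with h e0.
    have : (om - xi) * y <= (om - xi) * (Xy om + sl * om + B / 256 + - sl * x).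
      have -> : (om - xi) * (Xy om + sl * om + B / 256 + - sl * x) =
         (om - xi) * Xy om + (sl * (om - xi)) * (om - x) + (om - xi) * (B / 256) by ring.
      by rewrite slE; lra_with hh.
    by rewrite ler_pM2l.
exists (t_box xi om 0 (1 / 2 + tau)); split.
- by apply: t_box_ok; lra.
- rewrite t_box_area subr0 -mulrA ler_wpM2l//; first by lra.
  by rewrite /chord_bound /inset; lra.
- move=> x y _ /andP[hx1 hx2] y0 y1 hr.
  apply: t_box_in; first by apply/andP; split; lra_with hx1 kh0 hx2.
  rewrite y0 /=; move: hr; rewrite roof_geP => /and5P[_ _ _ h4 _].
  apply: le_trans h4 _; rewrite ler_pdivrMr//; rewrite /om in hx1 h x1 x2; lra.
Qed.

Definition loss_area := 1 + B / 8 + B / 64.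

(* 2 * loss_area exceeds the bound 2 + B / 4 of shell_area. *)
Lemma inscribed_loss (M : nat) (st : R) : 2 * om <= M%:R * st -> 0 < st -> 4 ^+ 4 * st <= B ->
  exists t s, [/\ t_ok t, ts_ok s,
    forall x y, t_in t x y -> (K x y /\ ~ Q x y) \/ ts_in s x y &
    loss_area <= t_area t - ts_area s].
Proof.
move=> hM st0 stB.
have kh0 := pkhat0 P; have k0 := pkap0 P; have k10 := pk10 P.
have e0 := ee_gt0 P; have el := ee_le P; have b0 := pB0 P; have b1 := pB1 P.
have [o1 o2] := om_bounds P; have tl := tau_le P; have t0 := tau_gt0 P.
have [Qbox|nQbox] := pselect (forall k, (k <= N)%N -> exists x y, vbox N B St k1 k x y /\ Q x y); last first.
  have /existsNP[k /not_implyP[kN nk]] := nQbox.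
  have w0 := ww_gt0 P; have s0 := St_gt0 P; have wl := ww_le P.
  have h0 : 0 <= St * k1 / ww by apply: divr_ge0; [apply: mulr_ge0|]; exact: ltW.
  exists (t_box (box_x N B k1 k) (box_x N B k1 k + k1)
     (box_y N B St k1 k) (box_y N B St k1 k + St * k1 / ww)), [::]; split => //.
  - by apply: t_box_ok; lra.
  - move=> x y [/= hx]; rewrite !mul0r !addr0 => hy; left; split; first exact: (@K_vbox k).
    by move=> hQ; apply: nk; exists x, y.
  - rewrite t_box_area subr0 (_ : _ * _ = St * k1 ^+ 2 / ww); last by ring.
    rewrite ler_pdivlMr//; have h2 := pSk1 P.
    have g : loss_area * ww <= loss_area * (1 + ee) by rewrite ler_wpM2l// /loss_area; lra.
    have g2 : loss_area * (1 + ee) <= (3 / 2) * (4 / 3) by apply: ler_pM; rewrite /loss_area; lra_with stB st0 e0 b1 el.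
    lra.
(* Missing this rectangle costs [6 / 5], which is more than [loss_area]. *)
have [Qtop|nQtop] := pselect (exists x y, [/\ `|x| <= 1, 2 / 5 <= y <= 1 & Q x y]); last first.
  exists (t_box (- 1) 1 (2 / 5) 1), [::]; split => //.
  - by apply: t_box_ok; lra.
  - move=> x y [/= hx]; rewrite !mul0r !addr0 => hy; left.
    have hx' : `|x| <= 1 by rewrite ler_norml.
    split; last by move=> hQ; apply: nQtop; exists x, y.
    move: hy => /andP[y1 y2]; move: hx => /andP[x1 x2].
    apply: K_upper; [lra_with hx' e0 y1 y2 stB st0 | apply/andP; split; lra_with hx' e0 y1 y2 stB st0 |].
    have Bx1 : B * (1 - x) >= 0 by rewrite mulr_ge0//; lra_with stB st0 x2.
    have Bx2 : B * (1 + x) >= 0 by rewrite mulr_ge0//; lra_with stB st0 x1.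
    by rewrite roof_geP; apply/and5P; split; try lra; apply: le_trans y2 _; rewrite ler_pdivlMr//; lra.
  - by rewrite t_box_area /= /loss_area; lra.
have Qmid := Q_mid; have Qroof : forall xi, `|xi| <= om -> ~ Q xi (Xy xi) by move=> xi _; exact: Q_roof.
have [xi [xi' [hxi hxi' /andP[xx1 xx2] hl hr]]] := lost_region P H Qbox Qtop Qmid Qroof hM st0.
have [tl' [okl al inl]] := chord_trap_left hxi hl.
have [tr' [okr ar inr]] := chord_trap_right hxi' hr.
have hxi_ := hxi; have hxi'_ := hxi'.
move: hxi_ hxi'_; rewrite !ler_norml => /andP[c1 c2] /andP[c3 c4].
(* The abscissas to which neither chord bound applies. *)
pose strips := [:: t_box (- om) (- om + khat) 0 (1 + B / 2);
  t_box (xi - khat) (xi' + khat) 0 (1 + B / 2); t_box (om - khat) om 0 (1 + B / 2)].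
have [eo1 [eo2 [eo3 [eo4 _]]]] := excess_ok.
(* A point of the bounding box that is not above the roof, not in a strip and not under a chord
   belongs to [K] but not to [Q]. *)
exists (t_box (- om) om 0 (1 + B / 2)), (tl' :: tr' :: strips ++ excess); split.
- by apply: t_box_ok; lra_with o1 stB st0.
- by do 5 (split; first by [|apply: t_box_ok; lra_with kh0 stB st0 xx1]).
- move=> x y [/= /andP[hx1 hx2]]; rewrite !mul0r !addr0 => /andP[y0 y1].
  have hx : `|x| <= om by rewrite ler_norml hx1.
  have [rf|] := excess_cover hx y1; last by move=> h; right; do 5 right.
  have hK : K x y by apply: K_upper => //; [lra_with hx o2 | rewrite y0].
  have [hQ|nQ] := pselect (Q x y); last by left.
  right; have y01 : 0 <= y <= 1 + B / 2 by rewrite y0.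
  have [x1|x1] := leP x (- om + khat).
    by do 2 right; left; apply: t_box_in => //; rewrite hx1.
  have [x2|x2] := leP (om - khat) x.
    by do 4 right; left; apply: t_box_in => //; rewrite x2.
  have [x3|x3] := leP x (xi - khat).
    by left; apply: inl => //; rewrite (ltW x1).
  have [x4|x4] := leP (xi' + khat) x.
    by right; left; apply: inr => //; rewrite x4 ltW.
  by do 3 right; left; apply: t_box_in => //; rewrite !ltW.
- have ea := excess_area.
  have -> : ts_area (tl' :: tr' :: strips ++ excess) =
     t_area tl' + t_area tr' + (4 * khat + (xi' - xi)) * (1 + B / 2) + ts_area excess.
    rewrite /ts_area /strips /= !t_box_area; ring.
  rewrite ea t_box_area.
  have khB := khat_B; have kB := kap_B.
  have g1 : (4 * khat + (xi' - xi)) * (1 + B / 2) <= (4 * khat + st) * (1 + B / 2).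
    by rewrite ler_wpM2r//; lra_with stB st0 xx2.
  have cb0 : 0 <= chord_bound by rewrite /chord_bound; lra_with t0 k0 stB st0.
  have g2 : (xi + om) * chord_bound / 2 + (om - xi') * chord_bound / 2 <= om * chord_bound.
    have -> : om * chord_bound = (2 * om) * chord_bound / 2 by field.
    by rewrite -mulrDl ler_pM2r ?invr_gt0// -mulrDl ler_wpM2r//; lra_with xx1.
  have g3 : om * chord_bound <= (1 + ee) * chord_bound by rewrite ler_wpM2r//; lra_with o2.
  have eE : ee = B / 4 by []. 
  have tE : tau = B / 64 by [].
  have BB : B * B <= 64^-1 * B by rewrite ler_wpM2r//; lra_with stB st0 b1.
  have te : tau * ee = B * B / 256 by rewrite tE eE; field.
  have g4 : (4 * khat + st) * (1 + B / 2) <= (4 * khat + st) * 2 by rewrite ler_wpM2l//; lra_with kh0 st0 b1.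
  have tot : t_area tl' + t_area tr' <= (1 + ee) * chord_bound by lra_with g3 g2 ar al.
  (* To first order in [B] the balance is [2 + 3 * B / 4 + ee] minus
     [1 + B / 2 + ee + tau + B / 128], that is [1 + 29 * B / 128], against the required
     [1 + 18 * B / 128]; the strips cost about [B / 128] more at most. *)
  have -> : (om - - om) * (1 + B / 2 - 0) - (t_area tl' + t_area tr' +
     (4 * khat + (xi' - xi)) * (1 + B / 2) + (B / 4 + ee * (1 - tau) * (1 + B - tau))) =
     2 + 3 / 4 * B + ee - tau * (tau * ee) - (t_area tl' + t_area tr') -
     (4 * khat + (xi' - xi)) * (1 + B / 2) by rewrite /om; field.
  have cE : (1 + ee) * chord_bound = 1 + B / 2 + tau + 4 * kap + B / 128 + ee +
      ee * B * (65 / 128) + tau * ee + 4 * (ee * kap) by rewrite /chord_bound; field.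
  have ek : ee * kap <= 1 * kap by rewrite ler_pM2r//; lra_with el.
  have tt : tau * (tau * ee) <= 1 * (tau * ee).
    by rewrite ler_wpM2r ?ltW ?(tauee_gt0 P)//; lra_with tl.
  have eB : ee * B = B * B / 4 by rewrite eE; field.
  have Bee : B * ee = B * B / 4 by rewrite eE; field.
  by rewrite /loss_area; lra.
Qed.

End Loss.

(** * Choice of the parameters *)

(** Conditions on [D] when a sum with a disc of radius [del] is measured in units of [del / D]; a
    bound [b] on its coordinates then becomes [b / (del / D)]. *)
Record disc_large (R : rcfType) (N : nat) (B St k1 kap khat E del b D : R) : Prop := DiscLarge {
  d_D0 : 0 < D;
  d_D1 : 2 * (2 + rho N St / k1) * rho N St <= D;
  d_D2 : 2 * (2 + rho N St / k1) ^+ 2 * rho N St ^+ 3 / D <= E;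
  d_D3 : 4 ^+ 3 * (4 ^+ 3 * (rho N St ^+ 2 / D + 2 * B * (b / (del / D)))) <= D;
  d_D4 : 64 + 4 * rho N St ^+ 2 <= D;
  d_kap : (rho N St ^+ 2 / D + 2 * khat) *
    (2 + 2 * N%:R * (St / ww N B) + 1 / flare B) <= kap }.

Local Tactic Notation "lra_with" ne_hyp_list(hs) := clear - hs; lra.

(** In [d_D3] the scaled bound [b / (del / D)] grows with [D], so [B] itself must be small compared
    with [del / b]. All other conditions on [D] are lower bounds, met by taking [D] to be a sum that
    includes each of them. *)
Lemma params_exist (R : rcfType) (N : nat) (del b : R) : (2 <= N)%N -> 0 < del -> 0 <= b ->
  exists B St k1 kap khat E D : R,
    [/\ params_ok N B St k1 kap khat E, 0 < khat & disc_large N B St k1 kap khat E del b D].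
Proof.
move=> N2 d0 b0; have n2 := natN_ge2 R N2; set n := N%:R in n2.
pose s := b + del + 1; have s0 : 0 < s by rewrite /s; lra.
pose B := del / (4 ^+ 3 * (4 ^+ 3 * (4 ^+ 3 * s))).
have s64 : 0 < 4 ^+ 3 * (4 ^+ 3 * (4 ^+ 3 * s)) by lra.
have B0 : 0 < B by rewrite divr_gt0.
have Bs : B * (4 ^+ 3 * (4 ^+ 3 * (4 ^+ 3 * s))) = del by rewrite divfK// gt_eqF.
have B1 : 4 ^+ 3 * B <= 1.
  have h : (4 ^+ 3 * B) * (4 ^+ 3 * (4 ^+ 3 * s)) <= 1 * (4 ^+ 3 * (4 ^+ 3 * s)) by rewrite /s in Bs *; lra.
  by move: h; rewrite ler_pM2r//; lra.
have Bb : 4 ^+ 3 * (4 ^+ 3 * (4 * (B * b))) <= del.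
  have h : B * b <= B * s by rewrite ler_pM2l// /s; lra.
  have h2 : 0 <= B * s by rewrite mulr_ge0 ?ltW.
  lra.
have n30 : 0 < n ^+ 3 by rewrite exprn_gt0//; lra.
pose k1 := B ^+ 2 / 256 / (2 * 4 * 4 * (2 * 4 * 4 * n ^+ 3)).
have k10 : 0 < k1.
  by apply: divr_gt0; [apply: divr_gt0 => //; exact: exprn_gt0 | lra].
have k1n : 2 * 4 * 4 * (2 * 4 * 4 * (n ^+ 3 * k1)) = inset B * flare B.
  by rewrite /k1 /inset /flare; field; rewrite gt_eqF//; lra.
pose St := 2 / k1 ^+ 2.
have k12 : 0 < k1 ^+ 2 by rewrite exprn_gt0.
have S0 : 0 < St by rewrite divr_gt0.
have Sk : St * k1 ^+ 2 = 2 by rewrite divfK// gt_eqF.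
have kB0 : 0 < k1 * B ^+ 2 by rewrite mulr_gt0// exprn_gt0.
pose E := k1 * B ^+ 2 / (4 ^+ 3 * (4 ^+ 3 * 64)).
have E0 : 0 < E by rewrite divr_gt0//; lra.
have EE : 4 ^+ 3 * (4 ^+ 3 * (4 ^+ 3 * E)) = k1 * B ^+ 2 by rewrite /E; field.
pose L := 2 + 2 * n * (St / ww N B) + 1 / flare B.
have e0 : 0 < flare B by rewrite divr_gt0.
have w0 : 0 < ww N B by rewrite /ww divr_gt0//; lra_with e0 n2.
have L1 : 1 <= L.
  have h1 : 0 <= 2 * n * (St / ww N B) by rewrite mulr_ge0 ?divr_ge0 ?(ltW S0) ?(ltW w0)//; lra_with n2 k12 e0.
  have h2 : 0 <= 1 / flare B by rewrite divr_ge0// ltW.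
  by rewrite /L; lra.
have L0 : 0 < L by lra.
pose khat := E / (4 * L).
have kh0 : 0 < khat by rewrite divr_gt0//; lra_with L1.
have khE : khat * (4 * L) = E by rewrite divfK// gt_eqF//; lra_with L1.
have khE' : khat <= E.
  have h : khat * 1 <= khat * (4 * L) by rewrite ler_pM2l//; lra_with L1.
  lra_with h khE.
pose r := rho N St.
have r0 : 0 <= r by rewrite /r /rho /qq mulr_ge0// mulr_ge0 ?sqr_ge0// ltW.
have rk0 : 0 <= 2 + r / k1 by have h : 0 <= r / k1 := divr_ge0 r0 (ltW k10); lra_with h.
pose D1 := 2 * (2 + r / k1) * r.
pose D2 := 2 * (2 + r / k1) ^+ 2 * r ^+ 3 / E.
pose D3 := 2 * L * r ^+ 2 / E.
have D10 : 0 <= D1 by rewrite mulr_ge0// mulr_ge0.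
have D20 : 0 <= D2.
  by apply: divr_ge0; [rewrite mulr_ge0 ?exprn_ge0// mulr_ge0// exprn_ge0 | exact: ltW].
have r20 : 0 <= r ^+ 2 by exact: sqr_ge0.
have D30 : 0 <= D3.
  by apply: divr_ge0; [rewrite mulr_ge0// mulr_ge0// ltW | exact: ltW].
pose D := 4 ^+ 3 * (4 ^+ 3 * 2) + 64 + 4 * r ^+ 2 + D1 + D2 + D3.
have D0 : 0 < D by rewrite /D; lra_with D30 r20 D20 D10.
have D1D : D1 <= D by rewrite /D; lra_with D30 r20 D20.
have D2D : D2 <= D by rewrite /D; lra_with D30 r20 D10.
have D3D : D3 <= D by rewrite /D; lra_with r20 D20 D10.
have Dr : 4 * r ^+ 2 <= D by rewrite /D; lra_with D30 D20 D10.
have rD : r ^+ 2 / D <= 1 by rewrite ler_pdivrMr//; lra.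
exists B, St, k1, E, khat, E, D; split => //.
  by split => //; rewrite ?k1n ?Sk ?EE//; [exact: ltW | rewrite -EE; lra_with khE'].
split => //.
- by rewrite ler_pdivrMr// [E * D]mulrC -ler_pdivrMr.
- have -> : b / (del / D) = b * D / del by field; rewrite !gt_eqF.
  have -> : 2 * B * (b * D / del) = (B * b / del) * (2 * D) by field; rewrite gt_eqF.
  have q : 4 ^+ 3 * (4 ^+ 3 * (4 * (B * b / del))) <= 1.
    have -> : 4 ^+ 3 * (4 ^+ 3 * (4 * (B * b / del))) = 4 ^+ 3 * (4 ^+ 3 * (4 * (B * b))) / del by ring.
    by rewrite ler_pdivrMr// mul1r.
  have q2 : (4 ^+ 3 * (4 ^+ 3 * (4 * (B * b / del)))) * D <= 1 * D by rewrite ler_pM2r.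
  rewrite -/r; have q3 : 4 ^+ 3 * (4 ^+ 3 * 2) <= D by rewrite /D; lra_with D30 r20 D20 D10.
  lra_with q3 q2 rD.
- by rewrite -/r /D; lra_with D30 D20 D10.
- rewrite -/n -/L -/r.
  have q : r ^+ 2 / D * (2 * L) <= E.
    have -> : r ^+ 2 / D * (2 * L) = (2 * L * r ^+ 2) / D by ring.
    by rewrite ler_pdivrMr// [E * D]mulrC -ler_pdivrMr.
  lra_with q khE.
Qed.

From mathcomp Require Import all_classical all_reals all_analysis.
From mathcomp Require Import measurable_realfun.
Import numFieldNormedType.Exports.
Local Open Scope classical_set_scope.
Local Open Scope ring_scope.

(** * Areas in the plane *)

Section Trapezoid.
Variable R : realType.
Local Notation mu := (@lebesgue_measure R).
Local Notation mR := (measurableTypeR R).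
Implicit Types (p q al be ga de : R).

Definition trap p q al be ga de : set (mR * mR) :=
  [set z | p <= z.1 <= q /\ al + be * z.1 <= z.2 <= ga + de * z.1].

Lemma measurable_trap p q al be ga de : measurable (trap p q al be ga de).
Proof.
have mle (f g : mR * mR -> R) : measurable_fun setT f -> measurable_fun setT g ->
    measurable [set z | f z <= g z].
  by move=> mf mg; rewrite -[X in measurable X]setTI; exact: measurable_fun_le.
have m1 : measurable_fun setT (fun z : mR * mR => z.1 : R) by exact: measurable_fst.
have m2 : measurable_fun setT (fun z : mR * mR => z.2 : R) by exact: measurable_snd.
have maff (c d : R) : measurable_fun setT (fun z : mR * mR => c + d * z.1 : R).
  by apply: measurable_funD => //; apply: measurable_funM.
rewrite (_ : trap _ _ _ _ _ _ = [set z | p <= z.1] `&` [set z | z.1 <= q] `&`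
   ([set z | al + be * z.1 <= z.2] `&` [set z | z.2 <= ga + de * z.1])).
  by apply: measurableI; apply: measurableI; apply: mle => //; exact: measurable_cst.
apply/seteqP; split => z /=; rewrite /trap /=.
  by move=> [/andP[? ?] /andP[? ?]].
by move=> [[h1 h2] [h3 h4]]; rewrite h1 h2 h3 h4.
Qed.

Lemma integral_affine p q (c d : R) : p <= q ->
  (\int[mu]_(x in `[p, q]) (c + d * x)%:E)%E = ((q - p) * ((c + d * p) + (c + d * q)) / 2)%:E.
Proof.
rewrite le_eqVlt => /orP[/eqP <-|pq].
  by rewrite set_itv1 integral_set1 subrr !mul0r.
pose F x := c * x + d / 2 * x ^+ 2 : R.
have dF x : is_derive x (1 : R) F (c + d * x).
  apply: is_derive_eq.
  by rewrite /GRing.scale /= !mulr1; field.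
have cF : continuous F by move=> x; apply: differentiable_continuous; apply/derivable1_diffP.
rewrite (@continuous_FTC2 _ _ F)//.
- by rewrite -EFinB; congr EFin; rewrite /F; field.
- apply: continuous_subspaceT => x.
  by apply: cvgD; [exact: cvg_cst | apply: cvgM; [exact: cvg_cst | exact: cvg_id]].
- split.
  + by move=> x _; apply: ex_derive.
  + by apply: cvg_at_right_filter; exact: cF.
  + by apply: cvg_at_left_filter; exact: cF.
- by move=> x _; rewrite derive1E; exact: derive_val.
Qed.

Lemma trap_area p q al be ga de : p <= q ->
  al + be * p <= ga + de * p -> al + be * q <= ga + de * q ->
  area (trap p q al be ga de) =
    ((q - p) * ((ga + de * p - (al + be * p)) + (ga + de * q - (al + be * q))) / 2)%:E.
Proof.
move=> pq hp hq; rewrite /area /product_measure1 /=.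
have hin x : p <= x <= q -> al + be * x <= ga + de * x.
  move=> /andP[px xq].
  have [pq'|pq'] := ltP p q; last by have -> : x = p by lra.
  have g1 := ler_wpM2l (_ : 0 <= q - x) hp; have g2 := ler_wpM2l (_ : 0 <= x - p) hq.
  have h1 : 0 <= q - x by lra.
  have h2 : 0 <= x - p by lra.
  have := g1 h1; have := g2 h2 => k1 k2.
  have : (q - p) * (al + be * x) <= (q - p) * (ga + de * x) by lra.
  by rewrite ler_pM2l// subr_gt0.
transitivity (\int[mu]_(x in `[p, q]) ((ga - al) + (de - be) * x)%:E)%E; last first.
  by rewrite integral_affine//; congr EFin; congr (_ / 2); ring.
rewrite [RHS]integral_mkcond; apply: eq_integral => x _ /=.
rewrite patchE; case: ifPn => xpq.
  move: xpq; rewrite inE /= in_itv /= => xpq.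
  have -> : xsection (trap p q al be ga de) x = `[al + be * x, ga + de * x]%classic.
    apply/seteqP; split => y; rewrite /xsection /= inE /trap /= in_itv /=; first by case.
    by split.
  rewrite lebesgue_measure_itv /= lte_fin; case: ltP => h; first by congr EFin; ring.
  by congr EFin; have := hin _ xpq; lra.
have -> : xsection (trap p q al be ga de) x = set0; last by rewrite measure0.
apply/seteqP; split => // y; rewrite /xsection /= inE /trap /= => -[xp _].
by move/negP: xpq; apply; rewrite inE /= in_itv.
Qed.

End Trapezoid.

Section Dilate.
Variable R : realType.
Variable a : R.
Hypothesis a0 : 0 < a.
Implicit Types (X Y : R -> R -> Prop) (t : trapezoid R).

(** Passage to true size: [a] is the length of the unit in which the model polygon is described. *)
Definition dilate X : set (measurableTypeR R * measurableTypeR R) :=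
  [set z | X (z.1 / a) (z.2 / a)].

Lemma dilate_trapezoid t : dilate (t_in t) =
  trap (a * t_left t) (a * t_right t) (a * t_low t) (t_low_slope t)
    (a * t_high t) (t_high_slope t).
Proof.
have d1 (x y : R) : (x <= y / a) = (a * x <= y) by rewrite ler_pdivlMr// mulrC.
have d2 (x y : R) : (y / a <= x) = (y <= a * x) by rewrite ler_pdivrMr// mulrC.
have d3 (c b x : R) : a * (c + b * (x / a)) = a * c + b * x.
  by field; rewrite gt_eqF.
by apply/seteqP; split => z; rewrite /dilate /trap /t_in /= !d1 !d2 !d3.
Qed.

Lemma measurable_dilate_trapezoid t : measurable (dilate (t_in t)).
Proof. by rewrite dilate_trapezoid; exact: measurable_trap. Qed.

Lemma area_dilate_trapezoid t : t_ok t -> area (dilate (t_in t)) = (a ^+ 2 * t_area t)%:E.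
Proof.
case=> h1; rewrite /t_height => h2 h3; rewrite dilate_trapezoid trap_area.
- by congr EFin; rewrite /t_area /t_height; field.
- by rewrite ler_pM2l.
- have := ler_wpM2l (ltW a0) h2; rewrite mulr0; lra.
- have := ler_wpM2l (ltW a0) h3; rewrite mulr0; lra.
Qed.

(** Induction on the list, taking the trapezoids out of [X] one by one. *)
Lemma area_cover X Y s : measurable (dilate X) -> measurable (dilate Y) -> ts_ok s ->
  (forall x y, X x y -> Y x y \/ ts_in s x y) ->
  (area (dilate X) <= area (dilate Y) + (a ^+ 2 * ts_area s)%:E)%E.
Proof.
move=> mX mY; elim: s X mX => [|t s IH] X mX /=.
  move=> _ h; rewrite mulr0 adde0; apply: le_measure; rewrite ?inE// => z /= /h.
  by case.
move=> [okt oks] h; pose X' x y := X x y /\ ~ t_in t x y.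
have XE : dilate X' = dilate X `\` dilate (t_in t) by apply/seteqP; split.
have mX' : measurable (dilate X').
  by rewrite XE; apply: measurableD => //; exact: measurable_dilate_trapezoid.
have IH' := IH X' mX' oks.
have /IH' {}IH' : forall x y, X' x y -> Y x y \/ ts_in s x y.
  by move=> x y [/h[|[|]]]; [left | | right].
have mU : measurable (dilate X' `|` dilate (t_in t)).
  by apply: measurableU => //; exact: measurable_dilate_trapezoid.
apply: (@le_trans _ _ (area (dilate X' `|` dilate (t_in t)))).
  apply: le_measure; rewrite ?inE// => z hz.
  by have [|] := pselect (dilate (t_in t) z); [right | left].
apply: (@le_trans _ _ (area (dilate X') + area (dilate (t_in t)))%E).
  by apply: measureU2 => //; exact: measurable_dilate_trapezoid.
rewrite area_dilate_trapezoid// mulrDr EFinD [X in (_ <= _ + X)%E]addeC addeA.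
by rewrite leeD2r.
Qed.

Lemma area_diff X Y (r : R) : measurable (dilate X) -> measurable (dilate Y) ->
  (forall x y, Y x y -> X x y) -> area (dilate X) = r%:E ->
  area (dilate Y) = (r%:E - area (dilate (fun x y => X x y /\ ~ Y x y)))%E.
Proof.
move=> mX mY YX hr.
have XE : dilate (fun x y => X x y /\ ~ Y x y) = dilate X `\` dilate Y by apply/seteqP; split.
have UE : dilate X = dilate Y `|` (dilate X `\` dilate Y).
  apply/seteqP; split => z /=.
    by move=> hz; have [|] := pselect (dilate Y z); [left | right].
  by case; [exact: YX | case].
have mD : measurable (dilate X `\` dilate Y) by exact: measurableD.
have : area (dilate X) = (area (dilate Y) + area (dilate X `\` dilate Y))%E.
  rewrite {1}UE; apply: measureU => //.
  by apply/seteqP; split => z //= -[hY [_]].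
rewrite hr XE => e; rewrite e.
have f : area (dilate X `\` dilate Y) \is a fin_num.
  have : (area (dilate Y) + area (dilate X `\` dilate Y))%E \is a fin_num by rewrite -e.
  by rewrite fin_numD => /andP[].
by rewrite addeK.
Qed.

End Dilate.

(** * Comparison of the areas of the three kinds of polygons *)

Section Gap.
Variables (R : realType) (N : nat) (B St k1 kap khat E : R).
Hypothesis P : params_ok N B St k1 kap khat E.
Variables (D Yt K0 Rr x0 : R) (C1 C C' : R -> R -> Prop).
Hypothesis H : body_ok N B St k1 khat E D Yt K0 Rr x0 C1 C C'.
Hypothesis HS : support_ok N B St k1 kap khat D Yt K0 x0 C1.
Variable a : R.
Hypothesis a0 : 0 < a.
Hypothesis mC : forall u v, measurable (dilate a (shifted C' u v)).

Lemma measurable_all_shifts m (v : 'I_m -> R * R) : measurable (dilate a (all_shifts C' v)).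
Proof.
have -> : dilate a (all_shifts C' v) = \bigcap_i dilate a (shifted C' (v i).1 (v i).2).
  by apply/seteqP; split => z h i; [move=> _; exact: h | exact: (h i)].
by apply: fin_bigcap_measurable => // i _; exact: mC.
Qed.

(** With [n = N + 2], [c1] bounds the loss of the lowered polygon and [c2] is a loss that no
    inscribed polygon with [n] translates avoids; [c1 < 2 * c2] is the failure of concavity. *)
Theorem area_gap : exists (u : 'I_N.+3 -> R * R) (w : 'I_N.+1 -> R * R) (r c1 c2 : R),
  [/\ forall x y, all_shifts C' u x y -> `|x| <= 2 /\ `|y| <= 3 * qq N St,
      forall x y, `|x| <= 1 / 2 -> 0 <= y <= 1 -> all_shifts C' u x y,
      forall x y, all_shifts C' w x y -> all_shifts C' u x y,
      c1 < 2 * c2 &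
      [/\ area (dilate a (all_shifts C' u)) = r%:E,
          ((r - c1)%:E <= area (dilate a (all_shifts C' w)))%E &
          forall v : 'I_N.+2 -> R * R, (forall x y, all_shifts C' v x y -> all_shifts C' u x y) ->
            (area (dilate a (all_shifts C' v)) <= (r - c2)%:E)%E]].
Proof.
have [ue [ul [ur [ut [uw]]]]] := translates_exist P H HS.
move=> /[let] edges /[let] K /[let] L [K_in K_out LK KL].
pose u (i : 'I_N.+3) := if (i < N)%N then ue i else if i == N :> nat then ul
  else if i == N.+1 :> nat then ur else ut.
pose w (i : 'I_N.+1) := if (i < N)%N then ue i else uw.
have QK x y : all_shifts C' u x y <-> K x y.
  split=> [h|[h1 h2 h3 h4] i].
    split.
    - move=> j jN; have jN' : (j < N.+3)%N by rewrite ltnW// ltnW// ltnW.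
      by have := h (Ordinal jN'); rewrite /u /= jN.
    - have i1 : (N < N.+3)%N by rewrite ltnW// ltnW.
      by have := h (Ordinal i1); rewrite /u /= ltnn eqxx.
    - have i1 : (N.+1 < N.+3)%N by rewrite ltnW.
      by have := h (Ordinal i1); rewrite /u /= ltnNge leqnSn /= eqn_leq ltnn eqxx.
    - have i1 : (N.+2 < N.+3)%N by [].
      have := h (Ordinal i1); rewrite /u /= ltnNge ltnW//= eqn_leq ltnNge ltnW//=.
      by rewrite eqn_leq ltnn.
  rewrite /u; case: ifPn => [iN|_]; first exact: h1.
  by case: ifP => // _; case: ifP.
have QL x y : all_shifts C' w x y <-> L x y.
  split=> [h|[h1 h2] i].
    split.
    - move=> j jN; have jN' : (j < N.+1)%N by rewrite ltnW.
      by have := h (Ordinal jN'); rewrite /w /= jN.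
    - have i1 : (N < N.+1)%N by [].
      by have := h (Ordinal i1); rewrite /w /= ltnn.
  by rewrite /w; case: ifPn => [iN|_]; first exact: h1.
have dQK : dilate a (all_shifts C' u) = dilate a K by apply/seteqP; split => z /QK.
have dQL : dilate a (all_shifts C' w) = dilate a L by apply/seteqP; split => z /QL.
have mK : measurable (dilate a K) by rewrite -dQK; exact: measurable_all_shifts.
have mL : measurable (dilate a L) by rewrite -dQL; exact: measurable_all_shifts.
have q1 := qq_ge P; have e0 := ee_gt0 P; have el := ee_le P; have b0 := pB0 P; have b1 := pB1 P.
have Kbox x y : K x y -> `|x| <= 2 /\ `|y| <= 3 * qq N St.
  move=> /K_out[[h1 /andP[h2 h3]] _ _ _]; split => //.
  by rewrite ler_norml; apply/andP; split; lra.
have a2 : 0 < a ^+ 2 by rewrite exprn_gt0.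
have [r rE] : exists r : R, area (dilate a K) = r%:E.
  have h : (area (dilate a K) <= area (dilate a (fun _ _ => False)) +
      (a ^+ 2 * ts_area [:: t_box (- 2) 2 (- (3 * qq N St)) (3 * qq N St)])%:E)%E.
    apply: area_cover => //.
    - have -> : dilate a (fun _ _ => False) = set0 by apply/seteqP; split.
      exact: measurable0.
    - by split => //; apply: t_box_ok; lra.
    - move=> x y /Kbox; rewrite !ler_norml => -[h1 h2]; right; left.
      exact: t_box_in.
  have h0 : (0 <= area (dilate a K))%E by exact: measure_ge0.
  have e : area (dilate a (fun _ _ => False)) = 0%E.
    have -> : dilate a (fun _ _ => False) = set0 by apply/seteqP; split.
    exact: measure0.
  rewrite e add0e in h.
  exists (fine (area (dilate a K))); rewrite fineK// ge0_fin_numE//.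
  exact: le_lt_trans h (ltry _).
exists u, w, r, (a ^+ 2 * (2 + B / 4)), (a ^+ 2 * loss_area B); split.
- by move=> x y /QK /Kbox.
- move=> x y hx hy; apply/QK; apply: (K_upper P K_in); first by lra.
    by move: hy => /andP[h1 h2]; apply/andP; split; lra.
  move: hx hy; rewrite ler_norml => /andP[x1 x2] /andP[y1 y2].
  have Bx1 : 0 <= B * (1 - x) by rewrite mulr_ge0 ?(ltW b0)//; lra.
  have Bx2 : 0 <= B * (1 + x) by rewrite mulr_ge0 ?(ltW b0)//; lra.
  by rewrite roof_geP; apply/and5P; split; try lra; apply: le_trans y2 _; rewrite ler_pdivlMr//; lra.
- by move=> x y /QL /LK /QK.
- by rewrite mulrCA ltr_pM2l// /loss_area; lra.
split; first by rewrite dQK.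
- rewrite dQL (area_diff mK mL LK rE) EFinB leeB//.
  have mKL : measurable (dilate a (fun x y => K x y /\ ~ L x y)).
    have -> : dilate a (fun x y => K x y /\ ~ L x y) = dilate a K `\` dilate a L by apply/seteqP; split.
    exact: measurableD.
  have m0 : measurable (dilate a (fun _ _ => False)).
    have -> : dilate a (fun _ _ => False) = set0 by apply/seteqP; split.
    exact: measurable0.
  have := area_cover a0 mKL m0 (shell_ok P).
  have -> : area (dilate a (fun _ _ => False)) = 0%E.
    have -> : dilate a (fun _ _ => False) = set0 by apply/seteqP; split.
    exact: measure0.
  rewrite add0e => h; apply: le_trans (h _) _.
    move=> x y [hK nL]; right; have [_ h1 h2 _] := K_out _ _ hK.
    exact: (shell_cover P h1 h2 (KL _ _ hK nL)).
  by rewrite lee_fin ler_pM2l// (shell_area P).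
move=> v vK.
have QvK x y : all_shifts C' v x y -> K x y by move=> /vK /QK.
have K_roof x y : K x y -> y <= roof B x + kap by move=> /K_out[].
have K_edge x y : K x y -> forall j, (j < N)%N -> edge N B St j x - kap <= y.
  by move=> /K_out[].
have st0 : 0 < B / 4 / 4 / 4 / 4 by do 4 apply: divr_gt0 => //.
have [M hM] : exists M : nat, 2 * om B <= M%:R * (B / 4 / 4 / 4 / 4).
  exists (Num.truncn (2 * om B / (B / 4 / 4 / 4 / 4))).+1.
  by rewrite -ler_pdivrMr// ltW// truncnS_gt.
have stB : 4 ^+ 4 * (B / 4 / 4 / 4 / 4) <= B by lra.
have [t [s [okt oks hc hl]]] := inscribed_loss P H K_in K_roof K_edge QvK hM st0 stB.
have mQ := measurable_all_shifts v.
rewrite (area_diff mK mQ QvK rE) EFinB leeB//.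
have mKQ : measurable (dilate a (fun x y => K x y /\ ~ all_shifts C' v x y)).
  have -> : dilate a (fun x y => K x y /\ ~ all_shifts C' v x y) = dilate a K `\` dilate a (all_shifts C' v).
    by apply/seteqP; split.
  exact: measurableD.
have := area_cover a0 (measurable_dilate_trapezoid a0 t) mKQ oks hc.
rewrite (area_dilate_trapezoid a0 okt) => h.
have h2 : a ^+ 2 * loss_area B <= a ^+ 2 * t_area t - a ^+ 2 * ts_area s.
  by rewrite -mulrBr ler_pM2l.
rewrite -leeBlDr// in h; apply: le_trans h.
by rewrite -EFinB lee_fin.
Qed.

End Gap.

Section OpenMeasurable.
Variable R : realType.

(** Connects the topology of [plane] with the product measure behind [area]: an open set is the
    union of the countably many squares with rational data that it contains. *)
Lemma open_plane_measurable (U : set (plane R)) : open U ->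
  measurable (U : set (measurableTypeR R * measurableTypeR R)).
Proof.
move=> oU.
pose bx (q1 q2 e : rat) : set (measurableTypeR R * measurableTypeR R) :=
  `](ratr q1 : R) - ratr e, ratr q1 + ratr e[%classic `*` `](ratr q2 : R) - ratr e, ratr q2 + ratr e[%classic.
pose F q1 q2 e := if `[< bx q1 q2 e `<=` U >] then bx q1 q2 e else set0.
have -> : (U : set (measurableTypeR R * measurableTypeR R)) = \bigcup_q1 \bigcup_q2 \bigcup_e F q1 q2 e.
  apply/seteqP; split => z /=; last first.
    by move=> [q1 _ [q2 _ [e _]]]; rewrite /F; case: asboolP => // h; exact: h.
  move=> Uz; have /nbhs_ballP[d /= d0 dU] : nbhs (z : plane R) U by exact: open_nbhs_nbhs.
  have d2 : 0 < d / 2 by rewrite divr_gt0.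
  have [e] := rat_in_itvoo d2; rewrite in_itv /= => /andP[e0 ed].
  have near (c : R) : c - ratr e < c + ratr e by lra.
  have [q1] := rat_in_itvoo (near z.1); rewrite in_itv /= => /andP[a1 a2].
  have [q2] := rat_in_itvoo (near z.2); rewrite in_itv /= => /andP[b1 b2].
  exists q1 => //; exists q2 => //; exists e => //; rewrite /F; case: asboolP => h.
    by split; rewrite /= in_itv /=; apply/andP; split; lra.
  exfalso; apply: h => y [/=]; rewrite !in_itv /= => /andP[c1 c2] /andP[c3 c4].
  apply: dU; rewrite -ball_normE /= prod_normE /= gt_max !ltr_norml.
  by apply/andP; split; apply/andP; split; lra.
apply: bigcupT_measurable_rat => q1; apply: bigcupT_measurable_rat => q2.
apply: bigcupT_measurable_rat => e; rewrite /F; case: ifP => _; last exact: measurable0.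
by apply: measurableX; exact: measurable_itv.
Qed.

Lemma closed_plane_measurable (U : set (plane R)) : closed U ->
  measurable (U : set (measurableTypeR R * measurableTypeR R)).
Proof.
move=> cU; rewrite -[U]setCK; apply: measurableC; apply: open_plane_measurable.
by rewrite openC.
Qed.

End OpenMeasurable.

(** * Sets in the plane *)

Section Plane.
Variable R : realType.
Implicit Types (A B C : set (plane R)) (z : plane R).

Definition coords A (x y : R) : Prop := A (x, y).

Lemma coordsE A z : A z = coords A z.1 z.2.
Proof. by rewrite /coords -surjective_pairing. Qed.

Lemma convex_coords A : @convex_set R (plane R) A <-> convex2 (coords A).
Proof.
split=> cA.
  move=> x1 y1 x2 y2 t /andP[t0 t1] h1 h2.
  have := cA (x2, y2) (x1, y1) (Itv01 t0 t1); rewrite !inE => /(_ h2 h1).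
  by move=> h; rewrite /coords addrC [X in (_, X)]addrC; exact: h.
move=> x y l; rewrite !inE => hx hy.
have l01 : 0 <= l%:inum <= 1 by apply/andP; split; [exact: ge0 | exact: le1].
have := cA y.1 y.2 x.1 x.2 l%:inum l01; rewrite -!coordsE => /(_ hy hx).
by rewrite /coords addrC [X in (_, X)]addrC.
Qed.

Lemma continuous_affine (c p q : R) : continuous (fun z : plane R => c + (p * z.1 + q * z.2) : R^o).
Proof.
move=> z; apply: cvgD; first exact: cvg_cst.
apply: cvgD; apply: cvgM; try exact: cvg_cst; [exact: cvg_fst | exact: cvg_snd].
Qed.

Lemma closed_half_plane (c p q : R) : closed [set z : plane R | c + (p * z.1 + q * z.2) <= 0].
Proof.
have := @continuous_affine c p q => /continuous_closedP /(_ [set x | x <= 0]).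
by apply; exact: closed_le.
Qed.

Lemma compact_plane A (M : R) : closed A -> (forall z, A z -> `|z.1| <= M /\ `|z.2| <= M) ->
  compact A.
Proof.
move=> cA hA; apply: (@subclosed_compact _ _ (`[- M, M]%classic `*` `[- M, M]%classic)) => //.
  by apply: compact_setX; exact: segment_compact.
by move=> z /hA[]; rewrite !ler_norml => h1 h2; split; rewrite /= in_itv.
Qed.

Lemma compact_plane_bound A : compact A ->
  exists M : R, 0 < M /\ forall z, A z -> `|z.1| <= M /\ `|z.2| <= M.
Proof.
move=> /compact_bounded[M [_ hM]]; exists (`|M| + 1); split; first by rewrite ltr_pwDr.
move=> z Az; have h : `|z| <= `|M| + 1.
  by apply: hM Az; rewrite (le_lt_trans (ler_norm M))// ltrDl.
by move: h; rewrite prod_normE ge_max => /andP[].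
Qed.

Lemma interior_box A c1 c2 (e : R) : 0 < e ->
  (forall x y, `|x - c1| < e -> `|y - c2| < e -> A (x, y)) -> A° !=set0.
Proof.
move=> e0 h; exists (c1, c2); apply/nbhs_ballP; exists e => //= z.
rewrite -ball_normE /= prod_normE /= gt_max => /andP[h1 h2].
by rewrite coordsE; apply: h; rewrite distrC.
Qed.

Lemma compact_max A (p q : R) : compact A -> A !=set0 ->
  exists z, A z /\ forall z', A z' -> p * z'.1 + q * z'.2 <= p * z.1 + q * z.2.
Proof.
move=> cA A0.
have cf : {within A, continuous (fun z : plane R => 0 + (p * z.1 + q * z.2) : R)}.
  by apply: continuous_subspaceT; exact: continuous_affine.
have [z zA hz] := compact_EVT_max A0 cA cf.
exists z; split; first by rewrite inE in zA.
by move=> z' Az'; have := hz z'; rewrite inE !add0r => /(_ Az').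
Qed.

Lemma eucl_continuous z : continuous (fun z' : plane R => eucl_dist z z' : R^o).
Proof.
pose g (z' : plane R) : R^o := (z.1 - z'.1) * (z.1 - z'.1) + (z.2 - z'.2) * (z.2 - z'.2).
rewrite (_ : eucl_dist z = (Num.sqrt : R^o -> R^o) \o g); last first.
  by apply/funext => z'; rewrite /eucl_dist !expr2.
move=> z'; apply: (@continuous_comp _ _ _ g (Num.sqrt : R^o -> R^o)); last exact: sqrt_continuous.
have c1 : continuous (fun x : plane R => z.1 - x.1 : R^o).
  by move=> x; apply: cvgB; [exact: cvg_cst | exact: cvg_fst].
have c2 : continuous (fun x : plane R => z.2 - x.2 : R^o).
  by move=> x; apply: cvgB; [exact: cvg_cst | exact: cvg_snd].
by apply: cvgD; apply: cvgM; [exact: c1 | exact: c1 | exact: c2 | exact: c2].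
Qed.

Lemma nearest_point A z : compact A -> A !=set0 ->
  exists p, A p /\ forall z', A z' -> eucl_dist z p <= eucl_dist z z'.
Proof.
move=> cA A0.
have cf : {within A, continuous (fun z' : plane R => eucl_dist z z' : R)}.
  by apply: continuous_subspaceT; exact: eucl_continuous.
have [p pA hp] := compact_EVT_min A0 cA cf.
exists p; split; first by rewrite inE in pA.
by move=> z' Az'; have := hp z'; rewrite inE; exact.
Qed.

Lemma closed_compact A : compact A -> closed A.
Proof. by apply: compact_closed; exact: norm_hausdorff. Qed.

End Plane.

(** * Disk-polygons *)

Section Ngons.
Variables (R : realType) (C' : osym_disk R) (a : R).
Hypothesis a0 : 0 < a.

Definition unit_coords (A : set (plane R)) (x y : R) : Prop := A (a * x, a * y).

Lemma translateP (v z : plane R) : translate C' v z <-> osym_disk_set C' (z - v).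
Proof.
split=> [[x Cx <-]|h]; first by rewrite addrC addKr.
by exists (z - v) => //; rewrite addrC subrK.
Qed.

Lemma closed_translate v : closed (translate C' v).
Proof.
have -> : translate C' v = (fun z : plane R => z - v) @^-1` C'.
  by apply/seteqP; split => z /translateP.
have /continuous_closedP : continuous (fun z : plane R => z - v).
  by move=> z; apply: cvgB; [exact: cvg_id | exact: cvg_cst].
by apply; exact: osym_disk_closed.
Qed.

Lemma convex_translate v : convex2 (coords (translate C' v)).
Proof.
have [_ /convex_coords cC _] := osym_disk_convex C'.
have e x y : coords (translate C' v) x y <-> shifted (coords C') v.1 v.2 x y.
  by rewrite /coords translateP.
by move=> x1 y1 x2 y2 t t01 /e h1 /e h2; apply/e; exact: shift_convex2.
Qed.

Definition ctr (w : R * R) : plane R := (a * w.1, a * w.2).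

Lemma dilate_shift w :
  dilate a (shifted (unit_coords C') w.1 w.2) = translate C' (ctr w) :> set (plane R).
Proof.
have e (z : plane R) : (a * (z.1 / a - w.1), a * (z.2 / a - w.2)) = z - ctr w :> plane R.
  rewrite [RHS]surjective_pairing; congr (_, _).
    by rewrite mulrBr mulrC divfK ?gt_eqF.
  by rewrite mulrBr mulrC divfK ?gt_eqF.
by apply/seteqP; split => z; rewrite translateP -e.
Qed.

Lemma dilate_all_shifts m (v : 'I_m -> R * R) : dilate a (all_shifts (unit_coords C') v) =
  \bigcap_i translate C' (ctr (v i)) :> set (plane R).
Proof.
apply/seteqP; split => z h i.
  by move=> _; rewrite -dilate_shift; exact: h.
by have := h i; rewrite -dilate_shift; apply.
Qed.

Lemma ngon_all_shifts m A : ngon C' m A <-> exists v : 'I_m -> R * R, A = dilate a (all_shifts (unit_coords C') v).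
Proof.
split=> [[v ->]|[v ->]]; last by exists (ctr \o v); exact: dilate_all_shifts.
exists (fun i => ((v i).1 / a, (v i).2 / a)); rewrite dilate_all_shifts.
apply: eq_bigcapr => i _; congr (translate C' _).
by rewrite [LHS]surjective_pairing /ctr /= ![a * _]mulrC !divfK ?gt_eqF.
Qed.

Lemma spindle_convex_ngon m A : ngon C' m A -> spindle_convex C' A.
Proof.
move=> [v ->] p q Kp Kq z h i _; apply: h; split; [exact: Kp | exact: Kq].
Qed.

Lemma measurable_dilate_shift u v : measurable (dilate a (shifted (unit_coords C') u v)).
Proof.
have := dilate_shift (u, v); rewrite /= => ->.
by apply: closed_plane_measurable; exact: closed_translate.
Qed.

Variables (N : nat) (B St k1 kap khat E : R).
Hypothesis P : params_ok N B St k1 kap khat E.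
Variables (D Yt K0 Rr x0 : R) (C1 C : R -> R -> Prop).
Hypothesis H : body_ok N B St k1 khat E D Yt K0 Rr x0 C1 C (unit_coords C').
Hypothesis HS : support_ok N B St k1 kap khat D Yt K0 x0 C1.

Definition not_concave_at n := exists K : set (plane R), spindle_convex_disk C' K /\
  (max_inscribed_area C' n.-1 K + max_inscribed_area C' n.+1 K > 2%:E * max_inscribed_area C' n K)%E.

Lemma area_gap_disk : not_concave_at N.+2.
Proof.
have [u [w [r [c1 [c2 [hb hin hLK c12 [rE hL hQ]]]]]]] := area_gap P H HS a0 measurable_dilate_shift.
pose K : set (plane R) := dilate a (all_shifts (unit_coords C') u).
have nK : ngon C' N.+3 K by apply/ngon_all_shifts; exists u.
have Kcap : K = \bigcap_i translate C' (ctr (u i)) by exact: dilate_all_shifts.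
exists K; split.
  split; last exact: spindle_convex_ngon nK.
  split.
  - apply: (@compact_plane _ _ (a * (2 + 3 * qq N St))).
      by rewrite Kcap; apply: closed_bigI => i _; exact: closed_translate.
    have q1 := qq_ge P.
    have g z c : `|z / a| <= c -> c <= 2 + 3 * qq N St -> `|z| <= a * (2 + 3 * qq N St).
      move=> h1 h2; rewrite normrM normfV (gtr0_norm a0) ler_pdivrMr// mulrC in h1.
      by apply: le_trans h1 _; rewrite ler_pM2l.
    by move=> z /hb[h1 h2]; split; [apply: g h1 _ | apply: g h2 _]; lra.
  - apply/convex_coords => x1 y1 x2 y2 t t01; rewrite /coords Kcap => h1 h2 i _.
    by apply: (@convex_translate (ctr (u i))) => //; [exact: h1 | exact: h2].
  - have a4 : 0 < a / 4 by rewrite divr_gt0.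
    apply: (@interior_box _ _ 0 (a / 2) _ a4) => x y; rewrite subr0 => hx hy.
    have e : a / 4 = 1 / 4 * a by ring.
    apply: hin => /=.
      by rewrite normrM normfV (gtr0_norm a0) ler_pdivrMr//; lra.
    move: hy; rewrite ltr_norml => /andP[h1 h2].
    by rewrite ler_pdivlMr// ler_pdivrMr//; apply/andP; split; lra.
have up : (max_inscribed_area C' N.+2 K <= (r - c2)%:E)%E.
  apply: ge_ereal_sup => _ [A [/ngon_all_shifts[v ->] hAK] <-].
  apply: hQ => x y hxy.
  have := hAK (a * x, a * y); rewrite /K /dilate /= ![a * _]mulrC !mulfK ?gt_eqF//.
  exact.
have lo1 : (r%:E <= max_inscribed_area C' N.+3 K)%E.
  rewrite -rE; apply: ereal_sup_ubound; exists K => //; split => //; exact: subset_refl.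
have lo2 : ((r - c1)%:E <= max_inscribed_area C' N.+1 K)%E.
  apply: le_trans hL _; apply: ereal_sup_ubound; exists (dilate a (all_shifts (unit_coords C') w)) => //.
  split; first by apply/ngon_all_shifts; exists w.
  by move=> z; exact: (hLK (z.1 / a) (z.2 / a)).
rewrite /=; apply: (@le_lt_trans _ _ (2 * (r - c2))%:E).
  by rewrite EFinM lee_pmul2l// ?lte_fin.
apply: (@lt_le_trans _ _ ((r - c1)%:E + r%:E)%E); last exact: leeD.
by rewrite -EFinD lte_fin; lra.
Qed.

End Ngons.

(** * Neighbourhoods of a disk *)

Section Inflate.
Variable R : realType.
Implicit Types (A B : set (plane R)) (z c : plane R) (d m : R).

Lemma eucl_dist_le z c d : 0 <= d ->
  (eucl_dist z c <= d) = ((z.1 - c.1) ^+ 2 + (z.2 - c.2) ^+ 2 <= d ^+ 2).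
Proof.
move=> d0; rewrite -(@ler_pXn2r _ 2) ?nnegrE ?eucl_dist_ge0// sqr_sqrtr//.
by rewrite addr_ge0 ?sqr_ge0.
Qed.

(** The Minkowski sum with a Euclidean disc of radius [d]. *)
Definition inflate A d : set (plane R) := [set z | exists2 c, A c & eucl_dist c z <= d].

Lemma inflate_sub A d : 0 <= d -> A `<=` inflate A d.
Proof. by move=> d0 z Az; exists z => //; rewrite eucl_distxx. Qed.

Lemma inflate_inflate A d m : inflate (inflate A d) m `<=` inflate A (d + m).
Proof.
move=> z [c [c' Ac' h1] h2]; exists c' => //.
by apply: le_trans (eucl_dist_triangle c _ _) _; exact: lerD.
Qed.

Lemma compact_inflate A d : 0 <= d -> compact A -> compact (inflate A d).
Proof.
move=> d0 cA; pose disc : set (plane R) := [set z | eucl_dist 0 z <= d].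
have cdisc : compact disc.
  apply: (@compact_plane _ _ d).
    have /continuous_closedP := @eucl_continuous R 0.
    by move=> /(_ [set x | x <= d]); apply; exact: closed_le.
  move=> z dz; have : `|0 - z| <= d by apply: le_trans dz; exact: norm_le_eucl_dist.
  by rewrite sub0r normrN prod_normE ge_max => /andP[].
have -> : inflate A d = [set x.1 + x.2 | x in A `*` disc].
  apply/seteqP; split => z.
    move=> [c Ac h]; exists (c, z - c); last by rewrite /= addrC subrK.
    split => //=; rewrite /disc /= in h *; apply: le_trans h; rewrite le_eqVlt; apply/orP; left.
    by apply/eqP; congr Num.sqrt; rewrite /=; ring.
  move=> [[c y] [/= Ac dy] <-]; exists c => //; apply: le_trans dy.
  rewrite le_eqVlt; apply/orP; left.
  by apply/eqP; congr Num.sqrt; rewrite /=; ring.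
apply: continuous_compact; last exact: compact_setX.
apply: continuous_subspaceT => x; apply: cvgD; [exact: cvg_fst | exact: cvg_snd].
Qed.

Lemma convex_inflate A d : 0 <= d -> convex2 (coords A) -> convex2 (coords (inflate A d)).
Proof.
move=> d0 cA x1 y1 x2 y2 t t01 [[c1 c2] Ac h] [[c3 c4] Ac' h'].
exists ((1 - t) * c1 + t * c3, (1 - t) * c2 + t * c4); first exact: cA.
rewrite !eucl_dist_le//= in h h' *; move: t01 => /andP[t0 t1].
have s0 : 0 <= 1 - t by lra.
have g1 := ler_wpM2l s0 h; have g2 := ler_wpM2l t0 h'.
have g3 : 0 <= t * (1 - t) * ((c1 - x1 - (c3 - x2)) ^+ 2 + (c2 - y1 - (c4 - y2)) ^+ 2).
  by rewrite mulr_ge0 ?addr_ge0 ?sqr_ge0// mulr_ge0.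
lra.
Qed.

Lemma convex_disk_inflate A d : 0 <= d -> convex_disk A -> convex_disk (inflate A d).
Proof.
move=> d0 [cA /convex_coords vA iA]; split; first exact: compact_inflate.
  by apply/convex_coords; exact: convex_inflate.
by case: iA => z Az; exists z; apply: (interiorS (@inflate_sub A d d0)).
Qed.

Lemma sym_inflate A d : origin_symmetric A -> origin_symmetric (inflate A d).
Proof.
move=> sA; have AN z : A z -> A (- z) by move=> Az; rewrite -sA; exists z.
have IN z : inflate A d z -> inflate A d (- z).
  move=> [c /AN Ac h]; exists (- c) => //; apply: le_trans h.
  rewrite le_eqVlt; apply/orP; left.
  by apply/eqP; congr Num.sqrt; rewrite /=; ring.
apply/seteqP; split => [_ [z /IN h <-] //|z /IN h].
by exists (- z) => //; rewrite opprK.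
Qed.

Definition inflate_disk (C : osym_disk R) d (d0 : 0 <= d) : osym_disk R :=
  OsymDisk (convex_disk_inflate d0 (osym_disk_convex C)) (sym_inflate d (osym_disk_sym C)).

Lemma hausdorff_inflate A B d : A !=set0 -> 0 <= d -> A `<=` B -> B `<=` inflate A d ->
  hausdorff_dist A B <= d.
Proof.
move=> [a Aa] d0 AB BA; apply: hausdorff_dist_le.
- by exists a.
- by exists a; exact: AB.
- move=> z Az; apply: le_trans (inf_dist_le _ (AB _ Az)) _.
  by rewrite eucl_distxx.
- move=> z /BA[c Ac h]; apply: le_trans (inf_dist_le _ Ac) _.
  by rewrite eucl_dist_sym.
Qed.

Lemma hausdorff_sub_inflate A B d : compact A -> B !=set0 -> hausdorff_dist A B < d ->
  A `<=` inflate B d.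
Proof.
move=> cA B0 h z Az; apply: contrapT => hn.
have : d <= inf_dist z B.
  apply: inf_dist_ge => // b Bb; rewrite leNgt; apply/negP => hb; apply: hn.
  by exists b => //; rewrite eucl_dist_sym ltW.
have := inf_dist_le_hausdorff cA B0 Az; lra.
Qed.

(** First-order condition at the nearest point: were [s] positive, moving from [p] towards [c] by
    [t = s / q], or by [t = 1] if [q <= s], would come closer to [z]. *)
Lemma projection_obtuse A z p c : convex2 (coords A) -> A p -> A c ->
  (forall z', A z' -> eucl_dist z p <= eucl_dist z z') ->
  (z.1 - p.1) * (c.1 - p.1) + (z.2 - p.2) * (c.2 - p.2) <= 0.
Proof.
move=> cA Ap Ac hp; set s := _ + _; rewrite leNgt; apply/negP => s0.
pose q := (c.1 - p.1) ^+ 2 + (c.2 - p.2) ^+ 2.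
have key t : 0 < t <= 1 -> 2 * s <= t * q.
  move=> /andP[t0 t1]; have t01 : 0 <= t <= 1 by rewrite ltW.
  have Apt := cA p.1 p.2 c.1 c.2 t t01 _ _; rewrite -!coordsE in Apt.
  have := hp _ (Apt Ap Ac); rewrite /eucl_dist ler_sqrt ?addr_ge0 ?sqr_ge0//= => h.
  have : t * (2 * s) <= t * (t * q) by rewrite /s /q; lra.
  by rewrite ler_pM2l.
have [sq|qs] := leP q s; first by have := key 1; rewrite ltr01 lexx => /(_ isT); lra.
have q0 : 0 < q by lra.
have /key : 0 < s / q <= 1 by rewrite divr_gt0//= ler_pdivrMr// mul1r ltW.
by rewrite divfK ?gt_eqF//; lra.
Qed.

(* If z in A missed C, the point of A + m disc beyond z, away from the point of C
   nearest to z, would be farther than m from C. *)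
Lemma hausdorff_inflate_sub C A m : compact C -> @convex_set R (plane R) C -> C !=set0 ->
  compact A -> 0 <= m -> hausdorff_dist C (inflate A m) < m -> A `<=` C.
Proof.
move=> cC /convex_coords vC C0 cA m0 h z Az; apply: contrapT => nz.
have [p [Cp hp]] := nearest_point z cC C0.
pose d := eucl_dist z p.
have d2 : d ^+ 2 = (z.1 - p.1) ^+ 2 + (z.2 - p.2) ^+ 2.
  by rewrite sqr_sqrtr// addr_ge0 ?sqr_ge0.
have d0 : 0 < d.
  rewrite lt_neqAle eucl_dist_ge0 andbT eq_sym; apply/negP => /eqP dz; apply: nz.
  have e0 : `|z - p| <= 0 by rewrite -dz; exact: norm_le_eucl_dist.
  by move: e0; rewrite normr_le0 subr_eq0 => /eqP ->.
pose n1 := (z.1 - p.1) / d; pose n2 := (z.2 - p.2) / d.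
have n1d : n1 * d = z.1 - p.1 by rewrite divfK// gt_eqF.
have n2d : n2 * d = z.2 - p.2 by rewrite divfK// gt_eqF.
have nn : n1 ^+ 2 + n2 ^+ 2 = 1.
  have : (n1 ^+ 2 + n2 ^+ 2) * d ^+ 2 = 1 * d ^+ 2 by rewrite mul1r [RHS]d2 -n1d -n2d; ring.
  by apply: mulIf; rewrite expf_neq0// gt_eqF.
pose w : plane R := (z.1 + m * n1, z.2 + m * n2).
have Aw : inflate A m w.
  exists z => //; rewrite eucl_dist_le//= le_eqVlt; apply/orP; left; apply/eqP.
  by rewrite -[RHS]mulr1 -nn; ring.
have hw : m + d <= inf_dist w C.
  apply: inf_dist_ge => // c Cc.
  have ob := projection_obtuse vC Cp Cc hp.
  have h1 : m + d <= n1 * (w.1 - c.1) + n2 * (w.2 - c.2).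
    have : (m + d) * d <= (n1 * (w.1 - c.1) + n2 * (w.2 - c.2)) * d.
      have -> : (n1 * (w.1 - c.1) + n2 * (w.2 - c.2)) * d = m * d * (n1 ^+ 2 + n2 ^+ 2) +
         (n1 * d) * (z.1 - c.1) + (n2 * d) * (z.2 - c.2) by rewrite /w /=; ring.
      by rewrite nn n1d n2d mulrDl -expr2 d2; lra.
    by rewrite ler_pM2r.
  apply: le_trans h1 _; set x := w.1 - c.1; set y := w.2 - c.2.
  rewrite /eucl_dist -/x -/y; apply: le_trans (ler_norm _) _.
  rewrite -sqrtr_sqr ler_sqrt ?addr_ge0 ?sqr_ge0//.
  have g : (n1 * x + n2 * y) ^+ 2 = (n1 ^+ 2 + n2 ^+ 2) * (x ^+ 2 + y ^+ 2) - (n1 * y - n2 * x) ^+ 2.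
    by ring.
  by rewrite g nn mul1r; have := sqr_ge0 (n1 * y - n2 * x); lra.
have := inf_dist_le_hausdorff (compact_inflate m0 cA) C0 Aw.
by rewrite hausdorff_dist_sym; lra.
Qed.

End Inflate.

(** * Density *)

Section Generic.
Variables (R : realType) (C0 : osym_disk R) (N : nat) (ep : R).
Hypothesis N2 : (2 <= N)%N.
Hypothesis ep0 : 0 < ep.

Let C0s : set (plane R) := C0.

Local Tactic Notation "lra_with" ne_hyp_list(hs) :=
  clear - hs R C0 N ep N2 ep0 C0s; lra.

Lemma osym_opp (C : osym_disk R) (z : plane R) : osym_disk_set C z -> osym_disk_set C (- z).
Proof. by move=> Cz; rewrite -(osym_disk_sym C); exists z. Qed.

Lemma eucl_dist_linear (c z : plane R) (d : R) : 0 <= d -> eucl_dist c z <= d ->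
  forall p q, p ^+ 2 + q ^+ 2 = 1 -> p * z.1 + q * z.2 <= p * c.1 + q * c.2 + d.
Proof.
move=> d0; rewrite eucl_dist_le// => h p q pq.
set x := c.1 - z.1 in h; set y := c.2 - z.2 in h.
have g : (p * x + q * y) ^+ 2 <= d ^+ 2.
  apply: le_trans h; rewrite -[leRHS]mul1r -pq.
  by have := sqr_ge0 (p * y - q * x); lra.
have := ler_wsqrtr g; rewrite !sqrtr_sqr (ger0_norm d0) ler_norml => /andP[h1 h2].
by rewrite /x /y in h1 h2; lra.
Qed.

(** [Cs] is [C0] inflated by [del] with two caps cut off; it still contains [C0]. The approximating
    disk is not [Cs] but [Cs] inflated by [m], which makes the perturbation one-sided: every disk
    within [m] of it contains [Cs] ([hausdorff_inflate_sub]) and lies within [2 * m] of it, as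
    [body_ok] requires. *)
Lemma dense_not_concave : exists (Cst : osym_disk R) (m : R),
  [/\ 0 < m, hausdorff_dist C0 Cst < ep &
      forall C' : osym_disk R, hausdorff_dist Cst C' < m -> not_concave_at C' N.+2].
Proof.
pose del := ep / 4; have d0 : 0 < del by rewrite divr_gt0.
have c0 := @osym_disk_compact R C0; have n0 := osym_disk_nonempty C0.
pose C1d := inflate_disk C0 (ltW d0); pose C1s : set (plane R) := C1d.
have c1 : compact C1s := @osym_disk_compact R C1d.
have [b [b0 hb]] := compact_plane_bound c1.
(* The parameters depend on the size [b] of the inflated disk; afterwards the unit [a] is chosen so
   that the radius [del] measures [D] units. *)
have [B [St [k1 [kap [khat [E [D [P kh0 DL]]]]]]]] := params_exist N2 d0 (ltW b0).
have D0 := d_D0 DL; have B0 := pB0 P.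
pose a := del / D; have a0 : 0 < a by rewrite divr_gt0.
have aD : a * D = del by rewrite divfK// gt_eqF.
have dv (x : R) : a * (x / a) = x by rewrite mulrC divfK// gt_eqF.
have vd (x : R) : a * x / a = x by rewrite mulrC mulKf// gt_eqF.
have [t [Ct ht]] := compact_max 0 1 c0 n0.
have {}ht z : C0s z -> z.2 <= t.2 by move=> /ht; rewrite !mul0r !mul1r !add0r.
pose Yt := (t.2 + del) / a; pose x0 := t.1 / a; pose Rr := b / a.
pose K0 := rho N St ^+ 2 / D.
pose C1 := unit_coords a C1s.
have akey (X : R) : (a ^+ 2 * X <= (a * D) ^+ 2) = (X <= D ^+ 2).
  by rewrite (exprMn 2 a D) ler_pM2l// exprn_gt0.
have disc_dist (c : plane R) (x y : R) : in_disc (c.1 / a) (c.2 / a) D x y <->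
    eucl_dist c (a * x, a * y) <= del.
  rewrite eucl_dist_le ?(ltW d0)// /in_disc /= -aD.
  have -> : (c.1 - a * x) ^+ 2 + (c.2 - a * y) ^+ 2 =
     a ^+ 2 * ((x - c.1 / a) ^+ 2 + (y - c.2 / a) ^+ 2) by field; rewrite gt_eqF.
  by rewrite akey.
have C1top x y : C1 x y -> y <= Yt.
  move=> [c Cc h]; rewrite ler_pdivlMr// mulrC.
  have pq : 0 ^+ 2 + 1 ^+ 2 = 1 :> R by rewrite expr0n expr1n add0r.
  have := eucl_dist_linear (ltW d0) h pq; rewrite !mul0r !mul1r !add0r /= => h2.
  by have := ht _ Cc; lra.
have C1sym x y : C1 x y -> C1 (- x) (- y).
  move=> h; have := @osym_opp C1d (a * x, a * y) h.
  rewrite /C1 /unit_coords /C1s !mulrN; exact.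
have C1wide x y : C1 x y -> `|x| <= Rr.
  move=> /hb[/= h _]; rewrite normrM (gtr0_norm a0) in h.
  by rewrite ler_pdivlMr// mulrC.
have C1disc (c : plane R) x y : C0s c -> in_disc (c.1 / a) (c.2 / a) D x y -> C1 x y.
  by move=> Cc /disc_dist h; exists c.
have tin : C1 x0 (t.2 / a).
  by apply: (C1disc t) => //; rewrite /in_disc !subrr !expr0n add0r sqr_ge0.
have K00 : 0 <= K0 by rewrite divr_ge0 ?sqr_ge0// ltW.
have Rr0 : 0 <= Rr by rewrite divr_ge0// ltW.
have d3 := d_D3 DL; rewrite -/K0 -/a -/Rr in d3.
have BR : 0 <= B * Rr by rewrite mulr_ge0// ltW.
have small : K0 + 2 * (B * Rr) <= D by lra.
pose cap x y := capset B x0 (Yt - K0) x y /\ capset B x0 (Yt - K0) (- x) (- y).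
pose Cs : set (plane R) := [set z | C1s z /\ cap (z.1 / a) (z.2 / a)].
have C0cap x y : C0s (a * x, a * y) -> capset B x0 (Yt - K0) x y.
  move=> h; have hx : `|x| <= Rr.
    by apply: (C1wide x y); apply: (inflate_sub (ltW d0)).
  have hx0 := C1wide _ _ tin.
  have hy : y <= Yt - D.
    rewrite /Yt lerBrDr ler_pdivlMr// mulrDl [D * a]mulrC aD mulrC.
    by have := ht _ h; rewrite /=; lra.
  have g1 : `|B * x| <= B * Rr by rewrite normrM gtr0_norm// ler_pM2l.
  have g2 : `|B * x0| <= B * Rr by rewrite normrM gtr0_norm// ler_pM2l.
  move: g1 g2; rewrite !ler_norml => /andP[g1 g2] /andP[g3 g4].
  by split; lra.
have C0Cs : C0s `<=` Cs.
  move=> z Cz; split; first exact: (inflate_sub (ltW d0)).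
  split; apply: C0cap; rewrite ?mulrN !dv.
    by rewrite -surjective_pairing.
  by have := @osym_opp C0 z Cz.
have CsC1 : Cs `<=` C1s by move=> z [].
have closed_cap : closed [set z : plane R | cap (z.1 / a) (z.2 / a)].
  have hp c p q (X : set (plane R)) : X = [set z | c + (p * z.1 + q * z.2) <= 0] -> closed X.
    by move=> ->; exact: closed_half_plane.
  have -> : [set z : plane R | cap (z.1 / a) (z.2 / a)] =
    [set z | (- (Yt - K0)) + (0 * z.1 + a^-1 * z.2) <= 0] `&`
    ([set z | (- (Yt - K0 + B * x0 + B / 2)) + (B / a * z.1 + a^-1 * z.2) <= 0] `&`
    ([set z | (- (Yt - K0 - B * x0 + B / 2)) + (- (B / a) * z.1 + a^-1 * z.2) <= 0] `&`
    ([set z | (- (Yt - K0)) + (0 * z.1 + - a^-1 * z.2) <= 0] `&`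
    ([set z | (- (Yt - K0 + B * x0 + B / 2)) + (- (B / a) * z.1 + - a^-1 * z.2) <= 0] `&`
     [set z | (- (Yt - K0 - B * x0 + B / 2)) + (B / a * z.1 + - a^-1 * z.2) <= 0])))).
    apply/seteqP; split => z /=; rewrite /cap /capset.
      move=> [[h1 h2 h3] [h4 h5 h6]]; do 5 (split; first by lra_with h1 h2 h3 h4 h5 h6); lra_with h1 h2 h3 h4 h5 h6.
    move=> [h1 [h2 [h3 [h4 [h5 h6]]]]]; split; split; lra_with h1 h2 h3 h4 h5 h6.
  by do 5 (apply: closedI; first exact: closed_half_plane); exact: closed_half_plane.
have cCs : compact Cs.
  apply: (@compact_plane _ _ b); last by move=> z /CsC1 /hb.
  by apply: closedI => //; exact: closed_compact.
have convC1 : convex2 C1.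
  have [_ /convex_coords v1 _] := osym_disk_convex C1d.
  move=> x1 y1 x2 y2 s s01 h1 h2; rewrite /C1 /unit_coords.
  have := v1 _ _ _ _ s s01 h1 h2; rewrite /coords /C1s.
  by rewrite !mulrDr ![a * (_ * _)]mulrCA.
have convcap x1 y1 x2 y2 s : 0 <= s <= 1 -> capset B x0 (Yt - K0) x1 y1 ->
    capset B x0 (Yt - K0) x2 y2 ->
    capset B x0 (Yt - K0) ((1 - s) * x1 + s * x2) ((1 - s) * y1 + s * y2).
  move=> /andP[s0 s1] [h1 h2 h3] [h4 h5 h6]; have s0' : 0 <= 1 - s by lra_with s1.
  have g1 := ler_wpM2l s0' h1; have g2 := ler_wpM2l s0' h2; have g3 := ler_wpM2l s0' h3.
  have g4 := ler_wpM2l s0 h4; have g5 := ler_wpM2l s0 h5; have g6 := ler_wpM2l s0 h6.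
  by split; lra_with g4 g1 g5 g2 g6 g3.
have convCs : @convex_set R (plane R) Cs.
  apply/convex_coords => x1 y1 x2 y2 s s01 [h1 [h2 h3]] [h4 [h5 h6]]; split.
    have [_ /convex_coords v1 _] := osym_disk_convex C1d.
    by apply: v1 => //; exact: h1.
  have e u v : ((1 - s) * u + s * v) / a = (1 - s) * (u / a) + s * (v / a) by ring.
  have e' u v : - (((1 - s) * u + s * v) / a) = (1 - s) * - (u / a) + s * - (v / a) by ring.
  by split; rewrite /= ?e'; rewrite ?e; apply: convcap.
have intCs : Cs° !=set0.
  by have [_ _ [z Iz]] := osym_disk_convex C0; exists z; exact: (interiorS C0Cs).
have symCs : origin_symmetric Cs.
  have h z : Cs z -> Cs (- z).
    move=> [h1 [h2 h3]]; split; first exact: (@osym_opp C1d).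
    by split; rewrite /= !mulNr ?opprK.
  apply/seteqP; split => [_ [z /h hz <-] //|z /h hz].
  by exists (- z) => //; rewrite opprK.
have dCs : convex_disk Cs by split.
pose Cd := OsymDisk dCs symCs.
(* The first bound keeps the total change below [ep]; the second turns [2 * m] into a perturbation
   of at most [khat] units. *)
pose m := Num.min del (a * khat / 2).
have m0 : 0 < m by rewrite lt_min d0 divr_gt0// mulr_gt0.
have md : m <= del by rewrite ge_min lexx.
have mk : m <= a * khat / 2 by rewrite ge_min lexx orbT.
exists (inflate_disk Cd (ltW m0)), m; split => //.
  apply: (@le_lt_trans _ _ (del + m)); last by rewrite /del in md *; lra.
  apply: hausdorff_inflate => //; first by lra.
    by apply: subset_trans C0Cs _; exact: (inflate_sub (ltW m0)).
  by move=> z [c /CsC1 hc h]; apply: inflate_inflate; exists c.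
move=> C' hC'.
have nCs : Cs !=set0 := osym_disk_nonempty Cd.
have cC' := @osym_disk_compact R C'; have nC' := osym_disk_nonempty C'.
have CsC' : Cs `<=` C'.
  have [_ vC' _] := osym_disk_convex C'.
  apply: (hausdorff_inflate_sub cC' vC' nC' cCs (ltW m0)).
  by rewrite hausdorff_dist_sym.
have C'Cs : C' `<=` inflate Cs (m + m).
  apply: subset_trans (@inflate_inflate _ Cs m m).
  apply: hausdorff_sub_inflate => //; first exact: osym_disk_nonempty (inflate_disk Cd (ltW m0)).
  by rewrite hausdorff_dist_sym.
apply: (@area_gap_disk _ C' a a0 N B St k1 kap khat E P D Yt K0 Rr x0 C1 (unit_coords a Cs)).
  split.
  - exact: convC1.
  - move=> x y [c Cc h]; exists (c.1 / a), (c.2 / a); split; first exact/disc_dist.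
    by move=> x' y'; exact: C1disc.
  - exact: D0.
  - exact: (d_D1 DL).
  - exact: (d_D2 DL).
  - by have := d_D3 DL; rewrite -/K0 -/a -/Rr.
  - exact: (d_D4 DL).
  - exact: K00.
  - exact: C1top.
  - exact: C1wide.
  - exact: (C1wide _ _ tin).
  - move=> x y; rewrite /unit_coords /Cs /= /cap !vd.
    by split=> [[h1 [h2 h3]]|[h1 h2 h3]].
  - by move=> x y h; exact: CsC'.
  - move=> x y /C'Cs[c hc h].
    exists (c.1 / a), (c.2 / a).
    have hn : `|c - (a * x, a * y)| <= a * khat.
      by apply: le_trans (norm_le_eucl_dist _ _) _; lra_with h mk.
    rewrite prod_normE ge_max /= in hn; move: hn => /andP[h1 h2].
    have e (u v : R) : `|u - a * v| <= a * khat -> `|u / a - v| <= khat.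
      have -> : u - a * v = a * (u / a - v) by field; rewrite gt_eqF.
      by rewrite normrM gtr0_norm// ler_pM2l.
    split; [|exact: e|exact: e].
    by rewrite /unit_coords !dv -surjective_pairing.
split.
- move=> p q pq; have [c [Cc hc]] := compact_max p q c0 n0.
  exists (c.1 / a), (c.2 / a); split; first by move=> x y; exact: C1disc.
  move=> x y [c' Cc' h].
  have := eucl_dist_linear (ltW d0) h pq; have := hc _ Cc' => h1 /= h2.
  have h3 : a * (p * x + q * y) <= a * (p * (c.1 / a) + q * (c.2 / a) + D).
    have -> : a * (p * (c.1 / a) + q * (c.2 / a) + D) = p * c.1 + q * c.2 + a * D.
      by field; rewrite gt_eqF.
    by rewrite aD; lra_with h2 h1.
  by rewrite ler_pM2l in h3.
- by move=> x y /C1sym /C1top h; lra_with h.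
- move=> x y h; apply: (C1disc t) => //.
  by rewrite -/x0 (_ : t.2 / a = Yt - D)// /Yt -aD; field; rewrite gt_eqF.
- by rewrite /K0 mulrC divfK// gt_eqF.
- exact: (d_kap DL).
Qed.

End Generic.

Theorem theorem3 (R : realType) :
  exists S : set (osym_disk R), residual S /\
    forall C : osym_disk R, S C ->
      forall n : nat, (4 <= n)%N ->
        exists K : set (plane R), spindle_convex_disk C K /\
          (max_inscribed_area C n.-1 K + max_inscribed_area C n.+1 K
             > 2%:E * max_inscribed_area C n K)%E.
Proof.
(* One set for each number of translates from 4 on; index [n] corresponds to a chain of [n.+2]
   edges. *)
pose F n : set (osym_disk R) := [set C | not_concave_at C n.+4].
exists (\bigcap_i F i); split; last first.
  move=> C hC n n4; have := hC (n - 4)%N I; rewrite /F /= -[(n - 4).+4]addn4 subnK//.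
exists F => // n O [C0 OC0] oO.
have /nbhs_ballP[ep /= ep0 hep] : nbhs C0 O by exact: open_nbhs_nbhs.
have [Cst [m [m0 h1 h2]]] := @dense_not_concave R C0 n.+2 ep isT ep0.
exists Cst; split; first by apply: hep; rewrite ballEmdist /= osym_disk_mdistE.
apply/nbhs_ballP; exists m => //= C'; rewrite ballEmdist /= osym_disk_mdistE.
Qed.
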